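(* Let $q\in\mathcal{L}_2[0,L]$, $H\in\mathbb{C}$, $x\in[0,L)$. Then \[ T(\rho,x)=\frac{\sin(\rho(x-L))}{\rho}+\frac{1}{2\rho\sin(\rho(x-L))}\sum_{n=0}^{\infty}t_n(x)\Bigl(\operatorname{sinc}\Bigl(\tfrac{2\rho(x-L)}{\pi}-2n-1\Bigr)+\operatorname{sinc}\Bigl(\tfrac{2\rho(x-L)}{\pi}+2n+1\Bigr)\Bigr), \] \[ t_n(x)=\frac{(-1)^n(2n+1)\pi}{x-L}T\Bigl(\frac{(2n+1)\pi}{2(x-L)},x\Bigr)-2,\quad n\ge0, \] and \[ \psi(\rho,x)=\rho(x-L)\,j_1(\rho(L-x))+\sum_{n=0}^{\infty}\psi_n(x)\Bigl(\operatorname{sinc}\Bigl(\tfrac{\rho(x-L)}{\pi}-n\Bigr)+\operatorname{sinc}\Bigl(\tfrac{\rho(x-L)}{\pi}+n\Bigr)\Bigr), \] \[ \psi_0(x)=\tfrac12\psi(0,x),\qquad\psi_n(x)=\psi\Bigl(\frac{n\pi}{x-L},x\Bigr)-(-1)^n,\ n\ge1. \] The series converge uniformly on every compact subset of the complex $\rho$-plane, and for $\rho\in\mathbb{R}$ they converge absolutely, uniformly, and in $\mathcal{L}_2(\mathbb{R})$.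
   Context: Let $L>0$, $q$ complex valued, $H\in\mathbb{C}$. $T(\rho,x)$, $\psi(\rho,x)$ are the solutions of $-y''+q(x)y=\rho^2y$ on $(0,L)$ with $T(\rho,L)=0,T'(\rho,L)=1$ and $\psi(\rho,L)=1,\psi'(\rho,L)=-H$. $\operatorname{sinc}(z)=\frac{\sin\pi z}{\pi z}$, $\operatorname{sinc}(0)=1$; $j_1(z)=\frac{\sin z}{z^2}-\frac{\cos z}{z}$. *)

(* Defs.v *)
From HB Require Import structures.
From mathcomp Require Import all_boot all_order all_algebra.
From mathcomp Require Import all_classical all_reals all_analysis.
From mathcomp Require Import complex.
Set Implicit Arguments. Unset Strict Implicit. Unset Printing Implicit Defensive.
Import Order.TTheory GRing.Theory Num.Theory.
Import numFieldNormedType.Exports.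
Local Open Scope classical_set_scope.
Local Open Scope ring_scope.
Local Open Scope complex_scope.

Section Defs.
Variable R : realType.
Implicit Types (z : R[i]) (a b : R).

Definition cabs z : R := Normc.normc z.

Definition rcosh a : R := (expR a + expR (- a)) / 2.
Definition rsinh a : R := (expR a - expR (- a)) / 2.

Definition csin z : R[i] :=
  (sin (complex.Re z) * rcosh (complex.Im z)) +i* (cos (complex.Re z) * rsinh (complex.Im z)).
Definition ccos z : R[i] :=
  (cos (complex.Re z) * rcosh (complex.Im z)) -i* (sin (complex.Re z) * rsinh (complex.Im z)).

Definition csinc z : R[i] :=
  if z == 0 then 1 else csin (pi%:C * z) / (pi%:C * z).

(** spherical Bessel j_1(z) = sin z / z^2 - cos z / z (value 0 at z = 0,
    the removable singularity; only ever multiplied by a factor vanishing there) *)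
Definition sph_j1 z : R[i] :=
  if z == 0 then 0 else csin z / z ^+ 2 - ccos z / z.

Definition cintegrable a b (f : R -> R[i]) : Prop :=
  (lebesgue_measure.-integrable `[a, b] (EFin \o (fun t => complex.Re (f t))))%E /\
  (lebesgue_measure.-integrable `[a, b] (EFin \o (fun t => complex.Im (f t))))%E.

Definition cint a b (f : R -> R[i]) : R[i] :=
  (\int[lebesgue_measure]_(t in `[a, b]) complex.Re (f t))%R
  +i* (\int[lebesgue_measure]_(t in `[a, b]) complex.Im (f t))%R.

Definition cL2 a b (q : R -> R[i]) : Prop :=
  measurable_fun `[a, b] (fun t => complex.Re (q t)) /\
  measurable_fun `[a, b] (fun t => complex.Im (q t)) /\
  (lebesgue_measure.-integrable `[a, b] (EFin \o (fun t => ((complex.Re (q t)) ^+ 2)%R)))%E /\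
  (lebesgue_measure.-integrable `[a, b] (EFin \o (fun t => ((complex.Im (q t)) ^+ 2)%R)))%E.

(** y is a (Caratheodory) solution on [0,L] of  -y'' + q y = rho^2 y  with
    derivative y1: y and y1 are absolutely continuous, y' = y1 and
    y1' = (q - rho^2) y a.e., written in integrated form from the point L. *)
Definition is_solution (L : R) (q : R -> R[i]) (rho : R[i])
    (y y1 : R -> R[i]) : Prop :=
  cintegrable 0 L y1 /\
  cintegrable 0 L (fun t => (q t - rho ^+ 2) * y t) /\
  forall x, 0 <= x <= L ->
    y x = y L - cint x L y1 /\
    y1 x = y1 L - cint x L (fun t => (q t - rho ^+ 2) * y t).

Definition psum (u : nat -> R[i] -> R[i]) (N : nat) (z : R[i]) : R[i] :=
  \sum_(n < N) u n z.

Definition series_unif_on (u : nat -> R[i] -> R[i]) (F : R[i] -> R[i])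
    (K : set R[i]) : Prop :=
  forall e : R, 0 < e -> exists N0 : nat, forall N : nat, (N0 <= N)%N ->
    forall z, K z -> cabs (psum u N z - F z) < e.

(** The convergence properties claimed for the series with sum F:
    uniform on every compact subset of C (equivalently on every closed disk),
    and for real rho: absolute, uniform on R, and in L_2(R). *)
Definition series_props (u : nat -> R[i] -> R[i]) (F : R[i] -> R[i]) : Prop :=
  (forall r : R, 0 < r -> series_unif_on u F [set z | cabs z <= r]) /\
  (forall t : R, exists l : R, forall e : R, 0 < e -> exists N0 : nat,
      forall N : nat, (N0 <= N)%N ->
        `| (\sum_(n < N) cabs (u n t%:C)) - l | < e) /\
  series_unif_on u F [set z | complex.Im z = 0] /\
  (forall e : R, 0 < e -> exists N0 : nat, forall N : nat, (N0 <= N)%N ->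
      (\int[lebesgue_measure]_(t in [set: R])
          (((cabs (psum u N t%:C - F t%:C)) ^+ 2)%R)%:E < e%:E)%E).

Definition t_coef (T : R[i] -> R -> R[i]) (L x : R) (n : nat) : R[i] :=
  (- 1) ^+ n * ((n.*2.+1)%:R * pi)%:C / (x - L)%:C
    * T (((n.*2.+1)%:R * pi / (2 * (x - L)))%:C) x - 2.

Definition T_term (T : R[i] -> R -> R[i]) (L x : R) (n : nat) (rho : R[i])
  : R[i] :=
  t_coef T L x n *
   (csinc (2 * rho * (x - L)%:C / pi%:C - (n.*2.+1)%:R)
    + csinc (2 * rho * (x - L)%:C / pi%:C + (n.*2.+1)%:R)).

Definition psi_coef (psi : R[i] -> R -> R[i]) (L x : R) (n : nat) : R[i] :=
  if n == 0%N then psi 0 x / 2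
  else psi ((n%:R * pi / (x - L))%:C) x - (- 1) ^+ n.

Definition psi_term (psi : R[i] -> R -> R[i]) (L x : R) (n : nat) (rho : R[i])
  : R[i] :=
  psi_coef psi L x n *
   (csinc (rho * (x - L)%:C / pi%:C - n%:R)
    + csinc (rho * (x - L)%:C / pi%:C + n%:R)).

End Defs.

(* Main.v *)
Require Import Defs.
From HB Require Import structures.
From mathcomp Require Import all_boot all_order all_algebra.
From mathcomp Require Import all_classical all_reals all_analysis.
From mathcomp Require Import measurable_realfun complex ring lra.
Set Implicit Arguments. Unset Strict Implicit. Unset Printing Implicit Defensive.
Import Order.TTheory GRing.Theory Num.Theory.
Import numFieldNormedType.Exports.
Local Open Scope ring_scope.
Local Open Scope complex_scope.

(** A solution y(rho, .) with rho-independent data at L satisfies the Volterra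
    equation with kernel sin (rho (t - x)) / rho, so y(rho, t) is, as a function
    of rho, a superposition of the cosines cos (rho u), 0 <= u <= L - t, of
    bounded total mass. This is used in dual form, which survives the Volterra
    iteration without constructing a transmutation kernel: every linear
    combination of values of y(., t) is bounded by the sup over u in [0, L - t]
    of the same combination of values of cos (. u) ([cosine_type]). Both
    2 rho sin (rho (x - L)) T - 2 sin^2 (rho (x - L)) and
    psi - cos z + sin z / z, z = rho (L - x), inherit the property, with intervals
    of length 2 (L - x) and L - x. Applied to the combination "value at rho minus N-th
    cardinal sum", the bound reduces the sampling formula for these functions to
    the one for cosines, uniformly in u; that one is the limit of the finite
    trigonometric interpolation formula on 2K + 1 points. The Volterra equation
    also shows that the sampled values are O(1/n), and the convergence statements
    on the real line follow from

      1 / (a b) = (1 / a + 1 / b) / (a + b),  a = n + 1, b = 1 + |w - n|,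

    which bounds the tails by C N^(-1/8) (1 + |w|)^(-3/4). *)

(** Cosines are the right class because both series pair the nodes n and -n: sinc (w - n) + sinc (w
    + n) has common denominator w^2 - n^2 and is O(1/n^2), so the cardinal series of cos (w u)
    converges although its samples cos (n u) do not decay, and it does so up to and including the
    critical frequency u = pi. The closed endpoint is essential, since the cosines that make up the
    sampled functions fill the whole closed frequency interval. The factor 2 rho sin (rho (x - L))
    vanishes at every second node, which is why only odd indices occur for T, and the subtracted 2
    sin^2 cancels the free term of the Volterra equation. For psi, the function sin z / z is its own
    cardinal term of index 0, so adding it to psi - cos z changes that single coefficient. Estimates
    are made in strips |Im rho| <= r because the Volterra kernel grows exponentially in |Im rho|.
    The O(1/n^2) bound is not uniform in w; on the whole real line it is replaced by the decay of
    the samples combined with that of each single sinc. *)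

(** * The complex modulus *)

Section ComplexModulus.
Context {R : realType}.
Implicit Types (z w : R[i]) (a b r : R).

Lemma cabsE z : cabs z = Num.sqrt (complex.Re z ^+ 2 + complex.Im z ^+ 2).
Proof. by case: z. Qed.

Lemma cabs_ge0 z : 0 <= cabs z.
Proof. by rewrite cabsE; exact: sqrtr_ge0. Qed.

Lemma cabsM z w : cabs (z * w) = cabs z * cabs w.
Proof. exact: Normc.normcM. Qed.

Lemma cabsD z w : cabs (z + w) <= cabs z + cabs w.
Proof. exact: (@le_normcD R z w). Qed.

Lemma cabsN z : cabs (- z) = cabs z.
Proof. exact: (@normcN R z). Qed.

Lemma cabsB z w : cabs (z - w) <= cabs z + cabs w.
Proof. by rewrite -(cabsN w) cabsD. Qed.

Lemma cabsC z w : cabs (z - w) = cabs (w - z).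
Proof. by rewrite -cabsN opprB. Qed.

Lemma cabs_real a : cabs a%:C = `|a|.
Proof. by rewrite cabsE /= expr0n addr0 sqrtr_sqr. Qed.

Lemma cabs0 : cabs (0 : R[i]) = 0.
Proof. exact: Normc.normc0. Qed.

Lemma cabs1 : cabs (1 : R[i]) = 1.
Proof. exact: Normc.normc1. Qed.

Lemma cabs_eq0 z : (cabs z == 0) = (z == 0).
Proof.
by apply/eqP/eqP => [/Normc.eq0_normc //|->]; exact: cabs0.
Qed.

Lemma cabs_gt0 z : (0 < cabs z) = (z != 0).
Proof. by rewrite lt_def cabs_ge0 andbT cabs_eq0. Qed.

Lemma cabsV z : cabs z^-1 = (cabs z)^-1.
Proof. exact: Normc.normcV. Qed.

Lemma cabsX z n : cabs (z ^+ n) = cabs z ^+ n.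
Proof.
by elim: n => [|n IH]; rewrite ?expr0 ?cabs1 // !exprS cabsM IH.
Qed.

Lemma cabs_nat n : cabs (n%:R : R[i]) = n%:R.
Proof. by rewrite -[n%:R](rmorph_nat (real_complex R)) cabs_real ger0_norm. Qed.

Lemma cabs_sum (I : Type) (s : seq I) (P : pred I) (f : I -> R[i]) :
  cabs (\sum_(i <- s | P i) f i) <= \sum_(i <- s | P i) cabs (f i).
Proof.
elim/big_rec2: _ => [|i x z _ le]; first by rewrite cabs0.
by rewrite (le_trans (cabsD _ _)) // lerD2l.
Qed.

Lemma cabs_triangle y z w : cabs (z - w) <= cabs (z - y) + cabs (y - w).
Proof. by apply: le_trans (cabsD _ _); rewrite addrA subrK. Qed.

Lemma Re_le_cabs z : `|complex.Re z| <= cabs z.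
Proof. by rewrite cabsE -sqrtr_sqr ler_wsqrtr // lerDl sqr_ge0. Qed.

Lemma Im_le_cabs z : `|complex.Im z| <= cabs z.
Proof. by rewrite cabsE -sqrtr_sqr ler_wsqrtr // lerDr sqr_ge0. Qed.

Lemma cabs_le_ReIm z : cabs z <= `|complex.Re z| + `|complex.Im z|.
Proof.
rewrite {1}[z]complexE (le_trans (cabsD _ _)) // cabsM !cabs_real.
by rewrite [cabs 'i]cabsE /= expr0n add0r expr1n sqrtr1 mul1r.
Qed.

Lemma cReD z w : complex.Re (z + w) = complex.Re z + complex.Re w.
Proof. by case: z; case: w. Qed.
Lemma cImD z w : complex.Im (z + w) = complex.Im z + complex.Im w.
Proof. by case: z; case: w. Qed.
Lemma cReN z : complex.Re (- z) = - complex.Re z.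
Proof. by case: z. Qed.
Lemma cImN z : complex.Im (- z) = - complex.Im z.
Proof. by case: z. Qed.
Lemma cReM z w : complex.Re (z * w) =
  complex.Re z * complex.Re w - complex.Im z * complex.Im w.
Proof. by case: z; case: w. Qed.
Lemma cImM z w : complex.Im (z * w) =
  complex.Re z * complex.Im w + complex.Im z * complex.Re w.
Proof. by case: z; case: w. Qed.

Lemma complex_eq z w : complex.Re z = complex.Re w ->
  complex.Im z = complex.Im w -> z = w.
Proof. by case: z; case: w => /= ? ? ? ? -> ->. Qed.

Lemma natCE n : (n%:R : R[i]) = (n%:R)%:C.
Proof. by rewrite rmorph_nat. Qed.

End ComplexModulus.

(** * Addition formulas and growth of the complex sine and cosine *)

Section ComplexTrigonometry.
Context {R : realType}.
Implicit Types (z w : R[i]) (a b r : R).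

Lemma rcoshD a b :
  rcosh (a + b) = rcosh a * rcosh b + rsinh a * rsinh b.
Proof. by rewrite /rcosh /rsinh opprD !expRD; field. Qed.

Lemma rsinhD a b :
  rsinh (a + b) = rsinh a * rcosh b + rcosh a * rsinh b.
Proof. by rewrite /rcosh /rsinh opprD !expRD; field. Qed.

Lemma rcoshN a : rcosh (- a) = rcosh a.
Proof. by rewrite /rcosh opprK addrC. Qed.

Lemma rsinhN a : rsinh (- a) = - rsinh a.
Proof. by rewrite /rsinh opprK -mulNr opprB. Qed.

Lemma rcosh0 : rcosh (0 : R) = 1.
Proof. by rewrite /rcosh oppr0 expR0; field. Qed.

Lemma rsinh0 : rsinh (0 : R) = 0.
Proof. by rewrite /rsinh oppr0 subrr mul0r. Qed.

Lemma csinD z w : csin (z + w) = csin z * ccos w + ccos z * csin w.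
Proof.
by apply: complex_eq; rewrite ?(cReD, cImD, cReM, cImM) /= cReD cImD ?sinD ?cosD
  ?rcoshD ?rsinhD; ring.
Qed.

Lemma ccosD z w : ccos (z + w) = ccos z * ccos w - csin z * csin w.
Proof.
by apply: complex_eq; rewrite ?(cReD, cImD, cReM, cImM, cReN, cImN) /= cReD cImD
  ?sinD ?cosD ?rcoshD ?rsinhD; ring.
Qed.

Lemma csinN z : csin (- z) = - csin z.
Proof.
by apply: complex_eq; rewrite /= ?(cReN, cImN) /= ?sinN ?cosN ?rcoshN ?rsinhN; ring.
Qed.

Lemma ccosN z : ccos (- z) = ccos z.
Proof.
by apply: complex_eq; rewrite /= ?(cReN, cImN) /= ?sinN ?cosN ?rcoshN ?rsinhN;
  ring.
Qed.

Lemma csin_real a : csin a%:C = (sin a)%:C.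
Proof. by apply: complex_eq; rewrite /= ?rcosh0 ?rsinh0 ?mulr1 ?mulr0. Qed.

Lemma ccos_real a : ccos a%:C = (cos a)%:C.
Proof. by apply: complex_eq; rewrite /= ?rcosh0 ?rsinh0 ?mulr1 ?mulr0 ?oppr0. Qed.

Lemma csin0 : csin (0 : R[i]) = 0.
Proof. by rewrite (csin_real 0) sin0. Qed.

Lemma ccos0 : ccos (0 : R[i]) = 1.
Proof. by rewrite (ccos_real 0) cos0. Qed.

Lemma csinB z w : csin (z - w) = csin z * ccos w - ccos z * csin w.
Proof. by rewrite csinD csinN ccosN mulrN. Qed.

Lemma ccosB z w : ccos (z - w) = ccos z * ccos w + csin z * csin w.
Proof. by rewrite ccosD csinN ccosN mulrN opprK. Qed.

Lemma ccos2Dcsin2 z : ccos z ^+ 2 + csin z ^+ 2 = 1.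
Proof. by rewrite !expr2 -ccosB subrr ccos0. Qed.

Lemma expR_norm_ge a : expR a <= expR `|a|.
Proof. by rewrite ler_expR ler_norm. Qed.

Lemma expRN_norm_ge a : expR (- a) <= expR `|a|.
Proof. by rewrite ler_expR -normrN ler_norm. Qed.

Lemma rcosh_ge1 a : 1 <= rcosh a.
Proof.
rewrite /rcosh; have u0 := expR_gt0 a; have : expR a * expR (- a) = 1.
  by rewrite -expRD subrr expR0.
move: u0; move: (expR a) (expR (- a)) => u v u0 uv.
have v0 : 0 < v by rewrite -(pmulr_rgt0 _ u0) uv.
have : (u - v) ^+ 2 >= 0 by rewrite sqr_ge0.
nra.
Qed.

Lemma rcosh_le a : rcosh a <= expR `|a|.
Proof.
have h1 := expR_norm_ge a; have h2 := expRN_norm_ge a; rewrite /rcosh; lra.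
Qed.

Lemma rsinh_le a : `|rsinh a| <= expR `|a|.
Proof.
have h1 := expR_norm_ge a; have h2 := expRN_norm_ge a; have h3 := expR_gt0 a.
have h4 := expR_gt0 (- a); rewrite /rsinh ler_norml; apply/andP; split; lra.
Qed.

Lemma norm_trig_hyp_le (s h e : R) : `|s| <= 1 -> `|h| <= e ->
  `|s * h| <= e.
Proof. by move=> hs hh; rewrite normrM -[leRHS]mul1r ler_pM. Qed.

Lemma rcosh_norm_le a : `|rcosh a| <= expR `|a|.
Proof. by rewrite (ger0_norm (le_trans ler01 (rcosh_ge1 _))) rcosh_le. Qed.

Lemma cabs_csin_le z : cabs (csin z) <= 2 * expR `|complex.Im z|.
Proof.
apply: le_trans (cabs_le_ReIm _) _; rewrite mulr_natl mulr2n.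
by apply: lerD; apply: norm_trig_hyp_le;
  rewrite ?sin_max ?cos_max ?rcosh_norm_le ?rsinh_le.
Qed.

Lemma cabs_ccos_le z : cabs (ccos z) <= 2 * expR `|complex.Im z|.
Proof.
apply: le_trans (cabs_le_ReIm _) _; rewrite mulr_natl mulr2n.
apply: lerD; last rewrite [complex.Im _]/(- _) normrN;
  by apply: norm_trig_hyp_le;
  rewrite ?sin_max ?cos_max ?rcosh_norm_le ?rsinh_le.
Qed.

Lemma csin_natpi n : csin (n%:R * pi)%:C = 0 :> R[i].
Proof.
elim: n => [|n IH]; first by rewrite mul0r csin0.
rewrite -natr1 mulrDl mul1r rmorphD csinD IH mul0r add0r.
by rewrite (csin_real pi) sinpi mulr0.
Qed.

Lemma ccos_natpi n : ccos (n%:R * pi)%:C = (- 1) ^+ n :> R[i].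
Proof.
elim: n => [|n IH]; first by rewrite mul0r ccos0 expr0.
rewrite -natr1 mulrDl mul1r rmorphD ccosD IH csin_natpi mul0r subr0.
by rewrite (ccos_real pi) cospi exprSr rmorphN1.
Qed.

Lemma ccosM z w : ccos z * ccos w = (ccos (z + w) + ccos (z - w)) / 2.
Proof. by rewrite ccosD ccosB; field. Qed.

End ComplexTrigonometry.

Local Open Scope classical_set_scope.

(** * Real Lebesgue integrals over closed intervals *)

Section RealIntegral.
Context {R : realType}.
Local Notation mu := (@lebesgue_measure R).
Implicit Types (a b c k u v w : R) (f g h : R -> R).

Definition rintegrable a b f := (mu.-integrable `[a, b] (EFin \o f))%E.
Definition rint a b f : R := (\int[mu]_(t in `[a, b]) f t)%R.

Lemma eq_rintegrable a b f g : (forall t, a <= t <= b -> f t = g t) ->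
  rintegrable a b f -> rintegrable a b g.
Proof.
move=> fg; apply: eq_integrable => //= t /set_mem; rewrite /= in_itv /= => tab.
by rewrite fg.
Qed.

Lemma eq_rint a b f g : (forall t, a <= t <= b -> f t = g t) ->
  rint a b f = rint a b g.
Proof.
move=> fg; apply: eq_Rintegral => t /set_mem; rewrite /= in_itv /= => tab.
by rewrite fg.
Qed.

Lemma rintegrable_sub a b u v f : a <= u -> v <= b ->
  rintegrable a b f -> rintegrable u v f.
Proof.
move=> au vb; apply: integrableS => //.
by apply: subset_itvScc; rewrite bnd_simp.
Qed.

Lemma rintegrableD a b f g : rintegrable a b f -> rintegrable a b g ->
  rintegrable a b (fun t => f t + g t).
Proof. by move=> fi gi; apply: (integrableD _ fi gi). Qed.

Lemma rintegrableB a b f g : rintegrable a b f -> rintegrable a b g ->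
  rintegrable a b (fun t => f t - g t).
Proof. by move=> fi gi; apply: (integrableB _ fi gi). Qed.

Lemma rintegrableZ a b k f : rintegrable a b f ->
  rintegrable a b (fun t => k * f t).
Proof. by move=> fi; apply: (integrableZl _ k fi). Qed.

Lemma rintegrable_norm a b f : rintegrable a b f ->
  rintegrable a b (fun t => `|f t|).
Proof. by move=> fi; apply: integrable_norm. Qed.

Lemma rintegrable_cont a b f : continuous f -> rintegrable a b f.
Proof.
move=> cf; apply: continuous_compact_integrable; first exact: segment_compact.
exact: continuous_subspaceT.
Qed.

Lemma rintegrable_mul_bounded a b k f h : measurable_fun `[a, b] h ->
  (forall t, a <= t <= b -> `|h t| <= k) -> rintegrable a b f ->
  rintegrable a b (fun t => h t * f t).
Proof.
move=> mh hk fi; have bh : [bounded h t | t in `[a, b]%classic].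
  exists k; split; first by rewrite num_real.
  move=> m km t /=; rewrite in_itv /= => tab.
  exact: le_trans (hk t tab) (ltW km).
exact: (@integrableMr _ (measurableTypeR R) R mu _ _ h (EFin \o f) mh bh fi).
Qed.

Lemma rintD a b f g : rintegrable a b f -> rintegrable a b g ->
  rint a b (fun t => f t + g t) = rint a b f + rint a b g.
Proof. by move=> fi gi; rewrite /rint RintegralD. Qed.

Lemma rintB a b f g : rintegrable a b f -> rintegrable a b g ->
  rint a b (fun t => f t - g t) = rint a b f - rint a b g.
Proof. by move=> fi gi; rewrite /rint RintegralB. Qed.

Lemma rintZ a b k f : rintegrable a b f ->
  rint a b (fun t => k * f t) = k * rint a b f.
Proof. by move=> fi; rewrite /rint RintegralZl. Qed.

Lemma rint_cst a b k : a <= b -> rint a b (fun=> k) = k * (b - a).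
Proof.
move=> ab; rewrite /rint Rintegral_cst //.
congr (_ * _); have mE := @lebesgue_measure_itv R (`[a, b]%O); move: mE => /= mE.
transitivity (fine (if (a%:E < b%:E)%E then (b%:E - a%:E)%E else 0%E : \bar R)); 
 first by congr fine; exact: mE.
by rewrite lte_fin; case: ltgtP ab => // -> _; rewrite subrr.
Qed.

Lemma le_rint a b f g : rintegrable a b f -> rintegrable a b g ->
  (forall t, a <= t <= b -> f t <= g t) -> rint a b f <= rint a b g.
Proof.
move=> fi gi fg; apply: le_Rintegral => // t /=; rewrite in_itv /=; exact: fg.
Qed.

Lemma norm_rint a b f : rintegrable a b f ->
  `|rint a b f| <= rint a b (fun t => `|f t|).
Proof. by move=> fi; apply: le_normr_Rintegral. Qed.

Lemma rint_split u v w f : u <= v -> v <= w -> rintegrable u w f ->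
  rint u w f = rint u v f + rint v w f.
Proof.
move=> uv vw fi; apply/eqP; rewrite addrC -subr_eq; apply/eqP.
rewrite /rint Rintegral_itvB ?bnd_simp //.
rewrite Rintegral_itv_obnd_cbnd //; apply: integrableS fi => //.
by apply: subset_itvr; rewrite bnd_simp.
Qed.

Lemma rint1 a f : rint a a f = 0.
Proof. by rewrite /rint set_itv1 Rintegral_set1. Qed.

Lemma rint_derive a b f g : a <= b ->
  (forall t : R, is_derive t 1 f (g t)) -> continuous g ->
  rint a b g = f b - f a.
Proof.
rewrite le_eqVlt => /predU1P[-> _ _|ab fg cg]; first by rewrite rint1 subrr.
have cf : continuous f.
  by move=> t; apply: differentiable_continuous; apply/derivable1_diffP; apply: ex_derive.
rewrite /rint /Rintegral (@continuous_FTC2 _ g f a b) //.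
- exact: continuous_subspaceT.
- split => [t _||]; first exact: ex_derive.
  + by apply: cvg_at_right_filter; exact: cf.
  + by apply: cvg_at_left_filter; exact: cf.
- by move=> t _; rewrite derive1E; apply: derive_val.
Qed.

Lemma rint_parameter_continuous a b f : a <= b -> rintegrable a b f ->
  {within `[a, b], continuous (fun t => rint a t f)}.
Proof. by move=> ab fi; apply: parameterized_integral_continuous. Qed.

End RealIntegral.

(** * Componentwise calculus for complex-valued functions of a real variable *)

Section ComplexIntegral.
Context {R : realType}.
Implicit Types (a b u v w r : R) (f g h : R -> R[i]) (k : R[i]).

Lemma cintE a b f : cint a b f = rint a b (fun t => complex.Re (f t)) +i*
  rint a b (fun t => complex.Im (f t)).
Proof. by []. Qed.

Lemma eq_cintegrable a b f g : (forall t, a <= t <= b -> f t = g t) ->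
  cintegrable a b f -> cintegrable a b g.
Proof.
by move=> fg [fr fi]; split; [move: fr|move: fi]; apply: eq_rintegrable => t tab;
  rewrite fg.
Qed.

Lemma eq_cint a b f g : (forall t, a <= t <= b -> f t = g t) ->
  cint a b f = cint a b g.
Proof. by move=> fg; rewrite !cintE; congr Complex; apply: eq_rint => t tab; rewrite fg. Qed.

Lemma cintegrable_sub a b u v f : a <= u -> v <= b ->
  cintegrable a b f -> cintegrable u v f.
Proof. by move=> au vb [fr fi]; split; [exact: (rintegrable_sub au vb fr)|exact: (rintegrable_sub au vb fi)]. Qed.

Lemma cintegrableD a b f g : cintegrable a b f -> cintegrable a b g ->
  cintegrable a b (fun t => f t + g t).
Proof.
move=> [fr fi] [gr gi]; split;
  [move: (rintegrableD fr gr)|move: (rintegrableD fi gi)];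
  by apply: eq_rintegrable => t _; rewrite ?cReD ?cImD.
Qed.

Lemma cintD a b f g : cintegrable a b f -> cintegrable a b g ->
  cint a b (fun t => f t + g t) = cint a b f + cint a b g.
Proof.
move=> [fr fi] [gr gi]; rewrite !cintE; apply: complex_eq; rewrite /= ?cReD ?cImD /=.
  by rewrite -rintD //; apply: eq_rint => t _; rewrite cReD.
by rewrite -rintD //; apply: eq_rint => t _; rewrite cImD.
Qed.

Lemma cintegrableZ a b k f : cintegrable a b f ->
  cintegrable a b (fun t => k * f t).
Proof.
move=> [fr fi]; split.
  move: (rintegrableB (rintegrableZ (complex.Re k) fr) (rintegrableZ (complex.Im k) fi)).
  by apply: eq_rintegrable => t _; rewrite cReM.
move: (rintegrableD (rintegrableZ (complex.Re k) fi) (rintegrableZ (complex.Im k) fr)).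
by apply: eq_rintegrable => t _; rewrite cImM.
Qed.

Lemma cintZ a b k f : cintegrable a b f ->
  cint a b (fun t => k * f t) = k * cint a b f.
Proof.
move=> [fr fi]; rewrite !cintE; apply: complex_eq; rewrite ?cReM ?cImM /=.
  rewrite -!rintZ // -rintB; try exact: rintegrableZ.
  by apply: eq_rint => t _; rewrite cReM.
rewrite -!rintZ // -rintD; try exact: rintegrableZ.
by apply: eq_rint => t _; rewrite cImM.
Qed.

Lemma cintegrableB a b f g : cintegrable a b f -> cintegrable a b g ->
  cintegrable a b (fun t => f t - g t).
Proof.
move=> fi gi; move: (cintegrableD fi (cintegrableZ (-1) gi)).
by apply: eq_cintegrable => t _; rewrite mulN1r.
Qed.

Lemma cintB a b f g : cintegrable a b f -> cintegrable a b g ->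
  cint a b (fun t => f t - g t) = cint a b f - cint a b g.
Proof.
move=> fi gi; rewrite -mulN1r -cintZ // -cintD //; last exact: cintegrableZ.
by apply: eq_cint => t _; rewrite mulN1r.
Qed.

Lemma cintegrable_sum a b n (f : nat -> R -> R[i]) :
  (forall i, (i < n)%N -> cintegrable a b (f i)) ->
  cintegrable a b (fun t => \sum_(i < n) f i t).
Proof.
elim: n => [_|n IH fi].
  have h : rintegrable a b (fun=> 0) by apply: rintegrable_cont => t; exact: cvg_cst.
  have h0 : cintegrable a b (fun=> 0 : R[i]) by split.
  by apply: eq_cintegrable h0 => t _; rewrite big_ord0.
move: (cintegrableD (IH (fun i ni => fi i (ltnW ni))) (fi n (leqnn _))).
by apply: eq_cintegrable => t _; rewrite big_ord_recr.
Qed.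

Lemma cint0 a b : cint a b (fun=> 0) = 0 :> R[i].
Proof.
by rewrite cintE /rint /Rintegral /=; congr Complex; rewrite integral0.
Qed.

Lemma cint_sum a b n (f : nat -> R -> R[i]) :
  (forall i, (i < n)%N -> cintegrable a b (f i)) ->
  cint a b (fun t => \sum_(i < n) f i t) = \sum_(i < n) cint a b (f i).
Proof.
elim: n => [_|n IH fi].
  by rewrite big_ord0 -[RHS](cint0 a b); apply: eq_cint => t _; rewrite big_ord0.
have fi' i : (i < n)%N -> cintegrable a b (f i) by move/ltnW; exact: fi.
rewrite big_ord_recr /= -IH // -cintD //; [|exact: cintegrable_sum|exact: fi].
by apply: eq_cint => t _; rewrite big_ord_recr.
Qed.

Lemma cint_split u v w f : u <= v -> v <= w -> cintegrable u w f ->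
  cint u w f = cint u v f + cint v w f.
Proof.
move=> uv vw [fr fi]; rewrite !cintE; apply: complex_eq; rewrite ?cReD ?cImD /=;
  exact: rint_split.
Qed.

(** Real and imaginary parts are estimated separately, whence the factor 2; it reappears in most
    later constants and is harmless, since only the existence of bounds matters. *)
Lemma cabs_cint_le a b f (g : R -> R) : cintegrable a b f -> rintegrable a b g ->
  (forall t, a <= t <= b -> cabs (f t) <= g t) ->
  cabs (cint a b f) <= 2 * rint a b g.
Proof.
move=> [fr fi] gi fg; apply: le_trans (cabs_le_ReIm _) _.
rewrite mulr_natl mulr2n cintE /=; apply: lerD.
  apply: le_trans (norm_rint fr) _; apply: le_rint => //.
    exact: rintegrable_norm.
  by move=> t tab; apply: le_trans (fg t tab); exact: Re_le_cabs.
apply: le_trans (norm_rint fi) _; apply: le_rint => //.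
  exact: rintegrable_norm.
by move=> t tab; apply: le_trans (fg t tab); exact: Im_le_cabs.
Qed.

Lemma cabs_cint_le_cst a b f r : a <= b -> cintegrable a b f ->
  (forall t, a <= t <= b -> cabs (f t) <= r) ->
  cabs (cint a b f) <= 2 * (r * (b - a)).
Proof.
move=> ab fi fr; rewrite -rint_cst //; apply: cabs_cint_le => //.
by apply: rintegrable_cont => t; exact: cvg_cst.
Qed.

Definition cmeasurable a b f :=
  measurable_fun `[a, b] (fun t => complex.Re (f t)) /\
  measurable_fun `[a, b] (fun t => complex.Im (f t)).

Definition ccontinuous f :=
  continuous (fun t => complex.Re (f t)) /\ continuous (fun t => complex.Im (f t)).

Definition cderivative f f' := forall t : R,
  is_derive t 1 (fun s => complex.Re (f s)) (complex.Re (f' t)) /\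
  is_derive t 1 (fun s => complex.Im (f s)) (complex.Im (f' t)).

Lemma ccontinuous_measurable a b f : ccontinuous f -> cmeasurable a b f.
Proof.
by case=> fr fi; split; apply: measurable_funTS; apply: continuous_measurable_fun.
Qed.

Lemma cintegrable_cont a b f : ccontinuous f -> cintegrable a b f.
Proof. by case=> fr fi; split; apply: rintegrable_cont. Qed.

Lemma cintegrable_mul_bounded a b r f h : cmeasurable a b h ->
  (forall t, a <= t <= b -> cabs (h t) <= r) -> cintegrable a b f ->
  cintegrable a b (fun t => h t * f t).
Proof.
move=> [mr mi] hr [fr fi].
have hRe t : a <= t <= b -> `|complex.Re (h t)| <= r.
  by move=> /hr; apply: le_trans; exact: Re_le_cabs.
have hIm t : a <= t <= b -> `|complex.Im (h t)| <= r.
  by move=> /hr; apply: le_trans; exact: Im_le_cabs.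
split.
  move: (rintegrableB (rintegrable_mul_bounded mr hRe fr)
    (rintegrable_mul_bounded mi hIm fi)).
  by apply: eq_rintegrable => t _; rewrite cReM.
move: (rintegrableD (rintegrable_mul_bounded mr hRe fi)
    (rintegrable_mul_bounded mi hIm fr)).
by apply: eq_rintegrable => t _; rewrite cImM.
Qed.

Lemma cderivative_continuous f f' : cderivative f f' -> ccontinuous f.
Proof.
by move=> ff'; split=> t; have [fr fi] := ff' t; apply: differentiable_continuous;
  apply/derivable1_diffP; apply: ex_derive.
Qed.

Lemma cint_derivative a b f f' : a <= b -> cderivative f f' -> ccontinuous f' ->
  cint a b f' = f b - f a.
Proof.
move=> ab ff' [cr ci]; rewrite cintE; apply: complex_eq; rewrite ?cReD ?cImD ?cReN ?cImN /=.
  have dr (t : R) : is_derive t 1 (fun s : R => complex.Re (f s)) (complex.Re (f' t)).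
    by have [] := ff' t.
  exact: (rint_derive ab dr cr).
have di (t : R) : is_derive t 1 (fun s : R => complex.Im (f s)) (complex.Im (f' t)).
  by have [] := ff' t.
exact: (rint_derive ab di ci).
Qed.

Lemma eq_cderivative f g f' g' : (forall t, f t = g t) -> (forall t, f' t = g' t) ->
  cderivative f f' -> cderivative g g'.
Proof. by move=> /funext -> /funext ->. Qed.

Lemma cderivativeZ k f f' : cderivative f f' ->
  cderivative (fun t => k * f t) (fun t => k * f' t).
Proof.
move=> ff' t; have [fr fi] := ff' t; split.
  under eq_fun do rewrite cReM.
  by apply: is_derive_eq; rewrite cReM /GRing.scale /=; ring.
under eq_fun do rewrite cImM.
by apply: is_derive_eq; rewrite cImM /GRing.scale /=; ring.
Qed.

End ComplexIntegral.

(** * Sine, cosine and sin (k s) / k along real lines *)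

Section TrigonometricDerivatives.
Context {R : realType}.
Implicit Types (a b t x s r : R) (k : R[i]).

(** The solution of -y'' = k^2 y with value 0 and derivative 1 at s = 0, extended by its limit at k
    = 0, so that the Volterra equation has one form for all k. *)
Definition cshc k s : R[i] := if k == 0 then s%:C else csin (k * s%:C) / k.

Lemma cshcE k s : k * cshc k s = csin (k * s%:C).
Proof.
rewrite /cshc; have [->|k0] := eqVneq k 0; first by rewrite !mul0r csin0.
by rewrite mulrC mulfVK.
Qed.

Lemma cshc0 k : cshc k 0 = 0.
Proof. by rewrite /cshc mulr0 csin0 mul0r; case: ifP. Qed.

Lemma is_derive_affine_comp (f f' : R -> R) a x t :
  (forall s : R, is_derive s 1 f (f' s)) ->
  is_derive t 1 (fun s : R => f (a * (s - x))) (a * f' (a * (t - x))).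
Proof.
move=> ff'.
have dh : is_derive t (1 : R) (fun s : R => a * (s - x)) a.
  by apply: is_derive_eq; rewrite /GRing.scale /= subr0 mulr1.
have df := ff' (a * (t - x)).
have := @is_derive1_comp R f (fun s : R => a * (s - x)) t _ _ df dh.
by rewrite mulrC.
Qed.

Lemma is_derive_rcosh t : is_derive t 1 (@rcosh R) (rsinh t).
Proof.
rewrite /rcosh /rsinh; apply: is_derive_eq.
by rewrite /GRing.scale /=; ring.
Qed.

Lemma is_derive_rsinh t : is_derive t 1 (@rsinh R) (rcosh t).
Proof.
rewrite /rcosh /rsinh; apply: is_derive_eq.
by rewrite /GRing.scale /=; ring.
Qed.

Lemma cRe_mulr k s : complex.Re (k * s%:C) = complex.Re k * s.
Proof. by rewrite cReM /= mulr0 subr0. Qed.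

Lemma cIm_mulr k s : complex.Im (k * s%:C) = complex.Im k * s.
Proof. by rewrite cImM /= mulr0 add0r. Qed.

Lemma cderivative_csin k x :
  cderivative (fun t => csin (k * (t - x)%:C)) (fun t => k * ccos (k * (t - x)%:C)).
Proof.
move=> t; set a := complex.Re k; set b := complex.Im k.
have ds := is_derive_affine_comp a x t (fun s => is_derive_sin s).
have dc := is_derive_affine_comp a x t (fun s => is_derive_cos s).
have dsh := is_derive_affine_comp b x t is_derive_rsinh.
have dch := is_derive_affine_comp b x t is_derive_rcosh.
split.
  have -> : (fun s : R => complex.Re (csin (k * (s - x)%:C))) =
      (fun s : R => sin (a * (s - x)) * rcosh (b * (s - x))).
    by apply/funext => s; rewrite /csin /= cRe_mulr cIm_mulr.
  apply: is_derive_eq; rewrite cReM /= cRe_mulr cIm_mulr -/a -/b /GRing.scale /=.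
  ring.
have -> : (fun s : R => complex.Im (csin (k * (s - x)%:C))) =
    (fun s : R => cos (a * (s - x)) * rsinh (b * (s - x))).
  by apply/funext => s; rewrite /csin /= cRe_mulr cIm_mulr.
apply: is_derive_eq; rewrite cImM /= cRe_mulr cIm_mulr -/a -/b /GRing.scale /=.
ring.
Qed.

Lemma cderivative_ccos k x :
  cderivative (fun t => ccos (k * (t - x)%:C)) (fun t => - k * csin (k * (t - x)%:C)).
Proof.
move=> t; set a := complex.Re k; set b := complex.Im k.
have ds := is_derive_affine_comp a x t (fun s => is_derive_sin s).
have dc := is_derive_affine_comp a x t (fun s => is_derive_cos s).
have dsh := is_derive_affine_comp b x t is_derive_rsinh.
have dch := is_derive_affine_comp b x t is_derive_rcosh.
split.
  have -> : (fun s : R => complex.Re (ccos (k * (s - x)%:C))) =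
      (fun s : R => cos (a * (s - x)) * rcosh (b * (s - x))).
    by apply/funext => s; rewrite /ccos /= cRe_mulr cIm_mulr.
  apply: is_derive_eq; rewrite cReM cReN cImN /= cRe_mulr cIm_mulr -/a -/b.
  rewrite /GRing.scale /=; ring.
have -> : (fun s : R => complex.Im (ccos (k * (s - x)%:C))) =
    (fun s : R => - (sin (a * (s - x)) * rsinh (b * (s - x)))).
  by apply/funext => s; rewrite /ccos /= cRe_mulr cIm_mulr.
apply: is_derive_eq; rewrite cImM cReN cImN /= cRe_mulr cIm_mulr -/a -/b.
rewrite /GRing.scale /=; ring.
Qed.

Lemma cderivative_cshc k x :
  cderivative (fun t => cshc k (t - x)) (fun t => ccos (k * (t - x)%:C)).
Proof.
have [->|k0] := eqVneq k 0.
  move=> t; rewrite mul0r ccos0; split.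
    have -> : (fun s : R => complex.Re (cshc 0 (s - x))) = (fun s : R => s - x).
      by apply/funext => s; rewrite /cshc eqxx.
    by apply: is_derive_eq; rewrite subr0.
  have -> : (fun s : R => complex.Im (cshc 0 (s - x))) = (fun s : R => 0).
    by apply/funext => s; rewrite /cshc eqxx.
  exact: is_derive_cst.
apply: eq_cderivative (cderivativeZ k^-1 (cderivative_csin k x)) => t.
  by rewrite /cshc (negbTE k0) mulrC.
by rewrite mulKf.
Qed.

Lemma ccontinuous_ccos k x : ccontinuous (fun t => ccos (k * (t - x)%:C)).
Proof. exact: cderivative_continuous (cderivative_ccos k x). Qed.

Lemma ccontinuousZ k (f : R -> R[i]) : ccontinuous f -> ccontinuous (fun t => k * f t).
Proof.
move=> [fr fi]; split=> t.
  under eq_fun do rewrite cReM.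
  by apply: cvgB; apply: cvgM; by [exact: cvg_cst|exact: fr|exact: fi].
under eq_fun do rewrite cImM.
by apply: cvgD; apply: cvgM; by [exact: cvg_cst|exact: fr|exact: fi].
Qed.

Lemma ccontinuous_csin k x : ccontinuous (fun t => csin (k * (t - x)%:C)).
Proof. exact: cderivative_continuous (cderivative_csin k x). Qed.

Lemma cabs_ccos_strip r k s : `|complex.Im k| <= r ->
  cabs (ccos (k * s%:C)) <= 2 * expR (r * `|s|).
Proof.
move=> kr; apply: le_trans (cabs_ccos_le _) _.
by rewrite ler_pM2l // ler_expR cIm_mulr normrM ler_wpM2r.
Qed.

Lemma cabs_csin_strip r k s : `|complex.Im k| <= r ->
  cabs (csin (k * s%:C)) <= 2 * expR (r * `|s|).
Proof.
move=> kr; apply: le_trans (cabs_csin_le _) _.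
by rewrite ler_pM2l // ler_expR cIm_mulr normrM ler_wpM2r.
Qed.

(** This form exhibits the Volterra kernel as a superposition of cosines of frequency at most s, and
    yields bounds that stay finite as k tends to 0. *)
Lemma cshc_cint k s : 0 <= s -> cshc k s = cint 0 s (fun t => ccos (k * t%:C)).
Proof.
move=> s0; have := cint_derivative s0 (cderivative_cshc k 0) (ccontinuous_ccos k 0).
rewrite subr0 subrr cshc0 subr0 => <-.
by apply: eq_cint => t _; rewrite subr0.
Qed.

Lemma cabs_cshc_strip r k s : 0 <= r -> `|complex.Im k| <= r -> 0 <= s ->
  cabs (cshc k s) <= 4 * s * expR (r * s).
Proof.
move=> r0 kr s0; rewrite cshc_cint //.
have -> : 4 * s * expR (r * s) = 2 * (2 * expR (r * s) * (s - 0)) by ring.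
apply: cabs_cint_le_cst => // [|t /andP[t0 ts]].
  by apply: eq_cintegrable (cintegrable_cont _ _ (ccontinuous_ccos k 0)) => t _; rewrite subr0.
apply: le_trans (cabs_ccos_strip _ kr) _.
by rewrite ler_pM2l // ler_expR ler_wpM2l // ger0_norm.
Qed.

End TrigonometricDerivatives.

(** * Integration by parts for absolutely continuous functions *)

Section IntegrationByParts.
Context {R : realType}.
Implicit Types (a b u v t x s r : R) (k : R[i]) (f g : R -> R[i]).

(* The increments of D are of second order, so summing them over a uniform
   subdivision gives 0; this replaces Fubini in the integration by parts. *)
Lemma second_order_increments_eq a b (D : R -> R[i]) (m : R -> R) : a <= b ->
  (forall u v, a <= u -> u <= v -> v <= b ->
     cabs (D v - D u) <= (v - u) * (m v - m u)) -> D b = D a.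
Proof.
move=> ab Dm; apply/eqP; rewrite -subr_eq0 -cabs_eq0.
suff H (n : nat) : cabs (D b - D a) * n.+1%:R <= (b - a) * (m b - m a).
  apply/negPn/negP => c0; have c1 : 0 < cabs (D b - D a) by rewrite lt_def c0 cabs_ge0.
  set K := (b - a) * (m b - m a) in H.
  have := H (Num.bound (K / cabs (D b - D a))).
  have : K / cabs (D b - D a) < (Num.bound (K / cabs (D b - D a)))%:R.
    apply: archi_boundP; rewrite divr_ge0 ?cabs_ge0 //.
    by apply: le_trans (H 0); rewrite mulr1 cabs_ge0.
  rewrite ltr_pdivrMr // mulrC => lt1 le1.
  suff : K < K by rewrite ltxx.
  apply: lt_le_trans lt1 (le_trans _ le1).
  by rewrite ler_wpM2l ?cabs_ge0 ?ler_nat.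
set h := (b - a) / n.+1%:R.
have h0 : 0 <= h by rewrite divr_ge0 // subr_ge0.
have step (k : nat) : (k <= n.+1)%N ->
    cabs (D (a + k%:R * h) - D a) <= h * (m (a + k%:R * h) - m a).
  elim: k => [_|k IH kn]; first by rewrite mul0r addr0 !subrr cabs0 mulr0.
  have e : a + k.+1%:R * h - (a + k%:R * h) = h by rewrite -natr1; ring.
  have kb : a + k.+1%:R * h <= b.
    rewrite -lerBrDl /h mulrA ler_pdivrMr ?ltr0Sn // mulrC ler_wpM2l ?subr_ge0 //.
    by rewrite ler_nat.
  have k1 : a <= a + k%:R * h by rewrite lerDl mulr_ge0.
  have k2 : a + k%:R * h <= a + k.+1%:R * h by rewrite -subr_ge0 e.
  have := Dm _ _ k1 k2 kb; rewrite e => Dk.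
  apply: le_trans (cabs_triangle (D (a + k%:R * h)) _ _) _.
  by move: (lerD Dk (IH (ltnW kn))); rewrite -mulrDr subrKA.
have := step n.+1 (leqnn _).
have -> : a + n.+1%:R * h = b by rewrite /h mulrC divfK ?pnatr_eq0 // addrC subrK.
move/(ler_wpM2r (ler0n R n.+1)); rewrite mulrAC.
by rewrite /h divfK ?pnatr_eq0.
Qed.

(** Absolute continuity with density [f'], anchored at the right endpoint as in [is_solution]. *)
Definition cprimitive a b f f' := cintegrable a b f' /\
  forall x, a <= x <= b -> f x = f b - cint x b f'.

Lemma cprimitive_sub a b f f' x : a <= x <= b -> cprimitive a b f f' ->
  cprimitive x b f f'.
Proof.
move=> /andP[ax xb] [fi fE]; split; first exact: cintegrable_sub fi.
by move=> t /andP[xt tb]; apply: fE; rewrite tb (le_trans ax).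
Qed.

Lemma cprimitiveB a b f f' u v : a <= u -> u <= v -> v <= b ->
  cprimitive a b f f' -> f v - f u = cint u v f'.
Proof.
move=> au uv vb [fi fE]; rewrite (fE u) ?(fE v) ?au ?vb ?(le_trans au) ?(le_trans uv) //.
rewrite (@cint_split _ u v b) //; last exact: cintegrable_sub fi.
ring.
Qed.

Lemma cprimitive_bounded a b f f' : cprimitive a b f f' ->
  exists M, forall t, a <= t <= b -> cabs (f t) <= M.
Proof.
move=> [fi fE]; pose N t := `|complex.Re (f' t)| + `|complex.Im (f' t)|.
have iN : rintegrable a b N.
  by case: fi => fr fi; apply: rintegrableD; exact: rintegrable_norm.
exists (cabs (f b) + 2 * rint a b N) => t /andP[at_ tb].
rewrite fE ?at_ ?tb // (le_trans (cabsB _ _)) // lerD2l.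
apply: (le_trans (@cabs_cint_le _ t b f' N _ _ _)).
- exact: cintegrable_sub fi.
- exact: rintegrable_sub iN.
- by move=> s _; exact: cabs_le_ReIm.
rewrite ler_pM2l // (@rint_split _ a t b) // lerDr.
by apply: Rintegral_ge0 => s _; rewrite addr_ge0.
Qed.

Lemma cprimitive_measurable a b f f' : cprimitive a b f f' -> cmeasurable a b f.
Proof.
have [ab|ba _] := leP a b; last first.
  by rewrite /cmeasurable set_itv_ge ?bnd_simp -?ltNge //; split; exact: measurable_fun_set0.
move=> [[fr fi] fE].
(* Re-anchoring at [a] makes t the upper limit, in which the integral is known to be continuous. *)
have fE' t : a <= t <= b -> f t = f b - (cint a b f' - cint a t f').
  move=> /andP[at_ tb]; rewrite fE ?at_ ?tb //.
  by rewrite (@cint_split _ a t b) //; congr (_ - _); ring.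
have mr := rint_parameter_continuous ab fr.
have mi := rint_parameter_continuous ab fi.
split.
  apply: (eq_measurable_fun (fun t => complex.Re (f b - cint a b f') +
      rint a t (fun s => complex.Re (f' s)))).
    move=> t /set_mem; rewrite /= in_itv /= => tab; rewrite [in RHS]fE' // opprB addrCA.
    by rewrite [in RHS]addrC [in RHS]cReD.
  apply: measurable_funD; first exact: measurable_cst.
  exact: subspace_continuous_measurable_fun mr.
apply: (eq_measurable_fun (fun t => complex.Im (f b - cint a b f') +
    rint a t (fun s => complex.Im (f' s)))).
  move=> t /set_mem; rewrite /= in_itv /= => tab; rewrite [in RHS]fE' // opprB addrCA.
  by rewrite [in RHS]addrC [in RHS]cImD.
apply: measurable_funD; first exact: measurable_cst.
exact: subspace_continuous_measurable_fun mi.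
Qed.

Lemma cprimitive_integrable a b f f' : cprimitive a b f f' -> cintegrable a b f.
Proof.
move=> pf; have [M fM] := cprimitive_bounded pf.
have i1 : cintegrable a b (fun=> 1 : R[i]).
  by split; apply: rintegrable_cont => t; exact: cvg_cst.
have := cintegrable_mul_bounded (cprimitive_measurable pf) fM i1.
by apply: eq_cintegrable => t _; rewrite mulr1.
Qed.

(** The function D(u) = f(u) g(u) + the integral of g f' + g' f over [u, b] is constant: each of its
    increments is a sum of integrals of an increment of one function against the density of the
    other. *)
Lemma cint_by_parts a b f f' g g' r : a <= b -> cprimitive a b f f' ->
  cderivative g g' -> ccontinuous g' ->
  (forall t, a <= t <= b -> cabs (g' t) <= r) ->
  [/\ cintegrable a b (fun t => g t * f' t),
    cintegrable a b (fun t => g' t * f t) &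
    cint a b (fun t => g t * f' t) + cint a b (fun t => g' t * f t) =
    f b * g b - f a * g a].
Proof.
move=> ab pf gg' cg' g'r; have [fi fE] := pf.
have pg : cprimitive a b g g'.
  split=> [|x /andP[ax xb]]; first exact: cintegrable_cont.
  by rewrite (cint_derivative xb gg' cg') opprB addrC subrK.
have [M gM] := cprimitive_bounded pg.
have i1 : cintegrable a b (fun t => g t * f' t).
  exact: cintegrable_mul_bounded (ccontinuous_measurable _ _ (cderivative_continuous gg')) gM fi.
have i2 : cintegrable a b (fun t => g' t * f t).
  exact: cintegrable_mul_bounded (ccontinuous_measurable _ _ cg') g'r (cprimitive_integrable pf).
split=> //.
have gi := pg.1.
have r0 : 0 <= r by apply: le_trans (g'r a _); rewrite ?cabs_ge0 ?lexx.
pose N t := `|complex.Re (f' t)| + `|complex.Im (f' t)|.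
have iN : rintegrable a b N.
  by case: fi => fr fi; apply: rintegrableD; exact: rintegrable_norm.
have N0 u v : 0 <= rint u v N.
  by apply: Rintegral_ge0 => s _; rewrite addr_ge0.
pose D u := f u * g u + cint u b (fun t => g t * f' t) + cint u b (fun t => g' t * f t).
suff : D b = D a.
  have c0 h : cint b b h = 0 by rewrite cintE !rint1.
  by rewrite /D !c0 !addr0 => ->; ring.
(* Each of the two integrals below contributes 4 r (v - u) times the integral of N over [u, v]; the
   4 consists of two factors 2 from [cabs_cint_le]. *)
apply: (second_order_increments_eq (m := fun u => 8 * r * rint a u N)) => //.
move=> u v au uv vb; have av := le_trans au uv; have ub := le_trans uv vb.
have sub h : cintegrable a b h -> cintegrable u v h by apply: cintegrable_sub.
have subb h : cintegrable a b h -> cintegrable u b h by apply: cintegrable_sub.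
have subN : rintegrable u v N by apply: rintegrable_sub iN.
(* From f(v) g(v) - f(u) g(u) = g(u) (f(v) - f(u)) + f(v) (g(v) - g(u)): g is frozen at the left end
   and f at the right end, so no cross term remains. *)
have -> : D v - D u = cint u v (fun t => g u * f' t - g t * f' t) +
    cint u v (fun t => f v * g' t - g' t * f t).
  rewrite !cintB ?cintZ; try by [apply: sub|apply: cintegrableZ; exact: sub].
  rewrite -(cprimitiveB au uv vb pf) -(cprimitiveB au uv vb pg) /D.
  rewrite [cint u b (fun t => g t * f' t)](@cint_split _ u v b) //; last exact: subb.
  rewrite [cint u b (fun t => g' t * f t)](@cint_split _ u v b) //; last exact: subb.
  ring.
rewrite (@rint_split _ a u v) //; last exact: rintegrable_sub iN.
set G := rint u v N.
have -> : (v - u) * (8 * r * (rint a u N + G) - 8 * r * rint a u N) =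
  2 * (2 * (r * (v - u)) * G) + 2 * (2 * G * r * (v - u)) by ring.
apply: (le_trans (cabsD _ _)); apply: lerD.
  rewrite -rintZ //; apply: cabs_cint_le; last first.
  - move=> t /andP[ut tv]; rewrite -mulrBl cabsM.
    apply: ler_pM; rewrite ?cabs_ge0 ?cabs_le_ReIm // cabsC.
    rewrite (cprimitiveB au ut (le_trans tv vb) pg).
    apply: (@le_trans _ _ (2 * (r * (t - u)))).
      apply: cabs_cint_le_cst => //.
        by apply: cintegrable_sub gi => //; exact: le_trans tv vb.
      move=> s /andP[us st]; apply: g'r.
      by rewrite (le_trans au us) (le_trans st (le_trans tv vb)).
    by rewrite ler_pM2l // ler_wpM2l // lerB.
  - exact: rintegrableZ.
  - by apply: cintegrableB; [apply: cintegrableZ|]; exact: sub.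
apply: cabs_cint_le_cst => //.
  by apply: cintegrableB; [apply: cintegrableZ|]; exact: sub.
move=> t /andP[ut tv]; rewrite [g' t * _]mulrC -mulrBl cabsM.
have at_ := le_trans au ut.
apply: ler_pM; rewrite ?cabs_ge0 //; last first.
  by apply: g'r; rewrite at_ (le_trans tv).
rewrite (cprimitiveB at_ tv vb pf).
apply: (@le_trans _ _ (2 * rint t v N)).
  apply: cabs_cint_le; first by apply: cintegrable_sub fi.
    exact: rintegrable_sub iN.
  by move=> s _; exact: cabs_le_ReIm.
by rewrite ler_pM2l // /G (@rint_split _ u t v) // lerDr.
Qed.

End IntegrationByParts.

(** * The Volterra integral equation of a solution *)

Section Volterra.
Context {R : realType}.
Implicit Types (x t s r L : R) (k : R[i]) (q y : R -> R[i]).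

Lemma solution_primitive L q k y y1 : is_solution L q k y y1 ->
  cprimitive 0 L y y1 /\ cprimitive 0 L y1 (fun t => (q t - k ^+ 2) * y t).
Proof.
by move=> [i1 [i2 yE]]; split; split=> // x /yE [].
Qed.

Lemma solution_bounded L q k y y1 : is_solution L q k y y1 ->
  exists M, forall t, 0 <= t <= L -> cabs (y t) <= M.
Proof. by move=> /solution_primitive [] /cprimitive_bounded. Qed.

Lemma solution_potential_integrable L q k y y1 : is_solution L q k y y1 ->
  cintegrable 0 L (fun t => q t * y t).
Proof.
move=> /solution_primitive [] py [ig _].
apply: eq_cintegrable (cintegrableD ig (cintegrableZ (k ^+ 2) (cprimitive_integrable py))).
by move=> t _; ring.
Qed.

Lemma cshc_mul_integrable x L k (f : R -> R[i]) : 0 <= x <= L -> cintegrable 0 L f ->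
  cintegrable x L (fun t => cshc k (t - x) * f t).
Proof.
move=> /andP[x0 xL] fi.
apply: (@cintegrable_mul_bounded _ _ _ (4 * (L - x) * expR (`|complex.Im k| * (L - x)))).
- exact: ccontinuous_measurable _ _ (cderivative_continuous (cderivative_cshc k x)).
- move=> t /andP[xt tL]; apply: le_trans (cabs_cshc_strip _ (lexx _) _) _ => //.
    by rewrite subr_ge0.
  apply: ler_pM; rewrite ?mulr_ge0 ?subr_ge0 ?expR_ge0 //.
    by rewrite ler_pM2l // lerB.
  by rewrite ler_expR ler_wpM2l // lerB.
- by apply: cintegrable_sub fi.
Qed.

(** Two integrations by parts move both derivatives from y to sin (k (t - x)) / k. That kernel has
    value 0 and slope 1 at t = x, so the lower boundary terms leave only y(x), and the two terms
    with k^2 cancel. *)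
Lemma solution_volterra L q k y y1 x : 0 <= x <= L -> is_solution L q k y y1 ->
  y x = y L * ccos (k * (L - x)%:C) - y1 L * cshc k (L - x) +
    cint x L (fun t => cshc k (t - x) * (q t * y t)).
Proof.
move=> x0L sol; have /andP[x0 xL] := x0L.
have [py py1] := solution_primitive sol.
have pxy := cprimitive_sub x0L py; have pxy1 := cprimitive_sub x0L py1.
set r := `|complex.Im k|; have r0 : 0 <= r := normr_ge0 _.
have bound t : x <= t <= L -> expR (r * `|t - x|) <= expR (r * (L - x)).
  move=> /andP[xt tL]; rewrite ler_expR; apply: ler_wpM2l => //.
  by rewrite ger0_norm ?subr_ge0 // lerB.
have bs t : x <= t <= L ->
    cabs (- k * csin (k * (t - x)%:C)) <= cabs k * (2 * expR (r * (L - x))).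
  move=> xtL; rewrite cabsM cabsN ler_wpM2l ?cabs_ge0 //.
  apply: le_trans (cabs_csin_strip _ (lexx _)) _.
  by rewrite ler_pM2l // bound.
have bc t : x <= t <= L -> cabs (ccos (k * (t - x)%:C)) <= 2 * expR (r * (L - x)).
  move=> xtL; apply: le_trans (cabs_ccos_strip _ (lexx _)) _.
  by rewrite ler_pM2l // bound.
have [_ _ E1] := cint_by_parts xL pxy (cderivative_ccos k x)
  (ccontinuousZ (- k) (ccontinuous_csin k x)) bs.
have [j1 _ E2] := cint_by_parts xL pxy1 (cderivative_cshc k x) (ccontinuous_ccos k x) bc.
move: E1 E2; rewrite subrr mulr0 ccos0 mulr1 cshc0 mulr0 subr0 => E1 E2.
have iS : cintegrable x L (fun t => cshc k (t - x) * y t).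
  exact: cshc_mul_integrable (cprimitive_integrable py).
have -> : cint x L (fun t => cshc k (t - x) * (q t * y t)) =
    cint x L (fun t => cshc k (t - x) * ((q t - k ^+ 2) * y t)) +
    k ^+ 2 * cint x L (fun t => cshc k (t - x) * y t).
  rewrite -cintZ // -cintD //; last exact: cintegrableZ.
  by apply: eq_cint => t _; ring.
have E3 : cint x L (fun t => - k * csin (k * (t - x)%:C) * y t) =
    - (k ^+ 2 * cint x L (fun t => cshc k (t - x) * y t)).
  rewrite -mulNr -cintZ //; apply: eq_cint => t _.
  by rewrite -cshcE; ring.
rewrite E3 in E1.
have -> : y x = y L * ccos (k * (L - x)%:C) -
   (cint x L (fun t => ccos (k * (t - x)%:C) * y1 t) -
    k ^+ 2 * cint x L (fun t => cshc k (t - x) * y t)) by rewrite E1; ring.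
rewrite -E2; ring.
Qed.

End Volterra.

(** * The cosine-type property and its stability under the Volterra iteration *)

Section CosineType.
Context {R : realType}.
Implicit Types (a t x s u r L M B : R) (k : R[i]) (q : R -> R[i]).

Lemma ccos_norm k s : ccos (k * `|s|%:C) = ccos (k * s%:C).
Proof.
by case: (ler0P s) => _ //; rewrite rmorphN mulrN ccosN.
Qed.

Definition cosine_bounded n (al rh : nat -> R[i]) a B :=
  forall t, 0 <= t <= a -> cabs (\sum_(i < n) al i * ccos (rh i * t%:C)) <= B.

(* By duality this says that F is a superposition of the functions
   k |-> cos (k t), 0 <= t <= a, of total mass at most M; only the values of F
   in the strip |Im k| <= r are constrained. *)
Definition cosine_type r a M (F : R[i] -> R[i]) :=
  forall n (al rh : nat -> R[i]) B,
    (forall i, (i < n)%N -> `|complex.Im (rh i)| <= r) ->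
    cosine_bounded n al rh a B ->
    cabs (\sum_(i < n) al i * F (rh i)) <= M * B.

Lemma cosine_bounded_ge0 n al rh a B : 0 <= a -> cosine_bounded n al rh a B -> 0 <= B.
Proof.
by move=> a0 /(_ 0); rewrite lexx a0 => /(_ isT); apply: le_trans; exact: cabs_ge0.
Qed.

(** The product is the mean of the cosines of frequencies |s + u| and |s - u|. Multiplying the
    weights by cos (. s) thus shortens the admissible interval by |s| and leaves the bound
    unchanged. *)
Lemma cosine_bounded_mulcos n al rh a B s u : `|s| + `|u| <= a ->
  cosine_bounded n al rh a B ->
  cabs (\sum_(i < n) al i * (ccos (rh i * s%:C) * ccos (rh i * u%:C))) <= B.
Proof.
move=> sua bB.
have -> : \sum_(i < n) al i * (ccos (rh i * s%:C) * ccos (rh i * u%:C)) =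
  2^-1 * (\sum_(i < n) al i * ccos (rh i * `|s + u|%:C)) +
  2^-1 * (\sum_(i < n) al i * ccos (rh i * `|s - u|%:C)).
  rewrite !big_distrr -big_split /=; apply: eq_bigr => i _.
  by rewrite !ccos_norm ccosM -mulrDr -mulrBr -rmorphD -rmorphB; field.
apply: le_trans (cabsD _ _) _; rewrite !cabsM.
have -> : cabs (2^-1 : R[i]) = 2^-1 by rewrite cabsV cabs_nat.
have h1 : cabs (\sum_(i < n) al i * ccos (rh i * `|s + u|%:C)) <= B.
  by apply: bB; rewrite normr_ge0 (le_trans (ler_normD _ _)).
have h2 : cabs (\sum_(i < n) al i * ccos (rh i * `|s - u|%:C)) <= B.
  by apply: bB; rewrite normr_ge0 (le_trans (ler_normB _ _)).
lra.
Qed.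

(** By [cshc_cint] the extra factor is an integral of cosines over [0, s], of total mass s; the 2 is
    that of [cabs_cint_le_cst]. *)
Lemma cosine_bounded_mulshc n al rh a B s u : 0 <= s -> s + `|u| <= a ->
  cosine_bounded n al rh a B ->
  cabs (\sum_(i < n) al i * (cshc (rh i) s * ccos (rh i * u%:C))) <= 2 * s * B.
Proof.
move=> s0 sua bB.
have ci i : cintegrable 0 s (fun t => ccos (rh i * t%:C)).
  by apply: eq_cintegrable (cintegrable_cont _ _ (ccontinuous_ccos (rh i) 0)) => t _;
    rewrite subr0.
have -> : \sum_(i < n) al i * (cshc (rh i) s * ccos (rh i * u%:C)) =
    cint 0 s (fun t => \sum_(i < n) al i * ccos (rh i * u%:C) * ccos (rh i * t%:C)).
  rewrite (cint_sum (f := fun i t => al i * ccos (rh i * u%:C) * ccos (rh i * t%:C)));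
    last by move=> i _; exact: cintegrableZ.
  by apply: eq_bigr => i _; rewrite cintZ // -cshc_cint //; ring.
have -> : 2 * s * B = 2 * (B * (s - 0)) by ring.
apply: cabs_cint_le_cst => //.
  by apply: (cintegrable_sum (f := fun i t => al i * ccos (rh i * u%:C) *
    ccos (rh i * t%:C))) => i _; exact: cintegrableZ.
move=> t /andP[t0 ts].
have -> : \sum_(i < n) al i * ccos (rh i * u%:C) * ccos (rh i * t%:C) =
  \sum_(i < n) al i * (ccos (rh i * u%:C) * ccos (rh i * t%:C)).
  by apply: eq_bigr => i _; rewrite mulrA.
apply: cosine_bounded_mulcos bB; apply: le_trans sua.
by rewrite addrC lerD // ger0_norm.
Qed.

(** Takes the place of the Cauchy-Schwarz inequality: |q| is split into a small multiple of |q|^2,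
    integrable since q is in L_2, and a constant to be integrated against the exponential weight. *)
Lemma le_young (e c : R) : 0 < e -> c <= e * c ^+ 2 + (4 * e)^-1.
Proof.
move=> e0; rewrite -subr_ge0.
have -> : e * c ^+ 2 + (4 * e)^-1 - c = (4 * e)^-1 * (2 * e * c - 1) ^+ 2.
  by field; rewrite gt_eqF.
by rewrite mulr_ge0 ?sqr_ge0 // invr_ge0 mulr_ge0 // ltW.
Qed.

Lemma sqr_cabs (z : R[i]) : cabs z ^+ 2 = complex.Re z ^+ 2 + complex.Im z ^+ 2.
Proof. by rewrite cabsE sqr_sqrtr // addr_ge0 ?sqr_ge0. Qed.

Lemma rint_expR lam x L : 0 < lam -> x <= L ->
  rint x L (fun t => expR (- lam * (t - L))) <= expR (- lam * (x - L)) / lam.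
Proof.
move=> l0 xL.
have de (t : R) : is_derive t 1 (fun s : R => - lam^-1 * expR (- lam * (s - L)))
    (expR (- lam * (t - L))).
  have h := is_derive_affine_comp (- lam) L t (fun s => is_derive_expR s).
  apply: is_derive_eq; rewrite /GRing.scale /=.
  by field; rewrite gt_eqF.
rewrite (rint_derive xL de).
  rewrite subrr mulr0 expR0 mulr1 mulNr opprK [lam^-1 * _]mulrC addrC lerBlDr lerDl.
  by rewrite invr_ge0 ltW.
move=> t; apply: differentiable_continuous; apply/derivable1_diffP.
by have h := is_derive_affine_comp (- lam) L t (fun s => is_derive_expR s); apply: ex_derive.
Qed.

(* An exponentially weighted sup norm makes the Volterra operator a contraction. *)
Lemma volterra_contraction L q theta : cL2 0 L q -> 0 < theta ->
  exists2 lam, 0 < lam & forall x f K, 0 <= x <= L -> 0 <= K -> cintegrable x L f ->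
    (forall t, x <= t <= L -> cabs (f t) <= cabs (q t) * (K * expR (lam * (L - t)))) ->
    cabs (cint x L f) <= theta * (K * expR (lam * (L - x))).
Proof.
move=> [_ [_ [ir ii]]] th0.
pose N t := complex.Re (q t) ^+ 2 + complex.Im (q t) ^+ 2.
have N0 t : 0 <= N t by rewrite addr_ge0 ?sqr_ge0.
have iN : rintegrable 0 L N by exact: rintegrableD.
have rN0 u v : 0 <= rint u v N by apply: Rintegral_ge0.
set Q := rint 0 L N; have Q0 : 0 <= Q by exact: rN0.
(* With this e the |q|^2 part contributes at most theta / 2, and with lam = 1 / (e theta) the
   constant part contributes exactly theta / 2. The 1 in Q + 1 guards against Q = 0. *)
pose e := theta / (4 * (Q + 1)).
have e0 : 0 < e by rewrite divr_gt0 // mulr_gt0 // ltr_wpDl.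
exists (e * theta)^-1; first by rewrite invr_gt0 mulr_gt0.
set lam := (e * theta)^-1; have l0 : 0 < lam by rewrite invr_gt0 mulr_gt0.
move=> x f K /andP[x0 xL] K0 fi fq.
have wE t : expR (lam * (L - t)) = expR (- lam * (t - L)) by congr expR; ring.
set E := expR (lam * (L - x)).
pose g t := (K * e * E) * N t + (K * (4 * e)^-1) * expR (- lam * (t - L)).
have ie : rintegrable x L (fun t => expR (- lam * (t - L))).
  apply: rintegrable_cont => t; apply: differentiable_continuous.
  apply/derivable1_diffP.
  by have h := is_derive_affine_comp (- lam) L t (fun s => is_derive_expR s); apply: ex_derive.
have ixN : rintegrable x L N by exact: rintegrable_sub iN.
have ig : rintegrable x L g by apply: rintegrableD; exact: rintegrableZ.
have fg t : x <= t <= L -> cabs (f t) <= g t.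
  move=> xtL; apply: le_trans (fq t xtL) _; rewrite /g wE.
  set w := expR _; have w0 : 0 <= w by exact: expR_ge0.
  have wE' : w <= E.
    rewrite /w -wE ler_expR ler_wpM2l ?(ltW l0) // lerB //; by case/andP: xtL.
  have := le_young (cabs (q t)) e0; rewrite sqr_cabs -/(N t) => h.
  have : cabs (q t) * (K * w) <= (e * N t + (4 * e)^-1) * (K * w).
    by rewrite ler_wpM2r // mulr_ge0.
  move/le_trans; apply.
  rewrite mulrDl; apply: lerD; last by rewrite le_eqVlt; apply/orP; left; apply/eqP; ring.
  have -> : e * N t * (K * w) = (K * e * N t) * w by ring.
  have -> : K * e * E * N t = (K * e * N t) * E by ring.
  by rewrite ler_wpM2l // mulr_ge0 // mulr_ge0 // ltW.
apply: le_trans (cabs_cint_le fi ig fg) _.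
rewrite rintD ?rintZ //; try exact: rintegrableZ.
have E0 : 0 < E by exact: expR_gt0.
have h1 : rint x L N <= Q by rewrite /Q (@rint_split _ 0 x L) // lerDr.
have h2 := rint_expR l0 xL; rewrite -wE -/E in h2.
have h3 : K * e * E * rint x L N <= K * e * E * Q.
  by rewrite ler_wpM2l // mulr_ge0 ?(ltW E0) // mulr_ge0 ?(ltW e0).
have h4 : K / (4 * e) * rint x L (fun t => expR (- lam * (t - L))) <= K / (4 * e) * (E / lam).
  by rewrite ler_wpM2l // divr_ge0 // mulr_ge0 ?(ltW e0).
have -> : theta * (K * E) = 2 * (K * E * (theta / 4) + K / (4 * e) * (E / lam)).
  by rewrite /lam; field; rewrite !gt_eqF.
rewrite ler_pM2l //; apply: lerD; last exact: h4.
apply: le_trans h3 _; have -> : K * e * E * Q = K * E * (e * Q) by ring.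
rewrite ler_wpM2l ?mulr_ge0 ?(ltW E0) //.
have -> : theta / 4 = e * (Q + 1) by rewrite /e; field; rewrite gt_eqF // ltr_wpDl.
by rewrite ler_wpM2l ?(ltW e0) // lerDl.
Qed.

Lemma ler_add_geometric (c P S : R) : (forall m : nat, c <= P + 2^-1 ^+ m * S) -> c <= P.
Proof.
move=> H; apply/ler_addgt0Pr => e e0.
have [S0|S0] := leP S 0.
  apply: le_trans (H 0) _; rewrite expr0 mul1r lerD2l.
  exact: le_trans S0 (ltW e0).
have /upper_nthrootP := leqnn (Num.bound (S / e)).
set m := Num.bound _ => Sm; apply: le_trans (H m) _; rewrite lerD2l.
rewrite exprVn mulrC ler_pdivrMr ?exprn_gt0 // mulrC -ler_pdivrMr //.
by rewrite ltW.
Qed.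

(** Inserting the Volterra equation into a combination at x gives a free term and an integral over t
    of combinations at t with weights al_i cshc (rh_i) (t - x). These weights satisfy a cosine bound
    on [0, L - t], exactly the interval needed at t, so the estimate can be iterated. For a fixed
    finite combination a crude a priori bound starts the iteration; its contribution is halved each
    time and disappears in the limit. *)
Lemma volterra_cosine_type L q (a0 b0 : R[i]) (y : R[i] -> R -> R[i]) r :
  0 < L -> cL2 0 L q ->
  (forall k, exists Y, forall t, 0 <= t <= L -> cabs (y k t) <= Y) ->
  (forall k, cintegrable 0 L (fun t => q t * y k t)) ->
  (forall k x, 0 <= x <= L -> y k x = a0 * ccos (k * (L - x)%:C) -
     b0 * cshc k (L - x) + cint x L (fun t => cshc k (t - x) * (q t * y k t))) ->
  0 <= r ->
  exists2 M, 0 <= M & forall t, 0 <= t <= L -> cosine_type r (L - t) M (fun k => y k t).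
Proof.
move=> L0 hq yb yi yV r0.
(* C dominates both costs of one iteration: 2 (t - x) for the cosine bound and 4 (t - x) exp (r (t -
   x)) for the size of the individual weights. *)
pose C := 4 * L * expR (r * L).
have e1 : 1 <= expR (r * L) by rewrite -expR0 ler_expR mulr_ge0 // ltW.
have C0 : 0 < C by rewrite !mulr_gt0 // expR_gt0.
have LC : 2 * L <= C by rewrite /C; nra.
(* One iteration multiplies the data by C, so a contraction factor 1 / (2 C) leaves a net factor
   1/2. *)
have th0 : 0 < (2 * C)^-1 by rewrite invr_gt0 mulr_gt0.
have [lam l0 contr] := volterra_contraction hq th0.
(* Twice the mass of the free term: K1 / 2 from the free term plus K1 / 2 from the halved integral
   reproduces K1. *)
pose K1 := 2 * (cabs a0 + 2 * L * cabs b0).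
have K10 : 0 <= K1.
  by rewrite mulr_ge0 // addr_ge0 ?cabs_ge0 // mulr_ge0 ?cabs_ge0 // mulr_ge0 // ltW.
exists (expR (lam * L) * K1); first by rewrite mulr_ge0 ?expR_ge0.
move=> x1 x1L n al1 rh B1 rhr.
(* Y depends on the chosen points [rh], but it enters only the remainder that tends to 0. *)
have [Yf YfP] := choice (fun i => yb (rh i)).
pose Y := \sum_(i < n) `|Yf i|.
have Y0 : 0 <= Y by apply: sumr_ge0.
have YP i t : (i < n)%N -> 0 <= t <= L -> cabs (y (rh i) t) <= Y.
  move=> i_n tL; apply: le_trans (YfP i t tL) _; apply: le_trans (ler_norm _) _.
  rewrite /Y (bigD1 (Ordinal i_n)) //= lerDl; exact: sumr_ge0.
(* The position, the weights and the bound all change in one iteration, so the induction quantifies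
   over them; only the points [rh] stay fixed. *)
have main m : forall x al B, 0 <= x <= L -> cosine_bounded n al rh (L - x) B ->
    cabs (\sum_(i < n) al i * y (rh i) x) <=
    expR (lam * (L - x)) * (K1 * B + 2^-1 ^+ m * (Y * \sum_(i < n) cabs (al i))).
  elim: m => [|m IH] x al B xL bB; have /andP[x0 x_L] := xL;
    have B0 : 0 <= B by apply: cosine_bounded_ge0 bB; rewrite subr_ge0.
    have ex1 : 1 <= expR (lam * (L - x)).
      by rewrite -expR0 ler_expR mulr_ge0 ?(ltW l0) // subr_ge0.
    apply: (@le_trans _ _ (Y * \sum_(i < n) cabs (al i))).
      apply: le_trans (cabs_sum _ _ _) _; rewrite big_distrr /=; apply: ler_sum => i _.
      by rewrite cabsM mulrC ler_wpM2r ?cabs_ge0 // YP.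
    rewrite expr0 mul1r; set S := Y * _.
    have S0 : 0 <= S by rewrite mulr_ge0 // sumr_ge0 // => i _; exact: cabs_ge0.
    have KB : 0 <= K1 * B by rewrite mulr_ge0.
    apply: (@le_trans _ _ (1 * (K1 * B + S))); first by rewrite mul1r lerDr.
    by rewrite ler_wpM2r // addr_ge0.
  set E := expR (lam * (L - x)); set S := \sum_(i < n) cabs (al i).
  have ex1 : 1 <= E by rewrite -expR0 ler_expR mulr_ge0 ?(ltW l0) // subr_ge0.
  have S0 : 0 <= S by apply: sumr_ge0 => i _; exact: cabs_ge0.
  pose f t := \sum_(i < n) al i * (cshc (rh i) (t - x) * (q t * y (rh i) t)).
  have ifi i : cintegrable x L (fun t => al i * (cshc (rh i) (t - x) * (q t * y (rh i) t))).
    by apply: cintegrableZ; exact: cshc_mul_integrable.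
  have fi : cintegrable x L f.
    by apply: (cintegrable_sum (f := fun i t => al i * (cshc (rh i) (t - x) *
      (q t * y (rh i) t)))) => i _.
  have -> : \sum_(i < n) al i * y (rh i) x =
      (a0 * (\sum_(i < n) al i * ccos (rh i * (L - x)%:C)) -
       b0 * (\sum_(i < n) al i * cshc (rh i) (L - x))) + cint x L f.
    rewrite (cint_sum (f := fun i t => al i * (cshc (rh i) (t - x) *
      (q t * y (rh i) t)))) // !big_distrr /= -sumrB -big_split /=.
    apply: eq_bigr => i _; rewrite yV // cintZ; first by ring.
    exact: cshc_mul_integrable.
  have free : cabs (a0 * (\sum_(i < n) al i * ccos (rh i * (L - x)%:C)) -
      b0 * (\sum_(i < n) al i * cshc (rh i) (L - x))) <= K1 / 2 * B.
    apply: le_trans (cabsB _ _) _; rewrite !cabsM.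
    have h1 : cabs (\sum_(i < n) al i * ccos (rh i * (L - x)%:C)) <= B.
      by apply: bB; rewrite lexx subr_ge0 x_L.
    have h2 : cabs (\sum_(i < n) al i * cshc (rh i) (L - x)) <= 2 * (L - x) * B.
      have Lx0 : 0 <= L - x by rewrite subr_ge0.
      have Lxx : L - x + `|0 : R| <= L - x by rewrite normr0 addr0.
      have := cosine_bounded_mulshc Lx0 Lxx bB.
      congr (cabs _ <= _); apply: eq_bigr => i _.
      by rewrite mulr0 ccos0 mulr1.
    have -> : K1 / 2 * B = cabs a0 * B + cabs b0 * (2 * L * B) by rewrite /K1; field.
    apply: lerD; apply: ler_wpM2l; rewrite ?cabs_ge0 //.
    apply: le_trans h2 _; rewrite ler_wpM2r // ler_pM2l // lerBlDr lerDl //.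
  pose K := C * (K1 * B + 2^-1 ^+ m * (Y * S)).
  have P0 : 0 <= 2^-1 ^+ m * (Y * S) by rewrite !mulr_ge0 // exprn_ge0.
  have K0 : 0 <= K by rewrite mulr_ge0 ?(ltW C0) // addr_ge0 // mulr_ge0.
  have int : cabs (cint x L f) <= (2 * C)^-1 * (K * E).
    apply: contr => // t /andP[xt tL].
    have t0L : 0 <= t <= L by rewrite tL (le_trans x0 xt).
    have tx0 : 0 <= t - x by rewrite subr_ge0.
    have -> : f t = q t * \sum_(i < n) (al i * cshc (rh i) (t - x)) * y (rh i) t.
      by rewrite /f big_distrr /=; apply: eq_bigr => i _; ring.
    rewrite cabsM ler_wpM2l ?cabs_ge0 //.
    have bC : cosine_bounded n (fun i => al i * cshc (rh i) (t - x)) rh (L - t) (C * B).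
      move=> u /andP[u0 uL].
      have h : t - x + `|u| <= L - x by rewrite ger0_norm //; lra.
      have := cosine_bounded_mulshc tx0 h bB.
      have -> : \sum_(i < n) al i * (cshc (rh i) (t - x) * ccos (rh i * u%:C)) =
        \sum_(i < n) al i * cshc (rh i) (t - x) * ccos (rh i * u%:C).
        by apply: eq_bigr => i _; rewrite mulrA.
      move/le_trans; apply; rewrite ler_wpM2r //; apply: le_trans LC.
      rewrite ler_pM2l //; lra.
    apply: le_trans (IH _ _ _ t0L bC) _; rewrite mulrC ler_wpM2r ?expR_ge0 //.
    rewrite /K mulrDr mulrCA lerD2l [leRHS]mulrCA; apply: ler_wpM2l; first exact: exprn_ge0.
    rewrite [leRHS]mulrCA; apply: ler_wpM2l => //.
    rewrite /S big_distrr /=; apply: ler_sum => i _; rewrite cabsM mulrC.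
    rewrite ler_wpM2r ?cabs_ge0 //.
    apply: le_trans (cabs_cshc_strip r0 (rhr _ (ltn_ord i)) tx0) _.
    apply: ler_pM; rewrite ?expR_ge0 ?mulr_ge0 //.
      by rewrite ler_pM2l //; lra.
    by rewrite ler_expR ler_wpM2l //; lra.
  apply: le_trans (cabsD _ _) _.
  have -> : E * (K1 * B + 2^-1 ^+ m.+1 * (Y * S)) =
      E * (K1 / 2 * B) + (2 * C)^-1 * (K * E).
    by rewrite /K exprS; field; rewrite gt_eqF.
  apply: lerD => //; apply: le_trans free _.
  by rewrite -[leLHS]mul1r ler_wpM2r // mulr_ge0 // divr_ge0.
move=> bB1; have /andP[x10 x1_L] := x1L.
have B10 : 0 <= B1 by apply: cosine_bounded_ge0 bB1; rewrite subr_ge0.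
apply: (@ler_add_geometric _ _ (expR (lam * (L - x1)) * (Y * \sum_(i < n) cabs (al1 i)))).
move=> m; apply: le_trans (main m _ _ _ x1L bB1) _.
rewrite mulrDr [X in _ + X]mulrCA lerD2r mulrA ler_wpM2r // ler_wpM2r //.
by rewrite ler_expR ler_wpM2l ?(ltW l0) // lerBlDr lerDl.
Qed.

End CosineType.

(** * Limits of complex sequences in terms of the modulus *)

Section ComplexLimits.
Context {R : realType}.
Implicit Types (u v : nat -> R[i]) (l m z w k : R[i]).

Definition clim u l := forall e : R, 0 < e ->
  exists n0, forall n, (n0 <= n)%N -> cabs (u n - l) <= e.

Lemma clim_cst l : clim (fun=> l) l.
Proof. by move=> e e0; exists 0%N => n _; rewrite subrr cabs0 ltW. Qed.

Lemma climD u v l m : clim u l -> clim v m -> clim (fun n => u n + v n) (l + m).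
Proof.
move=> ul vm e e0; have e2 : 0 < e / 2 by rewrite divr_gt0.
have [n1 h1] := ul _ e2; have [n2 h2] := vm _ e2.
exists (maxn n1 n2) => n; rewrite geq_max => /andP[n1n n2n].
have -> : u n + v n - (l + m) = (u n - l) + (v n - m) by ring.
apply: le_trans (cabsD _ _) _; have := h1 n n1n; have := h2 n n2n; lra.
Qed.

Lemma climM u v l m : clim u l -> clim v m -> clim (fun n => u n * v n) (l * m).
Proof.
move=> ul vm e e0.
pose c := cabs l + cabs m + 1; have c0 : 0 < c.
  by rewrite ltr_wpDl // addr_ge0 ?cabs_ge0.
pose d := Num.min 1 (e / (2 * c)).
have d0 : 0 < d by rewrite lt_min ltr01 divr_gt0 // mulr_gt0.
have [n1 h1] := ul _ d0; have [n2 h2] := vm _ d0.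
exists (maxn n1 n2) => n; rewrite geq_max => /andP[n1n n2n].
have -> : u n * v n - l * m = (u n - l) * (v n - m) + l * (v n - m) + m * (u n - l) by ring.
have a1 := h1 n n1n; have a2 := h2 n n2n.
apply: le_trans (cabsD _ _) _; apply: le_trans (lerD (cabsD _ _) (lexx _)) _.
rewrite !cabsM.
have d1 : d <= 1 by rewrite ge_min lexx.
have de : d * (2 * c) <= e by rewrite -ler_pdivlMr ?mulr_gt0 // ge_min lexx orbT.
have l0 := cabs_ge0 l; have m0 := cabs_ge0 m.
have p1 : cabs (u n - l) * cabs (v n - m) <= d * 1.
  by apply: ler_pM; rewrite ?cabs_ge0 // (le_trans a2).
have p2 : cabs l * cabs (v n - m) <= cabs l * d by rewrite ler_wpM2l.
have p3 : cabs m * cabs (u n - l) <= cabs m * d by rewrite ler_wpM2l.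
have dc : d * c <= d * (2 * c) by rewrite ler_wpM2l ?(ltW d0) //; lra.
have cE : d * c = cabs l * d + cabs m * d + d by rewrite /c; ring.
lra.
Qed.

Lemma clim_sum N (f : nat -> nat -> R[i]) (l : nat -> R[i]) :
  (forall i, (i < N)%N -> clim (f i) (l i)) ->
  clim (fun n => \sum_(i < N) f i n) (\sum_(i < N) l i).
Proof.
elim: N => [_|N IH fl]; first by rewrite big_ord0; under eq_fun do rewrite big_ord0;
  exact: clim_cst.
rewrite big_ord_recr /=; under eq_fun do rewrite big_ord_recr /=.
apply: climD; last exact: fl.
by apply: IH => i iN; apply: fl; exact: ltnW.
Qed.

Lemma clim_le u l (B : R) n0 : clim u l ->
  (forall n, (n0 <= n)%N -> cabs (u n) <= B) -> cabs l <= B.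
Proof.
move=> ul uB; apply/ler_addgt0Pr => e e0; have [n1 h1] := ul _ e0.
have := h1 (maxn n0 n1) (leq_maxr _ _); have := uB _ (leq_maxl n0 n1).
set x := u _ => h2 h3; have -> : l = x - (x - l) by ring.
by apply: le_trans (cabsB _ _) _; exact: lerD.
Qed.

Lemma clim_rate u l (c : R) n0 :
  (forall n, (n0 <= n)%N -> cabs (u n - l) <= c / n.+1%:R) -> clim u l.
Proof.
move=> ulc e e0; exists (maxn n0 (Num.bound (`|c| / e))) => n.
rewrite geq_max => /andP[n0n bn]; apply: le_trans (ulc n n0n) _.
have nb : `|c| / e <= n.+1%:R.
  apply: le_trans (ltW (archi_boundP _)) _; first by rewrite divr_ge0 // ltW.
  by rewrite ler_nat (leq_trans bn).
rewrite ler_pdivrMr ?ltr0Sn // mulrC; apply: le_trans (ler_norm _) _.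
by rewrite -ler_pdivrMr.
Qed.

End ComplexLimits.

(** * Quantitative estimates for sine and cosine *)

Section ComplexSineEstimates.
Context {R : realType}.
Implicit Types (z w k : R[i]) (a b t x : R).

Lemma ccos_lipschitz k a b : 0 <= a -> a <= b ->
  cabs (ccos (k * b%:C) - ccos (k * a%:C)) <=
  4 * cabs k * expR (cabs k * b) * (b - a).
Proof.
move=> a0 ab.
have := cint_derivative ab (cderivative_ccos k 0) (ccontinuousZ (- k) (ccontinuous_csin k 0)).
rewrite !subr0 => <-.
have -> : 4 * cabs k * expR (cabs k * b) * (b - a) =
  2 * ((cabs k * (2 * expR (cabs k * b))) * (b - a)) by ring.
apply: cabs_cint_le_cst => //.
  exact: cintegrable_cont (ccontinuousZ (- k) (ccontinuous_csin k 0)).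
move=> t /andP[ta tb]; rewrite cabsM cabsN ler_wpM2l ?cabs_ge0 // subr0.
apply: le_trans (cabs_csin_strip _ (Im_le_cabs k)) _.
rewrite ler_pM2l // ler_expR ler_wpM2l ?cabs_ge0 // ger0_norm //; exact: le_trans ta.
Qed.

Lemma cabs_csin_lin k : cabs (csin k) <= 4 * cabs k * expR (cabs k).
Proof.
have := cshcE k 1; rewrite mulr1 => <-; rewrite cabsM.
have := cabs_cshc_strip (cabs_ge0 k) (Im_le_cabs k) ler01; rewrite !mulr1 => h.
have -> : 4 * cabs k * expR (cabs k) = cabs k * (4 * expR (cabs k)) by ring.
by rewrite ler_wpM2l ?cabs_ge0.
Qed.

(** sin k - k is k times the integral of cos (k t) - 1 over [0, 1]. Quadratic order is enough for
    [clim_dsinc], where the bound at a point of size O(1/M) is multiplied by M. *)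
Lemma cabs_csinB k : cabs (csin k - k) <= 8 * cabs k ^+ 2 * expR (cabs k).
Proof.
have -> : csin k - k = k * (cint 0 1 (fun t => ccos (k * t%:C) - 1)).
  have ci : cintegrable 0 1 (fun t : R => ccos (k * t%:C)).
    by apply: eq_cintegrable (cintegrable_cont _ _ (ccontinuous_ccos k 0)) => t _;
      rewrite subr0.
  have i1 : cintegrable 0 1 (fun=> 1 : R[i]).
    by split; apply: rintegrable_cont => t; exact: cvg_cst.
  have c1 : cint 0 1 (fun=> 1 : R[i]) = 1.
    by rewrite cintE !rint_cst //= subr0 mulr1 mul0r.
  by rewrite cintB // c1 -cshc_cint // mulrBr cshcE !mulr1.
rewrite cabsM.
have -> : 8 * cabs k ^+ 2 * expR (cabs k) =
  cabs k * (2 * ((4 * cabs k * expR (cabs k)) * (1 - 0))) by ring.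
rewrite ler_wpM2l ?cabs_ge0 //; apply: cabs_cint_le_cst => //.
  apply: cintegrableB.
    by apply: eq_cintegrable (cintegrable_cont _ _ (ccontinuous_ccos k 0)) => t _;
      rewrite subr0.
  by split; apply: rintegrable_cont => t; exact: cvg_cst.
move=> t /andP[t0 t1].
have := ccos_lipschitz k (lexx 0) t0; rewrite mulr0 ccos0 subr0.
move/le_trans; apply.
have c0 := cabs_ge0 k; have e0 := expR_ge0 (cabs k).
rewrite -[leRHS]mulr1; apply: ler_pM => //.
  by rewrite !mulr_ge0 ?expR_ge0.
rewrite ler_wpM2l ?mulr_ge0 // ler_expR -[leRHS]mulr1 ler_wpM2l //.
Qed.

Lemma norm_sin_le (x : R) : `|sin x| <= `|x|.
Proof.
wlog x0 : x / 0 <= x => [H|].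
  have [/H //|/ltW x0] := leP 0 x.
  by have := H (- x); rewrite sinN !normrN oppr_ge0; apply.
rewrite [leRHS]ger0_norm //.
have := rint_derive x0 (fun t => is_derive_sin t) (@continuous_cos R).
rewrite sin0 subr0 => <-.
have ic : rintegrable 0 x (@cos R) by apply: rintegrable_cont; exact: continuous_cos.
apply: le_trans (norm_rint ic) _.
rewrite -[leRHS]mul1r -[X in _ <= 1 * X]subr0 -rint_cst //; apply: le_rint.
- exact: rintegrable_norm.
- by apply: rintegrable_cont => t; exact: cvg_cst.
- by move=> t _; exact: cos_max.
Qed.

Lemma cos_ge_half (x : R) : 0 <= x -> x <= 1 -> 2^-1 <= cos x.
Proof.
move=> x0 x1; have -> : x = (x / 2) *+ 2 by rewrite mulr2n; field.
rewrite cos_mulr2n cos2sin2 -[X in X - 1]mulr_natl.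
have : `|sin (x / 2)| ^+ 2 <= (2^-1) ^+ 2.
  rewrite lerXn2r ?nnegrE ?normr_ge0 ?invr_ge0 //.
  by apply: le_trans (norm_sin_le _) _; rewrite ger0_norm ?divr_ge0 // ler_pdivrMr // mulVf.
have -> : (2^-1 : R) ^+ 2 = 4^-1 by field.
rewrite real_normK ?num_real //; set y := sin _ ^+ 2 => h; lra.
Qed.

Lemma sin_ge_half (x : R) : 0 <= x -> x <= 1 -> x / 2 <= sin x.
Proof.
move=> x0 x1.
have := rint_derive x0 (fun t => is_derive_sin t) (@continuous_cos R).
rewrite sin0 subr0 => <-.
rewrite [leLHS]mulrC -[X in _ * X <= _]subr0 -rint_cst //; apply: le_rint.
- by apply: rintegrable_cont => t; exact: cvg_cst.
- by apply: rintegrable_cont; exact: continuous_cos.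
- by move=> t /andP[t0 tx]; apply: cos_ge_half => //; exact: le_trans tx x1.
Qed.

(** A weak Jordan inequality by halving the angle: x / 2 lies in [0, 1] because pi / 2 < 2, and
    there sine and cosine have simple lower bounds. *)
Lemma sin_ge_quarter (x : R) : 0 <= x -> x <= pi / 2 -> x / 4 <= sin x.
Proof.
move=> x0 xp; have p2 := @pihalf_lt2 R.
have h0 : 0 <= x / 2 by rewrite divr_ge0.
have h1 : x / 2 <= 1 by rewrite ler_pdivrMr //; lra.
have hs := sin_ge_half h0 h1; have hc := cos_ge_half h0 h1.
have -> : sin x = (cos (x / 2) * sin (x / 2)) *+ 2.
  by rewrite -sin_mulr2n; congr sin; rewrite mulr2n; field.
rewrite -[leRHS]mulr_natl; nra.
Qed.

End ComplexSineEstimates.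

(** * Finite trigonometric interpolation on 2K + 1 points *)

Section CosineInterpolation.
Context {R : realType}.
Implicit Types (z w : R[i]) (n j k m K N : nat) (t : R).

(** The weight that folds symmetric sums over n and -n onto n >= 0; it is also the origin of the 1/2
    in the coefficient psi_0. *)
Definition half0 n : R[i] := if n == 0%N then 2^-1 else 1.

Definition step K : R := 2 * pi / (K.*2.+1)%:R.

(** The Dirichlet kernel without division, hence valid at its removable singularities too; each term
    2 sin (z / 2) cos (k z) is a difference of consecutive half-integer sines. *)
Lemma dirichlet_kernel z K :
  2 * csin (z / 2) * (\sum_(k < K.+1) half0 k * ccos (k%:R * z)) =
  csin ((K%:R + 2^-1) * z).
Proof.
elim: K => [|K IH].
  rewrite big_ord_recl big_ord0 /half0 /= mul0r ccos0 !addr0 add0r mulr1.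
  by rewrite mulrAC mulfV ?mul1r ?pnatr_eq0 // mulrC.
rewrite big_ord_recr mulrDr IH /half0 /= mul1r.
have -> : (K%:R + 2^-1) * z = K.+1%:R * z - z / 2 by rewrite -natr1; field.
have -> : (K.+1%:R + 2^-1) * z = K.+1%:R * z + z / 2 by field.
by rewrite csinB csinD; ring.
Qed.

Definition stepC K : R[i] := (step K)%:C.

Lemma stepE K : (K.*2.+1)%:R * stepC K = (2 * pi)%:C.
Proof.
rewrite /stepC /step natCE -rmorphM /=; congr (_%:C).
by rewrite mulrC divfK // pnatr_eq0.
Qed.

Lemma oddE (S : pzRingType) K : (K.*2.+1)%:R = 2 * K%:R + 1 :> S.
Proof. by rewrite -[K.*2.+1]addn1 natrD -mul2n natrM. Qed.

Lemma step_half K : (K%:R + 2^-1) * stepC K = pi%:C.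
Proof.
have : 2 * ((K%:R + 2^-1) * stepC K) = 2 * pi%:C.
  rewrite mulrA mulrDr mulfV ?pnatr_eq0 //.
  have -> : 2 * pi%:C = (2 * pi)%:C :> R[i] by rewrite rmorphM /= -natCE.
  by rewrite -(stepE K) oddE.
by apply: mulfI; rewrite pnatr_eq0.
Qed.

(** At z = m [stepC] the right side of [dirichlet_kernel] is sin (m pi) = 0, whereas z / 2 lies
    strictly between 0 and pi and its sine can be cancelled. *)
Lemma sum_half0_cos K m : (0 < m)%N -> (m < K.*2.+1)%N ->
  \sum_(n < K.+1) half0 n * ccos (n%:R * (m%:R * stepC K)) = 0.
Proof.
move=> m0 mK; have := dirichlet_kernel (m%:R * stepC K) K.
have -> : (K%:R + 2^-1) * (m%:R * stepC K) = (m%:R * pi)%:C.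
  by rewrite mulrCA step_half (natCE m) -rmorphM.
rewrite csin_natpi => /eqP.
rewrite mulf_eq0 => /orP[|/eqP //].
rewrite mulf_eq0 pnatr_eq0 /=.
have -> : m%:R * stepC K / 2 = (m%:R * step K / 2)%:C.
  by rewrite /stepC (natCE 2) (natCE m) -rmorphM -fmorphV -rmorphM.
rewrite csin_real => /eqP[] s0.
have : 0 < sin (m%:R * step K / 2).
  apply: sin_gt0_pi.
  have -> : m%:R * step K / 2 = m%:R / (K.*2.+1)%:R * pi.
    have M0 : (K.*2.+1)%:R != 0 :> R by rewrite pnatr_eq0.
    by rewrite /step; move: (K.*2.+1)%:R M0 => M M0; field.
  rewrite mulr_gt0 ?pi_gt0 ?divr_gt0 ?ltr0n //=.
  by rewrite -[ltRHS]mul1r ltr_pM2r ?pi_gt0 // ltr_pdivrMr ?ltr0n // mul1r ltr_nat.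
by rewrite s0 ltxx.
Qed.

Lemma sum_half0 K : \sum_(n < K.+1) half0 n = (K.*2.+1)%:R / 2.
Proof.
rewrite big_ord_recl /= (eq_bigr (fun=> 1)) => [|i _ //].
rewrite sumr_const card_ord /half0 /=.
by rewrite oddE; field.
Qed.

(** The product formula leaves the frequencies j + k and |j - k|, both below 2K + 1, so only a zero
    frequency contributes. For j = k = 0 both are zero, and the factor [half0 k] corrects the
    doubling. *)
Lemma half0_orthogonal K j k : (j <= K)%N -> (k <= K)%N ->
  half0 k * (4 / (K.*2.+1)%:R) * (\sum_(n < K.+1) half0 n *
    (ccos (n%:R * (j%:R * stepC K)) * ccos (n%:R * (k%:R * stepC K)))) = (j == k)%:R.
Proof.
move=> jK kK; have M0 : (K.*2.+1)%:R != 0 :> R[i] by rewrite pnatr_eq0.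
pose G m := \sum_(n < K.+1) half0 n * ccos (n%:R * (m%:R * stepC K)).
have G0 m : G m = if m == 0%N then (K.*2.+1)%:R / 2 else G m.
  case: ifP => // /eqP ->; rewrite -sum_half0; apply: eq_bigr => n _.
  by rewrite mul0r mulr0 ccos0 mulr1.
pose d := if (j <= k)%N then (k - j)%N else (j - k)%N.
have -> : \sum_(n < K.+1) half0 n * (ccos (n%:R * (j%:R * stepC K)) *
    ccos (n%:R * (k%:R * stepC K))) = (G (j + k)%N + G d) / 2.
  rewrite /G -big_split /= big_distrl /=; apply: eq_bigr => n _.
  rewrite ccosM -mulrDr -mulrBr -mulrDl -mulrBl -natrD.
  have -> : ccos (n%:R * ((j%:R - k%:R) * stepC K)) = ccos (n%:R * (d%:R * stepC K)).
    rewrite /d; case: (leqP j k) => jk; last by rewrite natrB // ltnW.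
    by rewrite natrB // -opprB mulNr mulrN ccosN.
  by field.
have [jk|jk] := eqVneq j k.
  have -> : G d = (K.*2.+1)%:R / 2 by rewrite G0 /d jk leqnn subnn.
  rewrite -jk; have [j0|j0] := eqVneq j 0%N.
    rewrite j0 addn0 G0 /half0 /= mulr1n.
    by move: (K.*2.+1)%:R M0 => M M0; field.
  rewrite /half0 (negbTE j0) /G sum_half0_cos ?mulr1n.
  - by move: (K.*2.+1)%:R M0 => M M0; field.
  - by rewrite addn_gt0 lt0n j0.
  - by rewrite -addnn ltnS leq_add.
have d0 : (0 < d)%N.
  by rewrite /d; case: (leqP j k) => h; rewrite subn_gt0 // ltn_neqAle jk.
rewrite /G !sum_half0_cos ?addr0 ?mul0r ?mulr0 //.
- by rewrite /d; case: (leqP j k) => h; rewrite ltnS -addnn (leq_trans (leq_subr _ _)) // (leq_trans _ (leq_addr _ _)).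
- rewrite addn_gt0; move: jk; case: (j) => //=; case: (k) => //.
- by rewrite ltnS -addnn leq_add.
Qed.

(** With M = 2K + 1 this is sin (pi z) / (M sin (pi z / M)), the periodic analogue of [csinc]; as a
    cosine sum it is defined for every complex z. *)
Definition dsinc K z : R[i] :=
  2 / (K.*2.+1)%:R * (\sum_(k < K.+1) half0 k * ccos (k%:R * (stepC K * z))).

(** Expanding the pair of kernels in cosines and exchanging the sums, orthogonality in n keeps only
    k = j. The point w is an arbitrary complex number; the frequency must lie on the grid. *)
Lemma dsinc_interpolation K j w : (j <= K)%N ->
  \sum_(n < K.+1) half0 n * (ccos (n%:R * (j%:R * stepC K)) *
     (dsinc K (w - n%:R) + dsinc K (w + n%:R))) = ccos (w * (j%:R * stepC K)).
Proof.
move=> jK.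
have dE n : dsinc K (w - n%:R) + dsinc K (w + n%:R) = \sum_(k < K.+1)
    half0 k * (4 / (K.*2.+1)%:R) * ccos (w * (k%:R * stepC K)) * ccos (n%:R * (k%:R * stepC K)).
  rewrite /dsinc -mulrDr -big_split big_distrr /=; apply: eq_bigr => k _.
  rewrite -mulrDr -!mulrA; set h := half0 k; set c := _^-1.
  rewrite [ccos (w * _) * _]ccosM.
  have -> : k%:R * (stepC K * (w - n%:R)) = w * (k%:R * stepC K) - n%:R * (k%:R * stepC K) by ring.
  have -> : k%:R * (stepC K * (w + n%:R)) = w * (k%:R * stepC K) + n%:R * (k%:R * stepC K) by ring.
  by field.
transitivity (\sum_(k < K.+1) ccos (w * (k%:R * stepC K)) * (half0 k * (4 / (K.*2.+1)%:R) *
  (\sum_(n < K.+1) half0 n *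
    (ccos (n%:R * (j%:R * stepC K)) * ccos (n%:R * (k%:R * stepC K)))))).
  under eq_bigr do rewrite dE 2!big_distrr /=.
  rewrite exchange_big /=; apply: eq_bigr => k _; rewrite !big_distrr /=.
  by apply: eq_bigr => n _; ring.
rewrite (bigD1 (Ordinal (jK : (j < K.+1)%N))) //= half0_orthogonal // eqxx mulr1.
rewrite big1 ?addr0 // => k kj; have kK : (k <= K)%N by rewrite -ltnS.
rewrite half0_orthogonal //.
have -> : (j == k) = false; last by rewrite mulr0.
by apply/negbTE; rewrite eq_sym; apply: contra kj => /eqP kj; apply/eqP/val_inj.
Qed.

Lemma dsincE K z :
  (K.*2.+1)%:R * csin (pi%:C * z / (K.*2.+1)%:R) * dsinc K z = csin (pi%:C * z).
Proof.
have M0 : (K.*2.+1)%:R != 0 :> R[i] by rewrite pnatr_eq0.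
have := dirichlet_kernel (stepC K * z) K; rewrite mulrA step_half => <-.
rewrite /dsinc; have -> : stepC K * z / 2 = pi%:C * z / (K.*2.+1)%:R.
  have e : (K.*2.+1)%:R * stepC K = 2 * pi%:C by rewrite stepE rmorphM /= -natCE.
  apply: (mulfI M0); rewrite !mulrA e; move: (K.*2.+1)%:R M0 => M M0.
  by field.
by move: (K.*2.+1)%:R M0 => M M0; field.
Qed.

Lemma dsinc0 K : dsinc K 0 = 1.
Proof.
rewrite /dsinc; under eq_bigr do rewrite !mulr0 ccos0 mulr1.
have M0 : (K.*2.+1)%:R != 0 :> R[i] by rewrite pnatr_eq0.
by rewrite sum_half0; move: (K.*2.+1)%:R M0 => M M0; field.
Qed.

Lemma csin_shift_nat z n : csin (pi%:C * (z - n%:R)) = (- 1) ^+ n * csin (pi%:C * z) /\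
  csin (pi%:C * (z + n%:R)) = (- 1) ^+ n * csin (pi%:C * z).
Proof.
have e : pi%:C * n%:R = (n%:R * pi)%:C :> R[i] by rewrite natCE mulrC rmorphM.
by rewrite mulrBr mulrDr e csinB csinD csin_natpi ccos_natpi; split; ring.
Qed.

(* The product of the two sines in the denominators is sin^2 b - sin^2 a with
   a = pi n / M in [0, pi/2], so that only Jordan's inequality is needed. *)
Lemma dsinc_pair_bound w : exists2 c : R, 0 <= c & exists n0, forall K n,
  (n0 <= n)%N -> (n <= K)%N ->
  cabs (dsinc K (w - n%:R) + dsinc K (w + n%:R)) <= c / n%:R ^+ 2.
Proof.
pose c1 := 4 * (pi * cabs w) * expR (pi * cabs w).
have pw0 : 0 <= pi * cabs w by rewrite mulr_ge0 ?pi_ge0 ?cabs_ge0.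
have c10 : 0 <= c1 by rewrite /c1 mulr_ge0 ?expR_ge0 // mulr_ge0.
pose c2 := cabs (csin (pi%:C * w)); have c20 : 0 <= c2 := cabs_ge0 _.
exists (16 * c1 * c2); first by rewrite mulr_ge0 // mulr_ge0.
(* For n >= 3 c1 one gets |sin b| <= n / (3 M) against sin a >= n / (2 M), and 1/4 - 1/9 >= 1/8
   bounds the denominator from below. The threshold is independent of K. *)
exists (maxn 1 (Num.bound (3 * c1))) => K n; rewrite geq_max => /andP[n1 nb] nK.
have n0 : 0 < n%:R :> R by rewrite ltr0n.
have nc : 3 * c1 <= n%:R.
  apply: le_trans (ltW (archi_boundP _)) _; first by rewrite mulr_ge0.
  by rewrite ler_nat.
set M : R := (K.*2.+1)%:R; have M0 : 0 < M by rewrite ltr0n.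
have M1 : 1 <= M by rewrite ler1n.
have MC : (K.*2.+1)%:R = M%:C by rewrite natCE.
have MC0 : M%:C != 0 by rewrite -MC pnatr_eq0.
have := dsincE K (w - n%:R); have := dsincE K (w + n%:R).
have [-> ->] := csin_shift_nat w n; rewrite MC.
set b := pi%:C * w / M%:C; set a := pi * n%:R / M.
have aE : a%:C = pi%:C * n%:R / M%:C.
  by rewrite /a natCE !rmorphM fmorphV.
have -> : pi%:C * (w + n%:R) / M%:C = b + a%:C by rewrite aE /b; ring.
have -> : pi%:C * (w - n%:R) / M%:C = b - a%:C by rewrite aE /b; ring.
set A1 := dsinc K (w + n%:R); set A2 := dsinc K (w - n%:R) => E1 E2.
(* After clearing denominators the numerators add up to 2 sin b cos a. The factor sin b = O(1/M),
   which is due to the pairing, makes the powers of M cancel and leaves 1/n^2. *)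
have key : M%:C * (csin b ^+ 2 - (sin a)%:C ^+ 2) * (A2 + A1) =
    (- 1) ^+ n * csin (pi%:C * w) * (2 * csin b * (cos a)%:C).
  have p1 : csin b ^+ 2 - (sin a)%:C ^+ 2 = csin (b + a%:C) * csin (b - a%:C).
    have := ccos2Dcsin2 b; have := ccos2Dcsin2 a%:C.
    rewrite csinD csinB csin_real ccos_real => h1 h2.
    have -> : (csin b * (cos a)%:C + ccos b * (sin a)%:C) *
       (csin b * (cos a)%:C - ccos b * (sin a)%:C) =
      csin b ^+ 2 * (cos a)%:C ^+ 2 - ccos b ^+ 2 * (sin a)%:C ^+ 2 by ring.
    have -> : (cos a)%:C ^+ 2 = 1 - (sin a)%:C ^+ 2 by rewrite -h1; ring.
    have -> : ccos b ^+ 2 = 1 - csin b ^+ 2 by rewrite -h2; ring.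
    ring.
  have p2 : 2 * csin b * (cos a)%:C = csin (b + a%:C) + csin (b - a%:C).
    by rewrite csinD csinB ccos_real; ring.
  rewrite p1 p2 mulrDr.
  have -> : M%:C * (csin (b + a%:C) * csin (b - a%:C)) * A2 =
    csin (b + a%:C) * (M%:C * csin (b - a%:C) * A2) by ring.
  have -> : M%:C * (csin (b + a%:C) * csin (b - a%:C)) * A1 =
    csin (b - a%:C) * (M%:C * csin (b + a%:C) * A1) by ring.
  by rewrite E1 E2; ring.
have bM : cabs b <= pi * cabs w / M.
  by rewrite /b !cabsM cabsV !cabs_real (ger0_norm (@pi_ge0 R)) (ger0_norm (ltW M0)).
have sb : cabs (csin b) <= c1 / M.
  apply: le_trans (cabs_csin_lin b) _.
  have -> : c1 / M = 4 * (pi * cabs w / M) * expR (pi * cabs w) by rewrite /c1; ring.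
  apply: ler_pM; rewrite ?mulr_ge0 ?cabs_ge0 ?expR_ge0 //; first by rewrite ler_pM2l.
  rewrite ler_expR (le_trans bM) // ler_pdivrMr // ler_peMr //.
have a0 : 0 <= a by rewrite divr_ge0 ?mulr_ge0 ?pi_ge0 ?ler0n ?(ltW M0).
have sa : a / 4 <= sin a.
  apply: sin_ge_quarter => //.
  rewrite /a -mulrA ler_wpM2l ?pi_ge0 // ler_pdivrMr // ler_pdivlMl //.
  by rewrite /M -natrM ler_nat mul2n (leq_trans (_ : _ <= K.*2)%N) ?leq_double.
have an : n%:R / (2 * M) <= sin a.
  apply: le_trans sa; rewrite /a.
  have -> : n%:R / (2 * M) = 2 * (n%:R / M / 4) by field; rewrite gt_eqF.
  have -> : pi * n%:R / M / 4 = pi * (n%:R / M / 4) by ring.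
  by rewrite ler_wpM2r ?pi_ge2 // !divr_ge0 // ltW.
have den : n%:R ^+ 2 / (8 * M ^+ 2) <= cabs (csin b ^+ 2 - (sin a)%:C ^+ 2).
  have t1 : (sin a) ^+ 2 <= cabs (csin b ^+ 2 - (sin a)%:C ^+ 2) + cabs (csin b) ^+ 2.
    have := cabsB (csin b ^+ 2) (csin b ^+ 2 - (sin a)%:C ^+ 2).
    have -> : csin b ^+ 2 - (csin b ^+ 2 - (sin a)%:C ^+ 2) = ((sin a) ^+ 2)%:C.
      by rewrite rmorphXn; ring.
    by rewrite cabs_real (ger0_norm (sqr_ge0 _)) cabsX addrC.
  have t2 : (n%:R / (2 * M)) ^+ 2 <= (sin a) ^+ 2.
    rewrite lerXn2r ?nnegrE ?divr_ge0 ?mulr_ge0 ?(ltW M0) //.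
    by apply: le_trans an; rewrite divr_ge0 // mulr_ge0 // ltW.
  have t3 : cabs (csin b) ^+ 2 <= (n%:R / (3 * M)) ^+ 2.
    rewrite lerXn2r ?nnegrE ?cabs_ge0 ?divr_ge0 ?mulr_ge0 ?(ltW M0) //.
    apply: le_trans sb _; rewrite invfM mulrA ler_wpM2r ?invr_ge0 ?(ltW M0) //.
    by rewrite ler_pdivlMr // mulrC.
  have e1 : (n%:R / (2 * M)) ^+ 2 = (n%:R / M) ^+ 2 / 4 by field; rewrite gt_eqF.
  have e2 : (n%:R / (3 * M)) ^+ 2 = (n%:R / M) ^+ 2 / 9 by field; rewrite gt_eqF.
  have e3 : n%:R ^+ 2 / (8 * M ^+ 2) = (n%:R / M) ^+ 2 / 8 by field; rewrite gt_eqF.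
  have e4 : 0 <= (n%:R / M) ^+ 2 by exact: sqr_ge0.
  move: t1 t2 t3; rewrite e1 e2 e3; move: (_ ^+ 2) e4 => X e4 t1 t2 t3; lra.
have den0 : 0 < n%:R ^+ 2 / (8 * M ^+ 2) by rewrite divr_gt0 ?mulr_gt0 ?exprn_gt0.
have := congr1 (@cabs R) key.
rewrite !cabsM !cabs_real cabsX cabsN cabs1 expr1n mul1r -/c2 (ger0_norm (ltW M0)) cabs_nat => E.
have num : M * (n%:R ^+ 2 / (8 * M ^+ 2)) * cabs (A2 + A1) <= c2 * (2 * (c1 / M)).
  apply: (@le_trans _ _ (M * cabs (csin b ^+ 2 - (sin a)%:C ^+ 2) * cabs (A2 + A1))).
    by rewrite ler_wpM2r ?cabs_ge0 // ler_pM2l.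
  rewrite E ler_wpM2l // -[leRHS]mulr1; apply: ler_pM; rewrite ?mulr_ge0 ?cabs_ge0 ?cos_max //.
  by rewrite ler_pM2l.
rewrite ler_pdivlMr ?exprn_gt0 //.
have e5 : M * (n%:R ^+ 2 / (8 * M ^+ 2)) * cabs (A2 + A1) = cabs (A2 + A1) * n%:R ^+ 2 / (8 * M).
  by field; rewrite gt_eqF.
have e6 : c2 * (2 * (c1 / M)) = 16 * c1 * c2 / (8 * M) by field; rewrite gt_eqF.
by move: num; rewrite e5 e6 ler_pM2r // invr_gt0 mulr_gt0.
Qed.

End CosineInterpolation.

(** * The cardinal series of a cosine as a limit of interpolation formulas *)

Section ShannonCosine.
Context {R : realType}.
Implicit Types (z w : R[i]) (n j k m K N : nat) (t : R).

Lemma sum_inv_sqr N M : (0 < N)%N ->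
  \sum_(N <= n < M) (n%:R ^+ 2)^-1 <= 2 / N%:R :> R.
Proof.
move=> N0; have Nr : 0 < N%:R :> R by rewrite ltr0n.
have [MN|NM] := leqP M N; first by rewrite big_geq // divr_ge0 // ltW.
suff H m : \sum_(N <= n < N + m) (n%:R ^+ 2)^-1 <= 2 / N%:R - 2 / (N + m)%:R :> R.
  rewrite -(subnKC (ltnW NM)); apply: le_trans (H _) _.
  by rewrite lerBlDr lerDl divr_ge0.
elim: m => [|m IH]; first by rewrite addn0 big_geq // subrr.
rewrite addnS big_nat_recr ?leq_addr //=.
have x0 : 0 < (N + m)%:R :> R by rewrite ltr0n addn_gt0 N0.
have x1 : 1 <= (N + m)%:R :> R by rewrite ler1n addn_gt0 N0.
rewrite -[(N + m).+1%:R]natr1; move: (N + m)%:R x0 x1 IH => x x0 x1 IH.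
have h : (x ^+ 2)^-1 <= 2 / x - 2 / (x + 1).
  rewrite -subr_ge0.
  have -> : 2 / x - 2 / (x + 1) - (x ^+ 2)^-1 = (x - 1) / (x ^+ 2 * (x + 1)).
    by field; rewrite !gt_eqF // addr_gt0.
  by rewrite divr_ge0 ?subr_ge0 // mulr_ge0 ?sqr_ge0 // addr_ge0 // ltW.
by apply: le_trans (lerD IH h) _; rewrite addrA subrK.
Qed.

Lemma clim_dsinc z : clim (fun K => dsinc K z) (csinc z).
Proof.
rewrite /csinc; have [->|z0] := eqVneq z 0.
  by under eq_fun do rewrite dsinc0; exact: clim_cst.
pose S := csin (pi%:C * z) / (pi%:C * z).
have p0 := @pi_gt0 R; have cz : 0 < cabs z by rewrite cabs_gt0.
have pC0 : pi%:C != 0 :> R[i] by rewrite -cabs_gt0 cabs_real normr_gt0 gt_eqF.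
pose p := pi * cabs z; have pp : 0 < p by rewrite mulr_gt0.
have cpz : cabs (pi%:C * z) = p by rewrite cabsM cabs_real ger0_norm // ltW.
pose c4 := 8 * p ^+ 2 * expR p.
have c40 : 0 <= c4 by rewrite mulr_ge0 ?expR_ge0 // mulr_ge0 // sqr_ge0.
(* Beyond this threshold M sin u is within p / 2 of pi z, where p = |pi z|, so its modulus is at
   least p / 2 and the quotients can be compared. *)
apply: (@clim_rate _ _ _ (2 * c4 * cabs S / p) (Num.bound (2 * c4 / p))) => K bK.
set M : R := (K.*2.+1)%:R.
have M0 : 0 < M by rewrite ltr0n.
have M1 : 1 <= M by rewrite ler1n.
have MK : K.+1%:R <= M by rewrite ler_nat ltnS -addnn leq_addr.
have MC : (K.*2.+1)%:R = M%:C by rewrite natCE.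
have MC0 : M%:C != 0 by rewrite -MC pnatr_eq0.
have big : 2 * c4 / p <= M.
  apply: le_trans (ltW (archi_boundP _)) _.
    by rewrite divr_ge0 ?(ltW pp) // mulr_ge0.
  by rewrite ler_nat (leq_trans bK) // (leq_trans _ (leqnSn _)) // -addnn leq_addr.
have := dsincE K z; rewrite MC; set u := pi%:C * z / M%:C => E.
have uE : cabs u = p / M by rewrite /u cabsM cabsV cpz cabs_real ger0_norm // ltW.
have near : cabs (M%:C * csin u - pi%:C * z) <= c4 / M.
  have -> : M%:C * csin u - pi%:C * z = M%:C * (csin u - u) by rewrite /u; field.
  rewrite cabsM cabs_real (ger0_norm (ltW M0)).
  apply: (@le_trans _ _ (M * (8 * (p / M) ^+ 2 * expR p))).
    rewrite ler_pM2l //; apply: le_trans (cabs_csinB u) _; rewrite uE.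
    apply: ler_wpM2l; first by rewrite mulr_ge0 // sqr_ge0.
    by rewrite ler_expR ler_pdivrMr // ler_peMr // ltW.
  by rewrite le_eqVlt; apply/orP; left; apply/eqP; rewrite /c4; field; rewrite gt_eqF.
have low : p / 2 <= cabs (M%:C * csin u).
  have := cabs_triangle (M%:C * csin u) (pi%:C * z) 0; rewrite !subr0 cpz cabsC => h.
  have h' : c4 / M <= p / 2.
    by rewrite ler_pdivrMr // mulrC; move: big; rewrite ler_pdivrMr //; lra.
  have -> : p / 2 = p - p / 2 by field.
  rewrite lerBlDr (le_trans h) // addrC lerD2l.
  exact: le_trans near h'.
have e1 : M%:C * csin u * (dsinc K z - S) = - ((M%:C * csin u - pi%:C * z) * S).
  rewrite mulrBr E /S; have Z0 : pi%:C * z != 0 by rewrite mulf_neq0.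
  by move: (pi%:C * z) Z0 (csin u) => Z Z0 v; field.
have e2 : cabs (M%:C * csin u) * cabs (dsinc K z - S) =
    cabs (M%:C * csin u - pi%:C * z) * cabs S.
  by rewrite -cabsM e1 cabsN cabsM.
have h1 : p / 2 * cabs (dsinc K z - S) <= c4 / M * cabs S.
  apply: (@le_trans _ _ (cabs (M%:C * csin u) * cabs (dsinc K z - S))).
    by rewrite ler_wpM2r ?cabs_ge0.
  by rewrite e2 ler_wpM2r ?cabs_ge0.
have -> : cabs (dsinc K z - S) = (p / 2 * cabs (dsinc K z - S)) * (2 / p).
  by field; rewrite gt_eqF.
have -> : 2 * c4 * cabs S / p / K.+1%:R = (c4 / K.+1%:R * cabs S) * (2 / p).
  by field; rewrite gt_eqF //= nat1r pnatr_eq0.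
rewrite ler_wpM2r ?divr_ge0 ?(ltW pp) //; apply: le_trans h1 _.
rewrite ler_wpM2r ?cabs_ge0 // ler_wpM2l // lef_pV2 ?posrE ?ltr0n //.
Qed.

(** As t <= pi is half a period, t / step is at most K + 1/2, and its integer part stays among the
    frequencies up to K for which the interpolation formula holds. *)
Lemma grid_approximation t : 0 <= t <= pi -> exists2 j : nat -> nat,
  forall K, (j K <= K)%N & forall K, (j K)%:R * step K <= t <= (j K).+1%:R * step K.
Proof.
move=> /andP[t0 tp].
have s0 K : 0 < step K :> R by rewrite divr_gt0 ?ltr0n // mulr_gt0 // pi_gt0.
have fl K := truncn_itv (divr_ge0 t0 (ltW (s0 K))).
exists (fun K => Num.truncn (t / step K)) => K; have /andP[l1 l2] := fl K.
  have h : (Num.truncn (t / step K))%:R <= (K.*2.+1)%:R / 2 :> R.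
    apply: le_trans l1 _; rewrite ler_pdivrMr //.
    have M0 : (K.*2.+1)%:R != 0 :> R by rewrite pnatr_eq0.
    by rewrite /step; move: (K.*2.+1)%:R M0 => M M0; have -> : M / 2 * (2 * pi / M) = pi by field.
  by move: h; rewrite ler_pdivlMr // -natrM ler_nat muln2 -leq_half_double doubleK.
by rewrite -ler_pdivlMr // l1 /= ltW // -ltr_pdivrMr.
Qed.

Lemma clim_ccos_scale w (u : nat -> R) t : (forall K, 0 <= u K <= t) ->
  clim (fun K => (u K)%:C) t%:C -> clim (fun K => ccos (w * (u K)%:C)) (ccos (w * t%:C)).
Proof.
move=> u0t ut e e0; pose c := 4 * cabs w * expR (cabs w * t).
have c0 : 0 <= c by rewrite mulr_ge0 ?expR_ge0 // mulr_ge0 // cabs_ge0.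
have d0 : 0 < e / (c + 1) by rewrite divr_gt0 // ltr_wpDl.
have [n0 h] := ut _ d0; exists n0 => K n0K; have /andP[u0 uK] := u0t K.
rewrite cabsC; apply: le_trans (ccos_lipschitz w u0 uK) _.
have := h K n0K; rewrite cabsC -rmorphB cabs_real ger0_norm ?subr_ge0 // ler_pdivlMr ?ltr_wpDl //.
move=> h1; rewrite -/c; have h2 : 0 <= t - u K by rewrite subr_ge0.
by nra.
Qed.

Lemma norm_half0 n : cabs (half0 n : R[i]) <= 1.
Proof.
rewrite /half0; case: ifP => _; last by rewrite cabs1.
by rewrite cabsV cabs_nat invf_le1 // ler1n.
Qed.

Definition sincpair w n : R[i] := csinc (w - n%:R) + csinc (w + n%:R).

(** For the grid frequency just below t the formula is exact, so the error of the first N terms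
    equals the terms from N to K. [dsinc_pair_bound] controls these uniformly in K and t, and with N
    fixed K tends to infinity. The constant depends on w, but not on t. *)
Lemma shannon_cosine w : exists2 C : R, 0 <= C & exists2 n0, (0 < n0)%N &
  forall N, (n0 <= N)%N -> forall t, 0 <= t <= pi ->
    cabs (ccos (w * t%:C) - \sum_(n < N) half0 n *
      (ccos (n%:R * t%:C) * sincpair w n)) <= C / N%:R.
Proof.
have [c c0 [n0 bnd]] := dsinc_pair_bound w.
exists (2 * c); first by rewrite mulr_ge0.
exists (maxn 1 n0); first by rewrite leq_max.
move=> N; rewrite geq_max => /andP[N0 n0N] t t0p.
have [j jK jt] := grid_approximation t0p.
pose u K := (j K)%:R * step K : R.
have uC K : (u K)%:C = (j K)%:R * stepC K :> R[i] by rewrite (natCE (j K)) /u rmorphM.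
have u0t K : 0 <= u K <= t.
  have /andP[h1 _] := jt K; rewrite h1 andbT mulr_ge0 // divr_ge0 // mulr_ge0 //.
  exact: pi_ge0.
have ut : clim (fun K => (u K)%:C) t%:C.
  apply: (@clim_rate _ _ _ (2 * pi) 0%N) => K _; have /andP[h1 h2] := jt K.
  rewrite cabsC -rmorphB cabs_real ger0_norm ?subr_ge0 //.
  apply: (@le_trans _ _ (step K)).
    by move: h2; rewrite -natr1 mulrDl mul1r /u; lra.
  rewrite /step ler_wpM2l ?mulr_ge0 ?pi_ge0 // lef_pV2 ?posrE ?ltr0n // ler_nat.
  by rewrite ltnS -addnn leq_addr.
pose X K := ccos (w * (u K)%:C) - \sum_(n < N) half0 n *
   (ccos (n%:R * (u K)%:C) * (dsinc K (w - n%:R) + dsinc K (w + n%:R))).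
have Xlim : clim X (ccos (w * t%:C) - \sum_(n < N) half0 n *
      (ccos (n%:R * t%:C) * sincpair w n)).
  apply: climD; first exact: clim_ccos_scale.
  rewrite -mulN1r; under eq_fun do rewrite -mulN1r.
  apply: climM; first exact: clim_cst.
  apply: (clim_sum (f := fun n K => half0 n *
   (ccos (n%:R * (u K)%:C) * (dsinc K (w - n%:R) + dsinc K (w + n%:R))))
   (l := fun n => half0 n * (ccos (n%:R * t%:C) * sincpair w n))) => n _.
  apply: climM; first exact: clim_cst.
  apply: climM; first exact: clim_ccos_scale.
  by apply: climD; exact: clim_dsinc.
apply: (clim_le (n0 := N) Xlim) => K NK.
rewrite /X -[ccos (w * _)](_ : \sum_(n < K.+1) half0 n * (ccos (n%:R * (u K)%:C) *
     (dsinc K (w - n%:R) + dsinc K (w + n%:R))) = _); last first.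
  by rewrite uC; exact: dsinc_interpolation.
pose f n := half0 n * (ccos (n%:R * (u K)%:C) * (dsinc K (w - n%:R) + dsinc K (w + n%:R))).
have -> : \sum_(n < K.+1) f n - \sum_(n < N) f n = \sum_(N <= n < K.+1) f n.
  rewrite -(big_mkord xpredT f) -[X in _ - X](big_mkord xpredT f).
  rewrite (@big_cat_nat _ _ _ N 0 K.+1) ?(leq_trans NK) //=. by rewrite addrAC subrr add0r.
apply: le_trans (cabs_sum _ _ _) _.
have -> : 2 * c / N%:R = c * (2 / N%:R) by ring.
apply: le_trans (ler_wpM2l c0 (sum_inv_sqr K.+1 N0)).
rewrite big_distrr /=; apply: ler_sum_nat => n /andP[Nn nK].
rewrite /f !cabsM -[leRHS]mul1r; apply: ler_pM; rewrite ?mulr_ge0 ?cabs_ge0 ?norm_half0 //.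
rewrite -[leRHS]mul1r; apply: ler_pM; rewrite ?cabs_ge0 //.
  by rewrite natCE -rmorphM ccos_real cabs_real cos_max.
by apply: bnd => //; exact: leq_trans n0N Nn.
Qed.

End ShannonCosine.

(** * Eighth roots and the summation of 1 / ((n + 1) (1 + |w - n|)) *)

Section EighthRoot.
Context {R : realType}.
Implicit Types (x y w A : R) (n k N M : nat).

(** All exponents below are multiples of 1/8: the total order 2 is divided into 6/8 in 1 + |w|,
    which is square-integrable, 1/8 in N, which tends to 0, and 9/8 for a convergent sum over n.
    Nested roots keep every power natural. *)
Definition rt8 x : R := Num.sqrt (Num.sqrt (Num.sqrt x)).

Lemma rt8_ge0 x : 0 <= rt8 x.
Proof. exact: sqrtr_ge0. Qed.

Lemma rt8K x : 0 <= x -> rt8 x ^+ 8 = x.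
Proof.
move=> x0; rewrite (exprM _ 2 4) sqr_sqrtr ?sqrtr_ge0 // (exprM _ 2 2).
by rewrite sqr_sqrtr ?sqrtr_ge0 // sqr_sqrtr.
Qed.

Lemma le_rt8 x y : x <= y -> rt8 x <= rt8 y.
Proof. by move=> xy; rewrite !ler_wsqrtr. Qed.

Lemma rt8_1 : rt8 1 = 1.
Proof. by rewrite /rt8 !sqrtr1. Qed.

Lemma rt8_ge1 x : 1 <= x -> 1 <= rt8 x.
Proof. by move=> x1; rewrite -rt8_1 le_rt8. Qed.

Definition wt x : R := (rt8 (1 + x) ^+ 9)^-1.

Lemma wt_ge0 x : 0 <= wt x.
Proof. by rewrite invr_ge0 exprn_ge0 // rt8_ge0. Qed.

Lemma le_wt x y : 0 <= x -> x <= y -> wt y <= wt x.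
Proof.
move=> x0 xy.
have h1 : 1 <= rt8 (1 + x) by rewrite rt8_ge1 // lerDl.
have h2 : rt8 (1 + x) <= rt8 (1 + y) by rewrite le_rt8 // lerD2l.
rewrite /wt lef_pV2 ?posrE ?exprn_gt0 //; try lra.
by rewrite lerXn2r ?nnegrE //; lra.
Qed.

(** The integral test for x^(-9/8) with primitive -8 x^(-1/8), where r and s are eighth roots of
    consecutive numbers; factoring s^8 - r^8 = 1 serves as the mean value theorem. *)
Lemma wt_telescope (r s : R) : 1 <= r -> r <= s -> s ^+ 8 = r ^+ 8 + 1 ->
  (s ^+ 9)^-1 <= 8 * (r^-1 - s^-1).
Proof.
move=> r1 rs e.
have r0 : 0 < r by lra.
have s0 : 0 < s by lra.
have h : 1 <= (s - r) * (8 * s ^+ 7).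
  apply: (@le_trans _ _ ((s - r) * (\sum_(i < 8) s ^+ (7 - i) * r ^+ i))).
    by rewrite -subrXX e addrAC subrr add0r.
  rewrite ler_wpM2l ?subr_ge0 //.
  have -> : 8 * s ^+ 7 = \sum_(i < 8) s ^+ 7 by rewrite sumr_const card_ord mulr_natl.
  apply: ler_sum => i _; have i7 : (i <= 7)%N by rewrite -ltnS.
  rewrite -[leRHS](_ : s ^+ (7 - i) * s ^+ i = _); last by rewrite -exprD subnK.
  rewrite ler_wpM2l ?exprn_ge0 ?(ltW s0) //.
  by rewrite lerXn2r ?nnegrE ?(ltW r0) ?(ltW s0).
have -> : 8 * (r^-1 - s^-1) = (s - r) * (8 * s ^+ 8) / (r * s ^+ 9).
  by field; rewrite !gt_eqF.
have -> : (s ^+ 9)^-1 = r / (r * s ^+ 9) by field; rewrite !gt_eqF.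
rewrite ler_wpM2r ?invr_ge0 ?mulr_ge0 ?exprn_ge0 ?(ltW r0) ?(ltW s0) //.
apply: le_trans rs _; have -> : (s - r) * (8 * s ^+ 8) = (s - r) * (8 * s ^+ 7) * s by ring.
by rewrite -[leLHS]mul1r ler_wpM2r // ltW.
Qed.

Lemma sum_wt_le N : \sum_(k < N) wt k%:R <= 9.
Proof.
case: N => [|N]; first by rewrite big_ord0.
rewrite big_ord_recl /wt /= addr0 rt8_1 expr1n invr1.
suff : \sum_(i < N) (rt8 (1 + (bump 0 i)%:R) ^+ 9)^-1 <= 8 * (1 - (rt8 N.+1%:R)^-1).
  have : 0 <= (rt8 N.+1%:R)^-1 by rewrite invr_ge0 rt8_ge0.
  by move: (rt8 _)^-1 => ? h1 h2; lra.
elim: N => [|N IH]; first by rewrite big_ord0 rt8_1 invr1 subrr mulr0.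
rewrite big_ord_recr /=; apply: le_trans (lerD IH _) _; last first.
  have -> : 8 * (1 - (rt8 N.+2%:R)^-1) = 8 * (1 - (rt8 N.+1%:R)^-1) +
    8 * ((rt8 N.+1%:R)^-1 - (rt8 N.+2%:R)^-1) by ring.
  exact: lexx.
rewrite nat1r; apply: wt_telescope.
- by rewrite rt8_ge1 // ler1n.
- by rewrite le_rt8 // ler_nat.
- by rewrite !rt8K ?ler0n // natr1.
Qed.

(** For w > 0 the integers up to the integer part of w, and those above it, have distances to w at
    least 0, 1, 2, ... in order, so each side costs at most 9. The left block is summed in
    reverse. *)
Lemma sum_wt_dist_le w N : \sum_(n < N) wt `|w - n%:R| <= 18.
Proof.
have [w0|w0] := leP w 0.
  apply: (@le_trans _ _ (\sum_(n < N) wt n%:R)).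
    apply: ler_sum => n _; apply: le_wt; first exact: ler0n.
    by rewrite distrC ger0_norm; [rewrite lerBrDl gerDr|rewrite subr_ge0 (le_trans w0)].
  by apply: le_trans (sum_wt_le N) _; rewrite ler_nat.
set k := (Num.truncn w).+1.
have /andP[k1 k2] := truncn_itv (ltW w0).
apply: (@le_trans _ _ (\sum_(n < k + N) wt `|w - n%:R|)).
  rewrite [(k + N)%N]addnC big_split_ord /= lerDl; apply: sumr_ge0 => i _; exact: wt_ge0.
rewrite big_split_ord /=; have -> : 18 = 9 + 9 :> R by ring.
apply: lerD.
  apply: le_trans (sum_wt_le k); rewrite [leRHS](reindex_inj rev_ord_inj) /=.
  apply: ler_sum => i _; apply: le_wt; first exact: ler0n.
  have ik : (i <= Num.truncn w)%N by rewrite -ltnS.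
  rewrite subSS natrB //; have iw : i%:R <= w.
    by apply: le_trans k1; rewrite ler_nat.
  by rewrite ger0_norm ?subr_ge0 // lerB.
apply: le_trans (sum_wt_le N); apply: ler_sum => i _; apply: le_wt; first exact: ler0n.
rewrite distrC natrD ger0_norm.
  by rewrite addrAC lerDr subr_ge0 ltW.
by rewrite subr_ge0 (le_trans (ltW k2)) // lerDl.
Qed.

(** With s = a + b and x either of a, b, the factor 1 / s is split as s^(-6/8) s^(-1/8) s^(-1/8) and
    s is replaced by A, c and x respectively; the last piece raises 1 / x to x^(-9/8). *)
Lemma inv_mul_le_wt (a b A c : R) : 1 <= a -> 1 <= b -> 1 <= A -> 1 <= c ->
  A <= a + b -> c <= a ->
  (a * b)^-1 <= (rt8 A ^+ 6 * rt8 c)^-1 * (wt (a - 1) + wt (b - 1)).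
Proof.
move=> a1 b1 A1 c1 Aab ca.
have a0 : 0 < a by lra.
have b0 : 0 < b by lra.
have one x : 1 <= x -> forall s, x <= s -> A <= s -> c <= s ->
    (x * s)^-1 <= (rt8 A ^+ 6 * rt8 c)^-1 * wt (x - 1).
  move=> x1 s xs As cs; rewrite /wt addrC subrK -invfM lef_pV2 ?posrE; last 2 first.
  - by rewrite mulr_gt0 //; lra.
  - rewrite !mulr_gt0 ?exprn_gt0 // (lt_le_trans ltr01) // rt8_ge1 //.
  rewrite -{2}(@rt8K x); last by lra.
  rewrite -(@rt8K s); last by lra.
  have -> : rt8 A ^+ 6 * rt8 c * rt8 x ^+ 9 = rt8 x ^+ 8 * (rt8 A ^+ 6 * rt8 c * rt8 x) by ring.
  have -> : rt8 s ^+ 8 = rt8 s ^+ 6 * rt8 s * rt8 s by ring.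
  rewrite ler_wpM2l ?exprn_ge0 ?rt8_ge0 //.
  apply: ler_pM; rewrite ?mulr_ge0 ?exprn_ge0 ?rt8_ge0 ?le_rt8 //.
  apply: ler_pM; rewrite ?mulr_ge0 ?exprn_ge0 ?rt8_ge0 ?le_rt8 //.
  by rewrite lerXn2r ?nnegrE ?rt8_ge0 ?le_rt8.
have -> : (a * b)^-1 = (a * (a + b))^-1 + (b * (a + b))^-1.
  by field; rewrite !gt_eqF // addr_gt0.
rewrite [leRHS]mulrDr; apply: lerD; apply: one => //; lra.
Qed.

Lemma sum_inv_mul_le w N M : (N <= M)%N ->
  \sum_(N <= n < M) (n.+1%:R * (1 + `|w - n%:R|))^-1 <=
  27 * (rt8 (1 + `|w|) ^+ 6 * rt8 N.+1%:R)^-1.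
Proof.
move=> NM; set c := (rt8 _ ^+ 6 * _)^-1.
have c0 : 0 <= c by rewrite invr_ge0 mulr_ge0 ?exprn_ge0 ?rt8_ge0.
apply: (@le_trans _ _ (\sum_(N <= n < M) c * (wt n%:R + wt `|w - n%:R|))).
  apply: ler_sum_nat => n /andP[Nn _].
  have e1 : wt n%:R = wt (n.+1%:R - 1) by rewrite -natr1 addrK.
  have e2 : wt `|w - n%:R| = wt (1 + `|w - n%:R| - 1).
    by rewrite [1 + _]addrC addrK.
  rewrite e1 e2; apply: inv_mul_le_wt; rewrite ?ler1n ?lerDl ?ler_nat //.
  have := ler_normD (w - n%:R) n%:R; rewrite subrK (ger0_norm (ler0n _ _)) -natr1; lra.
rewrite -big_distrr /= mulrC ler_wpM2r //.
apply: (@le_trans _ _ (\sum_(0 <= n < M) (wt n%:R + wt `|w - n%:R|))).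
  rewrite (@big_cat_nat _ _ _ N 0 M) //= lerDr.
  by apply: sumr_ge0 => n _; rewrite addr_ge0 ?wt_ge0.
rewrite big_mkord big_split /=; have -> : 27 = 9 + 18 :> R by ring.
by apply: lerD; [exact: sum_wt_le|exact: sum_wt_dist_le].
Qed.

End EighthRoot.

(** * An integrable weight on the real line *)

Section SquareIntegrableWeight.
Context {R : realType}.
Local Notation mu := (@lebesgue_measure R).
Implicit Types (x k t : R).

(** Suprema over simple functions are compared directly, so the lemma applies to the squared error
    of a partial sum without a proof that this error is measurable. *)
Lemma ge0_le_integralT (f g : R -> \bar R) : (forall x, 0 <= f x)%E ->
  (forall x, f x <= g x)%E -> (\int[mu]_(x in [set: R]) f x <= \int[mu]_(x in [set: R]) g x)%E.
Proof.
move=> f0 fg; have g0 x : (0 <= g x)%E by exact: le_trans (f0 x) (fg x).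
rewrite !ge0_integralTE //; apply: ge_ereal_sup => _ [h hf <-].
by apply: ereal_sup_ubound; exists h => // x; exact: le_trans (hf x) (fg x).
Qed.

Lemma rt8X12 x : 0 <= x -> rt8 x ^+ 12 = Num.sqrt x ^+ 3.
Proof.
by move=> x0; rewrite (exprM _ 2 6) sqr_sqrtr ?sqrtr_ge0 // (exprM _ 2 3) sqr_sqrtr ?sqrtr_ge0.
Qed.

Lemma continuous_inv_sqrt3 k : 0 < k ->
  continuous (fun t : R => (Num.sqrt (1 + k * `|t|) ^+ 3)^-1).
Proof.
move=> k0; have pos t : 0 < 1 + k * `|t| by rewrite ltr_wpDr // mulr_ge0 // ltW.
move=> t; apply: cvgV; first by rewrite expf_neq0 // gt_eqF // sqrtr_gt0.
apply: (@continuous_comp _ _ _ (fun s : R => Num.sqrt (1 + k * `|s|)) (fun y : R => y ^+ 3));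
  last exact: exprn_continuous.
apply: (@continuous_comp _ _ _ (fun s : R => 1 + k * `|s|) (@Num.sqrt R));
  last exact: sqrt_continuous.
apply: cvgD; first exact: cvg_cst.
by apply: cvgM; [exact: cvg_cst|exact: norm_continuous].
Qed.

Lemma continuous_inv_rt8X12 k : 0 < k ->
  continuous (fun t : R => (rt8 (1 + k * `|t|) ^+ 12)^-1).
Proof.
move=> k0; rewrite (_ : (fun t : R => _) = (fun t : R => (Num.sqrt (1 + k * `|t|) ^+ 3)^-1)).
  exact: continuous_inv_sqrt3.
by apply/funext => t; rewrite rt8X12 // addr_ge0 // mulr_ge0 // ltW.
Qed.

(** The integrand is (1 + k |t|)^(-3/2), the square of the weight in the real-line tail bound. *)
Lemma integral_rt8_lty k : 0 < k -> exists2 J : R, 0 <= J &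
  (\int[mu]_(t in [set: R]) ((rt8 (1 + k * `|t|) ^+ 12)^-1)%:E <= J%:E)%E.
Proof.
move=> k0; pose f t := (Num.sqrt (1 + k * `|t|) ^+ 3)^-1.
have pos t : 0 < 1 + k * `|t| by rewrite ltr_wpDr // mulr_ge0 // ltW.
have f0 t : 0 <= f t by rewrite invr_ge0 exprn_ge0 // sqrtr_ge0.
have cf : continuous f := continuous_inv_sqrt3 k0.
(* A primitive on the half-line t >= 0, where the absolute value disappears; evenness supplies the
   other half. *)
pose F t := - (2 / k) * (Num.sqrt (1 + k * t))^-1.
have dF t : 0 <= t -> is_derive t 1 F (f t).
  move=> t0; have p : 0 < 1 + k * t by have := pos t; rewrite ger0_norm.
  have dh : is_derive t (1 : R) (fun s : R => 1 + k * s) k.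
    by apply: is_derive_eq; rewrite /GRing.scale /=; ring.
  have ds := is_derive1_sqrt p.
  have dG : is_derive t (1 : R) (fun s : R => Num.sqrt (1 + k * s)) (k * (2 * Num.sqrt (1 + k * t))^-1).
    have := @is_derive1_comp R (@Num.sqrt R) (fun s : R => 1 + k * s) t _ _ ds dh.
    by rewrite mulrC.
  have s0 : Num.sqrt (1 + k * t) != 0 by rewrite gt_eqF // sqrtr_gt0.
  have dV := @is_deriveV _ (fun s : R => Num.sqrt (1 + k * s)) t _ _ s0 dG.
  rewrite /F; apply: is_derive_eq; rewrite /GRing.scale /= /f ger0_norm //.
  move: (Num.sqrt (1 + k * t)) s0 => s s0.
  by field; rewrite s0 gt_eqF.
have J1 : (\int[mu]_(t in `[0%R, +oo[) (f t)%:E = 0%:E - (F 0)%:E)%E.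
  apply: ge0_continuous_FTC2y.
  - by move=> t _.
  - exact: continuous_subspaceT.
  - rewrite -[X in _ --> X](mulr0 (- (2 / k))); apply: cvgM; first exact: cvg_cst.
    apply/gtr0_cvgV0.
      apply: (filterS _ (nbhs_pinfty_ge (num_real (0 : R)))) => t t0.
      by rewrite sqrtr_gt0 ltr_wpDr // mulr_ge0 ?(ltW k0).
    apply/cvgryPge => A.
    apply: (filterS _ (nbhs_pinfty_ge (num_real (A ^+ 2 / k)))) => t t1.
    apply: le_trans (ler_norm _) _; rewrite -sqrtr_sqr ler_wsqrtr //.
    by move: t1; rewrite ler_pdivrMr // mulrC => /le_trans; apply; rewrite lerDr.
  - by move=> t t0; have := dF t (ltW t0) => d; apply: ex_derive.
  - have := dF 0 (lexx 0) => d; apply: cvg_at_right_filter.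
    by apply: differentiable_continuous; apply/derivable1_diffP; apply: ex_derive.
  - move=> t; rewrite in_itv /= andbT => t0; rewrite derive1E.
    by have := dF t (ltW t0) => d; apply: derive_val.
exists (2 * (0 - F 0)).
  rewrite mulr_ge0 // sub0r /F mulr0 addr0 sqrtr1 invr1 mulr1 opprK divr_ge0 //.
  exact: ltW.
under eq_integral do rewrite rt8X12 ?(ltW (pos _)) //.
have ef : f =1 f \o -%R by move=> t; rewrite /f /= normrN.
rewrite (ge0_symfun_integralT f0 cf ef) -set_itvcy J1.
by rewrite -EFinB -EFinM.
Qed.

End SquareIntegrableWeight.

(** * Modes of convergence of cardinal series *)

Section CardinalSeries.
Context {R : realType}.
Local Notation mu := (@lebesgue_measure R).
Implicit Types (x t C : R) (z w rho : R[i]) (n N M : nat).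

Lemma csincE z : pi%:C * z * csinc z = csin (pi%:C * z).
Proof.
rewrite /csinc; case: eqVneq => [->|z0]; first by rewrite mulr0 mul0r csin0.
have Z0 : pi%:C * z != 0.
  by rewrite mulf_neq0 // -cabs_gt0 cabs_real normr_gt0 gt_eqF ?pi_gt0.
by move: (pi%:C * z) Z0 (csin _) => Z Z0 v; field.
Qed.

Lemma cabs_csinc_real x : cabs (csinc x%:C) <= 2 / (1 + `|x|).
Proof.
have p2 := @pi_ge2 R; have y0 := normr_ge0 x.
have [->|x0] := eqVneq x 0.
  by rewrite /csinc eqxx cabs1 normr0 addr0 divr1 ler1n.
have yp : 0 < `|x| by rewrite normr_gt0.
have := congr1 (@cabs R) (csincE x%:C).
rewrite !cabsM !cabs_real (ger0_norm (@pi_ge0 R)) -rmorphM csin_real cabs_real => E.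
have s1 := sin_max (pi * x); have s2 := norm_sin_le (pi * x).
rewrite normrM (ger0_norm (@pi_ge0 R)) in s2.
rewrite ler_pdivlMr; last lra.
have p0 : 0 < pi * `|x| by rewrite mulr_gt0 ?pi_gt0.
rewrite -(ler_pM2l p0) mulrA E.
move: s1 s2 y0 yp p2; set s := `|sin _|; move: `|x| (pi : R) => y p s1 s2 y0 yp p2.
have : s * y <= 1 * y by rewrite ler_wpM2r.
have : 1 * y <= p * y by rewrite ler_wpM2r //; lra.
lra.
Qed.

(** The scale [kap] is a positive multiple of x - L, hence negative in both applications; by
    evenness its absolute value is what counts. *)
Definition cardinal_term (kap : R) (c : nat -> R[i]) n rho :=
  c n * sincpair (kap%:C * rho) n.

Lemma cabs_cardinal_term_real kap c C n t : (forall n, cabs (c n) <= C / n.+1%:R) ->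
  cabs (cardinal_term kap c n t%:C) <= 2 * C *
   ((n.+1%:R * (1 + `|kap * t - n%:R|))^-1 + (n.+1%:R * (1 + `|- (kap * t) - n%:R|))^-1).
Proof.
move=> cC; rewrite /cardinal_term /sincpair -rmorphM (natCE n) -rmorphB -rmorphD cabsM.
apply: (@le_trans _ _ (C / n.+1%:R * (2 / (1 + `|kap * t - n%:R|) + 2 / (1 + `|kap * t + n%:R|)))).
  apply: ler_pM; rewrite ?cabs_ge0 //.
  by apply: le_trans (cabsD _ _) _; apply: lerD; exact: cabs_csinc_real.
rewrite -opprD normrN !invfM le_eqVlt; apply/orP; left; apply/eqP; ring.
Qed.

(** The two sincs of a pair are treated as centred at w and at -w, each costing 27; hence 108 = 2
    (27 + 27). *)
Lemma sum_cardinal_term_real kap c C t N M : (forall n, cabs (c n) <= C / n.+1%:R) ->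
  (N <= M)%N -> \sum_(N <= n < M) cabs (cardinal_term kap c n t%:C) <=
  108 * C * (rt8 (1 + `|kap * t|) ^+ 6 * rt8 N.+1%:R)^-1.
Proof.
move=> cC NM.
have C0 : 0 <= C by apply: le_trans (cabs_ge0 (c 0%N)) _; rewrite -[C]divr1.
apply: le_trans (ler_sum_nat _) _.
  by move=> n _; exact: cabs_cardinal_term_real.
rewrite -big_distrr /= big_split /=.
have h1 := sum_inv_mul_le (kap * t) NM.
have := sum_inv_mul_le (- (kap * t)) NM; rewrite normrN => h2.
have -> : 108 * C * (rt8 (1 + `|kap * t|) ^+ 6 * rt8 N.+1%:R)^-1 = 2 * C *
  (27 * (rt8 (1 + `|kap * t|) ^+ 6 * rt8 N.+1%:R)^-1 +
   27 * (rt8 (1 + `|kap * t|) ^+ 6 * rt8 N.+1%:R)^-1) by ring.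
by rewrite ler_wpM2l ?mulr_ge0 // lerD.
Qed.

(** Over the common denominator w^2 - n^2 the numerators combine to 2 w sin (pi w), up to sign and
    the factor pi; n >= 2 W keeps the denominator above n^2 / 2. *)
Lemma cabs_sincpair_disk w n (W : R) : cabs w <= W -> (0 < n)%N -> 2 * W <= n%:R ->
  cabs (sincpair w n) <= 8 * W * expR (pi * W) / n%:R ^+ 2.
Proof.
move=> wW n0 Wn; have w0 := cabs_ge0 w; have W0 : 0 <= W := le_trans w0 wW.
have nr : 0 < n%:R :> R by rewrite ltr0n.
have p2 := @pi_ge2 R; have p0 := @pi_gt0 R.
have key : pi%:C * (w ^+ 2 - n%:R ^+ 2) * sincpair w n =
    (- 1) ^+ n * csin (pi%:C * w) * (2 * w).
  have -> : pi%:C * (w ^+ 2 - n%:R ^+ 2) * sincpair w n =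
    (w + n%:R) * (pi%:C * (w - n%:R) * csinc (w - n%:R)) +
    (w - n%:R) * (pi%:C * (w + n%:R) * csinc (w + n%:R)) by rewrite /sincpair; ring.
  by rewrite !csincE; have [-> ->] := csin_shift_nat w n; ring.
have := congr1 (@cabs R) key; rewrite !cabsM cabsX cabsN cabs1 expr1n mul1r cabs_nat.
rewrite cabs_real (ger0_norm (ltW p0)) => E.
have sB : cabs (csin (pi%:C * w)) <= 2 * expR (pi * W).
  apply: le_trans (cabs_csin_le _) _; rewrite ler_pM2l // ler_expR.
  apply: le_trans (Im_le_cabs _) _; rewrite cabsM cabs_real (ger0_norm (ltW p0)).
  by rewrite ler_pM2l.
have den : n%:R ^+ 2 / 2 <= cabs (w ^+ 2 - n%:R ^+ 2).
  have := cabsB (w ^+ 2) (w ^+ 2 - n%:R ^+ 2).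
  have -> : w ^+ 2 - (w ^+ 2 - n%:R ^+ 2) = n%:R ^+ 2 by ring.
  rewrite !cabsX cabs_nat => h.
  have h2 : cabs w ^+ 2 <= (n%:R / 2) ^+ 2.
    rewrite lerXn2r ?nnegrE ?cabs_ge0 ?divr_ge0 //.
    by apply: le_trans wW _; rewrite ler_pdivlMr // mulrC.
  have e : (n%:R / 2) ^+ 2 = n%:R ^+ 2 / 4 :> R by field.
  have e0 : 0 <= n%:R ^+ 2 :> R by exact: sqr_ge0.
  rewrite e in h2; lra.
rewrite ler_pdivlMr ?exprn_gt0 //.
have s0 := cabs_ge0 (sincpair w n).
have h1 : n%:R ^+ 2 / 2 * cabs (sincpair w n) <=
    pi * cabs (w ^+ 2 - n%:R ^+ 2) * cabs (sincpair w n).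
  rewrite ler_wpM2r //; apply: le_trans den _; rewrite -[leLHS]mul1r ler_wpM2r ?cabs_ge0 //.
  lra.
have h2 : cabs (csin (pi%:C * w)) * (2 * cabs w) <= 2 * expR (pi * W) * (2 * W).
  by apply: ler_pM; rewrite ?cabs_ge0 ?mulr_ge0 ?cabs_ge0 // ler_pM2l.
have e : 2 * expR (pi * W) * (2 * W) = 8 * W * expR (pi * W) / 2 by field.
move: h1 h2; rewrite E e; move: (cabs (sincpair w n)) (n%:R ^+ 2) => a b; lra.
Qed.

Lemma cabs_psum_tail (u : nat -> R[i] -> R[i]) z l N (B : R) :
  clim (fun M => psum u M z) l ->
  (forall M, (N <= M)%N -> \sum_(N <= n < M) cabs (u n z) <= B) ->
  cabs (psum u N z - l) <= B.
Proof.
move=> ul uB; rewrite cabsC.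
have h : clim (fun M => psum u M z - psum u N z) (l - psum u N z).
  by apply: climD => //; exact: clim_cst.
apply: (clim_le (n0 := N) h) => M NM; apply: le_trans (uB M NM).
rewrite /psum -(big_mkord xpredT (fun n => u n z)) -[X in _ - X](big_mkord xpredT (fun n => u n z)).
rewrite (@big_cat_nat _ _ _ N 0 M) //= addrAC subrr add0r; exact: cabs_sum.
Qed.

(** On disks the decay of the sinc pairs suffices and the coefficients are merely bounded by C; on
    the real line the rate C / (n + 1) of the coefficients is used. *)
Lemma cardinal_series_props kap c C (F : R[i] -> R[i]) : kap != 0 ->
  (forall n, cabs (c n) <= C / n.+1%:R) ->
  (forall z, clim (fun N => psum (cardinal_term kap c) N z) (F z)) ->
  series_props (cardinal_term kap c) F.
Proof.
move=> kap0 cC uF.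
have C0 : 0 <= C by apply: le_trans (cabs_ge0 (c 0%N)) _; rewrite -[C]divr1.
have tailR t N : cabs (psum (cardinal_term kap c) N t%:C - F t%:C) <=
    108 * C * (rt8 (1 + `|kap * t|) ^+ 6 * rt8 N.+1%:R)^-1.
  by apply: cabs_psum_tail => // M NM; exact: sum_cardinal_term_real.
have rA t : 1 <= rt8 (1 + `|kap * t|) by rewrite rt8_ge1 // lerDl.
have rN N : 1 <= rt8 N.+1%:R :> R by rewrite rt8_ge1 // ler1n.
have rlarge (X : R) : exists N0, forall N, (N0 <= N)%N -> X < rt8 N.+1%:R.
  exists (Num.bound (`|X| ^+ 8)) => N hN; rewrite ltNge; apply/negP => h.
  have : N.+1%:R <= `|X| ^+ 8.
    rewrite -[N.+1%:R]rt8K // lerXn2r ?nnegrE ?rt8_ge0 //.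
    exact: le_trans h (ler_norm _).
  apply/negP; rewrite -ltNge; apply: lt_le_trans (archi_boundP _) _; first exact: exprn_ge0.
  by rewrite ler_nat (leq_trans hN).
have unifR e : 0 < e -> exists N0, forall N, (N0 <= N)%N -> forall t,
    cabs (psum (cardinal_term kap c) N t%:C - F t%:C) < e.
  move=> e0; have [N0 h] := rlarge (108 * C / e); exists N0 => N /h hN t.
  apply: le_lt_trans (tailR t N) _.
  have r0 : 0 < rt8 N.+1%:R :> R by have := rN N; lra.
  apply: (@le_lt_trans _ _ (108 * C / rt8 N.+1%:R)); last first.
    by rewrite ltr_pdivrMr // [ltRHS]mulrC -ltr_pdivrMr.
  rewrite ler_wpM2l ?mulr_ge0 // lef_pV2 ?posrE //; last first.
    by rewrite mulr_gt0 // exprn_gt0 // (lt_le_trans ltr01).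
  by rewrite -[leLHS]mul1r ler_wpM2r ?(ltW r0) // exprn_ege1.
split; [|split; [|split]].
- move=> r r0 e e0.
  pose W := `|kap| * r; have W0 : 0 <= W by rewrite mulr_ge0 // ltW.
  pose D := C * (8 * W * expR (pi * W)).
  have D0 : 0 <= D by rewrite mulr_ge0 // mulr_ge0 ?expR_ge0 // mulr_ge0.
  exists (maxn 1 (maxn (Num.bound (2 * W)) (Num.bound (2 * D / e)))) => N.
  rewrite !geq_max => /and3P[N1 NW ND] z zr.
  have Nr : 0 < N%:R :> R by rewrite ltr0n.
  have WN : 2 * W <= N%:R.
    apply: le_trans (ltW (archi_boundP _)) _; first by rewrite mulr_ge0.
    by rewrite ler_nat.
  have DN : 2 * D / e < N%:R.
    apply: lt_le_trans (archi_boundP _) _; first by rewrite divr_ge0 ?(ltW e0) // mulr_ge0.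
    by rewrite ler_nat.
  apply: (@le_lt_trans _ _ (D * (2 / N%:R))); last first.
    by rewrite mulrA ltr_pdivrMr // [ltRHS]mulrC -ltr_pdivrMr // [D * 2]mulrC.
  apply: cabs_psum_tail => // M NM.
  apply: le_trans (ler_wpM2l D0 (sum_inv_sqr M N1)).
  rewrite big_distrr /=; apply: ler_sum_nat => n /andP[Nn _].
  have -> : D * (n%:R ^+ 2)^-1 = C * (8 * W * expR (pi * W) / n%:R ^+ 2).
    by rewrite /D -!mulrA.
  rewrite /cardinal_term cabsM; apply: ler_pM; rewrite ?cabs_ge0 //.
    apply: le_trans (cC n) _; rewrite -[leRHS]mulr1; apply: ler_wpM2l => //.
    by rewrite invf_le1 ?ltr0Sn // ler1n.
  apply: cabs_sincpair_disk; last 2 first.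
  + exact: leq_trans Nn.
  + by apply: le_trans WN _; rewrite ler_nat.
  by rewrite cabsM cabs_real ler_wpM2l.
- move=> t; pose S N := \sum_(n < N) cabs (cardinal_term kap c n t%:C).
  have cS : cvgn S.
    apply: nondecreasing_is_cvgn.
      apply/nondecreasing_seqP => n; rewrite /S big_ord_recr /= lerDl; exact: cabs_ge0.
    exists (108 * C * (rt8 (1 + `|kap * t|) ^+ 6 * rt8 1)^-1) => _ [N _ <-].
    have := @sum_cardinal_term_real kap c C t 0 N cC (leq0n N).
    by rewrite big_mkord.
  exists (limn S) => e e0; have := cS; move/cvgrPdist_lt => /(_ e e0) [N0 _ h].
  by exists N0 => N /h; rewrite distrC.
- move=> e e0; have [N0 h] := unifR e e0; exists N0 => N hN z /= z0.
  have -> : z = (complex.Re z)%:C by apply: complex_eq.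
  exact: h.
- move=> e e0.
  have k0 : 0 < `|kap| by rewrite normr_gt0.
  have [J J0 hJ] := integral_rt8_lty k0.
  pose D := (108 * C) ^+ 2; have D0 : 0 <= D by exact: sqr_ge0.
  have [N0 h] := rlarge (D * J / e); exists N0 => N /h hN.
  have r0 : 0 < rt8 N.+1%:R :> R by have := rN N; lra.
  (* Squaring the tail bound produces two factors 1 / [rt8 N.+1%:R]; one is kept for the convergence
     and the other is bounded by 1. *)
  apply: (@le_lt_trans _ _ (\int[mu]_(t in [set: R])
     ((D / rt8 N.+1%:R)%:E * ((rt8 (1 + `|kap| * `|t|) ^+ 12)^-1)%:E))%E).
    apply: ge0_le_integralT => t; first by rewrite lee_fin sqr_ge0.
    rewrite -EFinM lee_fin.
    apply: (@le_trans _ _ ((108 * C * (rt8 (1 + `|kap * t|) ^+ 6 * rt8 N.+1%:R)^-1) ^+ 2)).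
      rewrite lerXn2r ?nnegrE ?cabs_ge0 //.
      by apply: le_trans (cabs_ge0 _) (tailR t N).
    rewrite -normrM; have a0 : 0 < rt8 (1 + `|kap * t|) by have := rA t; lra.
    have -> : (108 * C * (rt8 (1 + `|kap * t|) ^+ 6 * rt8 N.+1%:R)^-1) ^+ 2 =
      D / rt8 N.+1%:R * (rt8 (1 + `|kap * t|) ^+ 12)^-1 * (rt8 N.+1%:R)^-1.
      by rewrite /D; field; rewrite !gt_eqF.
    rewrite -[leRHS]mulr1; apply: ler_wpM2l.
      apply: mulr_ge0; first by rewrite divr_ge0 // ltW.
      by rewrite invr_ge0 exprn_ge0 // ltW.
    by rewrite invf_le1.
  rewrite ge0_integralZl_EFin //; last 3 first.
  + by move=> t _; rewrite lee_fin invr_ge0 exprn_ge0 // rt8_ge0.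
  + apply/measurable_EFinP; apply: continuous_measurable_fun.
    exact: continuous_inv_rt8X12.
  + by rewrite divr_ge0 // ltW.
  apply: (@le_lt_trans _ _ ((D / rt8 N.+1%:R)%:E * J%:E)%E).
    by rewrite lee_wpmul2l // lee_fin divr_ge0 // ltW.
  rewrite -EFinM lte_fin mulrAC ltr_pdivrMr // [ltRHS]mulrC.
  by move: hN; rewrite ltr_pdivrMr.
Qed.

End CardinalSeries.

(** * Sampling series of functions of cosine type *)

Section CosineTypeSampling.
Context {R : realType}.
Implicit Types (a t kap K L : R) (z k : R[i]) (n N : nat) (F : R[i] -> R[i]).

Lemma psum_cardinal kap c N z :
  psum (cardinal_term kap c) N z = \sum_(n < N) c n * sincpair (kap%:C * z) n.
Proof. by []. Qed.

Lemma cosine_type_cardinal a kap F : 0 < a -> `|kap| = a / pi ->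
  (forall r, 0 <= r -> exists2 M : R, 0 <= M & cosine_type r a M F) ->
  forall z, clim (fun N => psum (cardinal_term kap
    (fun n => half0 n * F (n%:R / kap)%:C)) N z) (F z).
Proof.
move=> a0 kapE hF z.
have p0 := @pi_gt0 R.
have kap0 : kap != 0 by rewrite -normr_gt0 kapE divr_gt0.
have [M M0 FM] := hF `|complex.Im z| (normr_ge0 _).
have [C C0 [n0 n00 sh]] := shannon_cosine (kap%:C * z).
apply: (@clim_rate _ _ _ (2 * (M * C)) n0) => N nN.
have N0 : (0 < N)%N by exact: leq_trans nN.
have Nr : 0 < N%:R :> R by rewrite ltr0n.
(* Index 0 carries the point z with weight 1 and index m + 1 the node m / kap. The nodes are real,
   so all points lie in the strip |Im k| <= |Im z|. *)
pose al n : R[i] := if n is m.+1 then - (half0 m * sincpair (kap%:C * z) m) else 1.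
pose rh n : R[i] := if n is m.+1 then (m%:R / kap)%:C else z.
rewrite cabsC; apply: (@le_trans _ _ (M * (C / N%:R))); last first.
  have -> : 2 * (M * C) / N.+1%:R = M * C * (2 / N.+1%:R) by ring.
  rewrite mulrA ler_wpM2l ?mulr_ge0 // ler_pdivlMr ?ltr0Sn // mulrC ler_pdivrMr //.
  by rewrite -natrM ler_nat mul2n -addnn -addn1 leq_add.
have -> : F z - psum (cardinal_term kap (fun n => half0 n * F (n%:R / kap)%:C)) N z =
    \sum_(i < N.+1) al i * F (rh i).
  rewrite big_ord_recl /= mul1r psum_cardinal -sumrN; congr (_ + _).
  by apply: eq_bigr => i _; rewrite add0n; ring.
apply: FM => [[|m] _ //=|t /andP[t0 ta]]; first by rewrite normr0.
(* The dilation of [0, a] onto [0, pi]; the sign of [kap] is lost, which evenness of the cosine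
   allows. *)
pose tau := pi * t / a.
have tau0 : 0 <= tau by rewrite divr_ge0 ?(ltW a0) // mulr_ge0 // ltW.
have taup : tau <= pi by rewrite ler_pdivrMr // ler_pM2l.
have tE : a / pi * tau = t.
  by rewrite /tau; move: (pi : R) p0 => p p0; field; rewrite !gt_eqF.
have := sh N nN tau; rewrite tau0 taup => /(_ isT); congr (cabs _ <= _).
rewrite big_ord_recl /= mul1r -sumrN; congr (_ + _).
  have -> : kap%:C * z * tau%:C = z * (kap * tau)%:C by rewrite (rmorphM (real_complex R) kap tau) /=; ring.
  by rewrite -ccos_norm normrM kapE (ger0_norm tau0) tE.
apply: eq_bigr => i _; rewrite add0n mulNr; congr (- _).
have nE : `|i%:R / kap * t| = i%:R * tau.
  rewrite !normrM normfV kapE (ger0_norm (ler0n _ _)) (ger0_norm t0) /tau.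
  by move: (pi : R) p0 => p p0; field; rewrite !gt_eqF.
have -> : ccos ((i%:R / kap)%:C * t%:C) = ccos (i%:R * tau%:C).
  rewrite (natCE i) -!rmorphM /= -nE.
  by have := ccos_norm 1 (i%:R / kap * t); rewrite !mul1r.
ring.
Qed.

Lemma cosine_type_series a kap F K : 0 < a -> `|kap| = a / pi ->
  (forall r, 0 <= r -> exists2 M : R, 0 <= M & cosine_type r a M F) ->
  (forall t, t != 0 -> cabs (F t%:C) <= K / `|t|) ->
  series_props (cardinal_term kap (fun n => half0 n * F (n%:R / kap)%:C)) F.
Proof.
move=> a0 kapE hF FK; have p0 := @pi_gt0 R.
have k0 : 0 < `|kap| by rewrite kapE divr_gt0.
have kap0 : kap != 0 by rewrite -normr_gt0.
have K0 : 0 <= K.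
  by have := FK 1 (oner_neq0 _); rewrite normr1 divr1; apply: le_trans; exact: cabs_ge0.
(* The first summand covers n = 0, where the decay hypothesis says nothing; the 2 replaces 1/n by 2
   / (n + 1) for n >= 1. *)
apply: (cardinal_series_props (C := cabs (F 0) + 2 * (K * `|kap|))) => //; last first.
  exact: (cosine_type_cardinal a0 kapE hF).
have KK : 0 <= 2 * (K * `|kap|) by rewrite mulr_ge0 // mulr_ge0.
move=> n; rewrite cabsM; apply: (@le_trans _ _ (1 * cabs (F (n%:R / kap)%:C))).
  by rewrite ler_wpM2r ?cabs_ge0 // norm_half0.
rewrite mul1r; case: n => [|n]; first by rewrite mul0r divr1 lerDl.
apply: le_trans (FK _ _) _; first by rewrite mulf_neq0 ?invr_eq0 ?pnatr_eq0.
rewrite normrM normfV (ger0_norm (ler0n _ _)) invfM invrK.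
apply: (@le_trans _ _ (2 * (K * `|kap|) / n.+2%:R)); last first.
  by rewrite ler_wpM2r ?invr_ge0 // lerDr cabs_ge0.
have -> : K * (n.+1%:R^-1 * `|kap|) = K * `|kap| * n.+1%:R^-1 by ring.
have -> : 2 * (K * `|kap|) / n.+2%:R = K * `|kap| * (2 / n.+2%:R) by ring.
rewrite ler_wpM2l ?mulr_ge0 // ler_pdivlMr ?ltr0Sn // mulrC ler_pdivrMr ?ltr0Sn //.
by rewrite -natrM ler_nat mul2n -addnn addSn ltnS leq_addl.
Qed.

Lemma sum_double (V : nmodType) (f : nat -> V) N : (forall n, f n.*2 = 0) ->
  \sum_(n < N.*2) f n = \sum_(n < N) f n.*2.+1.
Proof.
move=> f0; elim: N => [|N IH]; first by rewrite !big_ord0.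
by rewrite doubleS !big_ord_recr /= IH f0 addr0.
Qed.

(** The N-th partial sum of v is the 2N-th of u, so every mode of convergence passes to v. *)
Lemma series_props_odd (u v : nat -> R[i] -> R[i]) F :
  (forall n z, u n.*2 z = 0) -> (forall n z, v n z = u n.*2.+1 z) ->
  series_props u F -> series_props v F.
Proof.
move=> u0 vu.
have pE N z : psum v N z = psum u N.*2 z.
  by rewrite /psum (sum_double (f := fun n => u n z)) //; apply: eq_bigr => i _.
have dbl N0 N : (N0 <= N)%N -> (N0 <= N.*2)%N.
  by move=> h; rewrite -addnn (leq_trans h) // leq_addr.
move=> [h1 [h2 [h3 h4]]]; split; [|split; [|split]].
- move=> r r0 e e0; have [N0 h] := h1 r r0 e e0; exists N0 => N NN z zr.
  by rewrite pE; apply: h => //; exact: dbl.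
- move=> t; have [l hl] := h2 t; exists l => e e0; have [N0 h] := hl e e0.
  exists N0 => N NN; have := h N.*2 (dbl _ _ NN).
  rewrite (sum_double (f := fun n => cabs (u n t%:C))) => [|n]; last by rewrite u0 cabs0.
  by under eq_bigr do rewrite -vu.
- move=> e e0; have [N0 h] := h3 e e0; exists N0 => N NN z zr.
  by rewrite pE; apply: h => //; exact: dbl.
- move=> e e0; have [N0 h] := h4 e e0; exists N0 => N NN.
  by under eq_integral do rewrite pE; apply: h; exact: dbl.
Qed.

Lemma cosine_type_real_bound r a M F t : 0 <= r -> cosine_type r a M F ->
  cabs (F t%:C) <= M.
Proof.
move=> r0 FM; have := FM 1%N (fun=> 1) (fun=> t%:C) 1.
rewrite big_ord1 mul1r mulr1; apply => [i _ /=|s _]; first by rewrite normr0.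
by rewrite big_ord1 mul1r -rmorphM ccos_real cabs_real cos_max.
Qed.

Lemma cabs_csin_real t : cabs (csin t%:C) <= 1.
Proof. by rewrite csin_real cabs_real sin_max. Qed.

Lemma cabs_cshc_real t s : t != 0 -> cabs (cshc t%:C s) <= `|t|^-1.
Proof.
move=> t0; have tp : 0 < `|t| by rewrite normr_gt0.
have := congr1 (@cabs R) (cshcE t%:C s); rewrite cabsM cabs_real -rmorphM => E.
by rewrite -[leRHS]mul1r ler_pdivlMr // mulrC E cabs_csin_real.
Qed.

(** Q plays the role of the L_1 norm of q; it comes from the contraction estimate with theta = 1 by
    bounding the exponential weight. *)
Lemma potential_bound L q : cL2 0 L q -> exists2 Q : R, 0 <= Q &
  forall x f K, 0 <= x <= L -> 0 <= K -> cintegrable x L f ->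
    (forall t, x <= t <= L -> cabs (f t) <= cabs (q t) * K) ->
    cabs (cint x L f) <= Q * K.
Proof.
move=> hq; have [lam l0 contr] := volterra_contraction hq ltr01.
exists (expR (lam * L)); first exact: expR_ge0.
move=> x f K /[dup] xL /andP[x0 x_L] K0 fi fq.
apply: le_trans (contr x f K xL K0 fi _) _.
  move=> t /[dup] tL /andP[_ t_L]; apply: le_trans (fq t tL) _; rewrite ler_wpM2l ?cabs_ge0 //.
  by rewrite ler_peMr // -expR0 ler_expR mulr_ge0 ?(ltW l0) // subr_ge0.
by rewrite mul1r mulrC ler_wpM2r // ler_expR ler_wpM2l ?(ltW l0) // lerBlDr lerDl.
Qed.

End CosineTypeSampling.

(** * The sampled functions for T and psi *)

Section Representation.
Context {R : realType}.
Implicit Types (t L x r : R) (k : R[i]) (n N : nat).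

Lemma cosine_kernel_integrable L q k y c d x : 0 <= x <= L -> cintegrable 0 L (fun t => q t * y t) ->
  cintegrable x L (fun t => (ccos (k * (t - c)%:C) - ccos (k * (t - d)%:C)) * (q t * y t : R[i])).
Proof.
move=> /andP[x0 xL] qy; have qyx : cintegrable x L (fun t => q t * y t).
  by apply: cintegrable_sub qy.
have one e : cintegrable x L (fun t => ccos (k * (t - e)%:C) * (q t * y t)).
  have pg : cprimitive x L (fun t => ccos (k * (t - e)%:C))
      (fun t => - k * csin (k * (t - e)%:C)).
    split=> [|s /andP[xs sL]]; first exact: cintegrable_cont (ccontinuousZ _ (ccontinuous_csin k e)).
    rewrite (cint_derivative sL (cderivative_ccos k e) (ccontinuousZ _ (ccontinuous_csin k e))).
    by rewrite opprB addrCA subrr addr0.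
  have [M gM] := cprimitive_bounded pg.
  exact: cintegrable_mul_bounded (ccontinuous_measurable _ _ (ccontinuous_ccos k e)) gM qyx.
by apply: eq_cintegrable (cintegrableB (one c) (one d)) => t _; ring.
Qed.

(** At each t the factor cos (k (t - c)) enlarges the frequency interval of y from L - t to L - t +
    |t - c|; if this stays within a, integration against q preserves the type. *)
Lemma cosine_kernel_type L q (y : R[i] -> R -> R[i]) c d x a r M : cL2 0 L q ->
  0 <= x <= L -> (forall k, cintegrable 0 L (fun t => q t * y k t)) -> 0 <= M -> 0 <= a ->
  (forall t, 0 <= t <= L -> cosine_type r (L - t) M (fun k => y k t)) ->
  (forall t, x <= t <= L -> `|t - c| + (L - t) <= a /\ `|t - d| + (L - t) <= a) ->
  exists2 M' : R, 0 <= M' & cosine_type r a M' (fun k => cint x L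
    (fun t => (ccos (k * (t - c)%:C) - ccos (k * (t - d)%:C)) * (q t * y k t))).
Proof.
move=> hq xL qy M0 a0 yM cd; have [Q Q0 hQ] := potential_bound hq.
have /andP[x0 x_L] := xL.
exists (Q * (2 * M)); first by rewrite mulr_ge0 // mulr_ge0.
move=> n al rh B rhr bB; have B0 := cosine_bounded_ge0 a0 bB.
pose f i t := al i * ((ccos (rh i * (t - c)%:C) - ccos (rh i * (t - d)%:C)) *
  (q t * y (rh i) t)).
have fi i : cintegrable x L (f i).
  by apply: cintegrableZ; exact: cosine_kernel_integrable.
have -> : \sum_(i < n) al i * cint x L (fun t => (ccos (rh i * (t - c)%:C) -
    ccos (rh i * (t - d)%:C)) * (q t * y (rh i) t)) = cint x L (fun t => \sum_(i < n) f i t).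
  rewrite (cint_sum (f := f)) //; apply: eq_bigr => i _; rewrite cintZ //.
  exact: cosine_kernel_integrable.
rewrite -mulrA; apply: hQ => //; first by rewrite mulr_ge0 // mulr_ge0.
  exact: cintegrable_sum.
move=> t /[dup] xtL /andP[xt tL]; have [tc td] := cd t xtL.
have t0L : 0 <= t <= L by rewrite tL (le_trans x0).
have one e : `|t - e| + (L - t) <= a ->
    cabs (\sum_(i < n) (al i * ccos (rh i * (t - e)%:C)) * y (rh i) t) <= M * B.
  move=> te; apply: (yM t t0L n (fun i => al i * ccos (rh i * (t - e)%:C)) rh) => // s /andP[s0 sL].
  have h : `|t - e| + `|s| <= a by rewrite (ger0_norm s0); lra.
  have := cosine_bounded_mulcos h bB; congr (cabs _ <= _).
  by apply: eq_bigr => i _; rewrite mulrA.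
have -> : \sum_(i < n) f i t = q t * (
    (\sum_(i < n) (al i * ccos (rh i * (t - c)%:C)) * y (rh i) t) -
    (\sum_(i < n) (al i * ccos (rh i * (t - d)%:C)) * y (rh i) t)).
  by rewrite -sumrB big_distrr /=; apply: eq_bigr => i _; rewrite /f; ring.
rewrite cabsM ler_wpM2l ?cabs_ge0 //; apply: le_trans (cabsB _ _) _.
have -> : 2 * M * B = M * B + M * B by ring.
by apply: lerD; exact: one.
Qed.

Lemma solution_family_type L q (y : R[i] -> R -> R[i]) a0 b0 : 0 < L -> cL2 0 L q ->
  (forall k, exists y1, is_solution L q k (y k) y1 /\ y k L = a0 /\ y1 L = b0) ->
  [/\ forall k, cintegrable 0 L (fun t => q t * y k t),
    forall k x, 0 <= x <= L -> y k x = a0 * ccos (k * (L - x)%:C) -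
     b0 * cshc k (L - x) + cint x L (fun t => cshc k (t - x) * (q t * y k t)) &
    forall r, 0 <= r -> exists2 M : R, 0 <= M &
      forall t, 0 <= t <= L -> cosine_type r (L - t) M (fun k => y k t)].
Proof.
move=> L0 hq hy.
have qy k : cintegrable 0 L (fun t => q t * y k t).
  by have [y1 [/solution_potential_integrable]] := hy k.
have yV k x : 0 <= x <= L -> y k x = a0 * ccos (k * (L - x)%:C) -
     b0 * cshc k (L - x) + cint x L (fun t => cshc k (t - x) * (q t * y k t)).
  by move=> xL; have [y1 [sol [<- <-]]] := hy k; exact: solution_volterra.
split=> // r r0; apply: volterra_cosine_type yV r0 => // k.
by have [y1 [/solution_bounded]] := hy k.
Qed.

(** For real t the cosine type with r = 0 bounds y, and the kernel is at most 1 / |t|. Uniformity in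
    x is used when T is integrated over [x, L]. *)
Lemma solution_family_real_remainder L q (y : R[i] -> R -> R[i]) a0 b0 :
  0 < L -> cL2 0 L q ->
  (forall k, exists y1, is_solution L q k (y k) y1 /\ y k L = a0 /\ y1 L = b0) ->
  exists2 K : R, 0 <= K & forall t x, t != 0 -> 0 <= x <= L ->
    cabs (y t%:C x - a0 * ccos (t%:C * (L - x)%:C)) <= K / `|t|.
Proof.
move=> L0 hq hy; have [qy yV yM] := solution_family_type L0 hq hy.
have [M M0 hM] := yM 0 (lexx 0); have [Q Q0 hQ] := potential_bound hq.
exists (cabs b0 + Q * M); first by rewrite addr_ge0 ?cabs_ge0 // mulr_ge0.
move=> t x t0 xL; have /andP[x0 x_L] := xL.
have ti : 0 <= `|t|^-1 by rewrite invr_ge0.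
have -> : y t%:C x - a0 * ccos (t%:C * (L - x)%:C) =
    cint x L (fun s => cshc t%:C (s - x) * (q s * y t%:C s)) - b0 * cshc t%:C (L - x).
  by rewrite (yV _ _ xL); ring.
apply: le_trans (cabsB _ _) _; rewrite [leRHS]mulrDl addrC cabsM; apply: lerD.
  by rewrite ler_wpM2l ?cabs_ge0 // cabs_cshc_real.
have -> : Q * M / `|t| = Q * (`|t|^-1 * M) by ring.
apply: hQ => //; first by rewrite mulr_ge0.
  exact: cshc_mul_integrable.
move=> s /andP[xs sL]; rewrite !cabsM mulrCA ler_wpM2l ?cabs_ge0 //.
apply: ler_pM; rewrite ?cabs_ge0 ?cabs_cshc_real //.
by apply: cosine_type_real_bound (lexx 0) (hM s _); rewrite sL (le_trans x0).
Qed.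

(** The sum that the sampling series must have: the representation of T solved for it, with both
    denominators cleared. *)
Definition T_sum (T : R[i] -> R -> R[i]) L x k : R[i] :=
  2 * k * csin (k * (x - L)%:C) * T k x - 2 * csin (k * (x - L)%:C) ^+ 2.

Definition psi_sum (psi : R[i] -> R -> R[i]) L x k : R[i] :=
  psi k x - k * (x - L)%:C * sph_j1 (k * (L - x)%:C).

Lemma csin_oddpi n : csin ((n.*2.+1)%:R * pi / 2)%:C = (- 1) ^+ n :> R[i].
Proof.
have -> : (n.*2.+1)%:R * pi / 2 = n%:R * pi + pi / 2 :> R by rewrite oddE; field.
rewrite rmorphD csinD csin_natpi ccos_natpi mul0r add0r.
by rewrite (csin_real (pi / 2)) sin_pihalf mulr1.
Qed.

(* 2 sin (k (x - L)) sin (k (t - x)) is a difference of two cosines; this turns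
   the factor k sin (k (x - L)) of the paper's formula into a cosine kernel. *)
Lemma T_sum_cint L q T x k : 0 <= x <= L ->
  (forall k, cintegrable 0 L (fun t => q t * T k t)) ->
  (forall k x, 0 <= x <= L -> T k x = 0 * ccos (k * (L - x)%:C) -
     1 * cshc k (L - x) + cint x L (fun t => cshc k (t - x) * (q t * T k t))) ->
  T_sum T L x k = cint x L (fun t => (ccos (k * (t - (x *+ 2 - L))%:C) -
    ccos (k * (t - L)%:C)) * (q t * T k t)).
Proof.
move=> xL qT TV; rewrite /T_sum (TV _ _ xL); set s := csin (k * (x - L)%:C).
have i1 : cintegrable x L (fun t => cshc k (t - x) * (q t * T k t)).
  exact: cshc_mul_integrable.
have sE : k * cshc k (L - x) = - s.
  by rewrite cshcE /s -csinN -mulrN -rmorphN opprB.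
set I := cint x L _.
(* The free term contributes 2 s^2 and cancels against the subtracted square, leaving the integral
   alone. *)
have -> : 2 * k * s * (0 * ccos (k * (L - x)%:C) - 1 * cshc k (L - x) + I) - 2 * s ^+ 2 =
  2 * s * k * I - 2 * s * (k * cshc k (L - x)) - 2 * s ^+ 2 by ring.
rewrite sE; have -> : 2 * s * k * I - 2 * s * - s - 2 * s ^+ 2 = 2 * s * k * I by ring.
rewrite /I -cintZ //; apply: eq_cint => t _.
have -> : 2 * s * k * (cshc k (t - x) * (q t * T k t)) =
  2 * s * (k * cshc k (t - x)) * (q t * T k t) by ring.
rewrite cshcE; congr (_ * _).
have -> : k * (t - (x *+ 2 - L))%:C = - (k * (x - L)%:C - k * (t - x)%:C).
  by rewrite -mulrBr -mulrN -rmorphB -rmorphN; congr (_ * _%:C); rewrite mulr2n; ring.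
have -> : k * (t - L)%:C = k * (x - L)%:C + k * (t - x)%:C.
  by rewrite -mulrDr -rmorphD; congr (_ * _%:C); ring.
by rewrite ccosN ccosB ccosD /s; ring.
Qed.

Lemma T_series_props L q T x : 0 < L -> cL2 0 L q ->
  (forall k, exists T1, is_solution L q k (T k) T1 /\ T k L = 0 /\ T1 L = 1) ->
  0 <= x < L -> series_props (T_term T L x) (T_sum T L x).
Proof.
move=> L0 hq hT /andP[x0 xL]; have xL' : 0 <= x <= L by rewrite x0 ltW.
have [qT TV TM] := solution_family_type L0 hq hT.
have [K K0 hK] := solution_family_real_remainder L0 hq hT.
have [Q Q0 hQ] := potential_bound hq.
have lx0 : 0 < L - x by rewrite subr_gt0.
have xL0 : x - L != 0 by rewrite subr_eq0 lt_eqF.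
have p0 := @pi_gt0 R; have pn : pi != 0 :> R by rewrite gt_eqF.
pose kap : R := 2 * (x - L) / pi.
have FE : T_sum T L x = fun k => cint x L (fun t =>
    (ccos (k * (t - (x *+ 2 - L))%:C) - ccos (k * (t - L)%:C)) * (q t * T k t)).
  by apply/funext => k; exact: T_sum_cint.
have kapE : `|kap| = 2 * (L - x) / pi.
  by rewrite /kap normrM normfV (ger0_norm (ltW p0)) normrM ger0_norm // distrC gtr0_norm.
have a0 : 0 < 2 * (L - x) by rewrite mulr_gt0.
have hF r : 0 <= r -> exists2 M : R, 0 <= M & cosine_type r (2 * (L - x)) M (T_sum T L x).
  move=> r0; have [M M0 hM] := TM r r0; rewrite FE.
  apply: (cosine_kernel_type hq xL' qT M0 (ltW a0) hM) => t /andP[xt tL].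
  (* For the reflected centre 2x - L the two lengths add up to exactly 2 (L - x) at every t; for the
     centre L they give 2 (L - t), largest at t = x. *)
  rewrite mulr2n; split.
    by rewrite ger0_norm; lra.
  by rewrite distrC ger0_norm ?subr_ge0 //; lra.
have dec t : t != 0 -> cabs (T_sum T L x t%:C) <= Q * (2 * K) / `|t|.
  move=> t0; rewrite FE; have ti : 0 <= `|t|^-1 by rewrite invr_ge0.
  (* The difference of cosines is at most 2, and T itself is O(1/|t|) because its value at L is
     0. *)
  have -> : Q * (2 * K) / `|t| = Q * (2 * (K / `|t|)) by ring.
  apply: hQ => //; first by rewrite !mulr_ge0.
    exact: cosine_kernel_integrable.
  move=> s /andP[xs sL]; rewrite !cabsM mulrCA ler_wpM2l ?cabs_ge0 //.
  apply: ler_pM; rewrite ?cabs_ge0 //.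
    apply: le_trans (cabsB _ _) _; rewrite -!rmorphM !ccos_real !cabs_real.
    by have := cos_max (t * (s - (x *+ 2 - L))); have := cos_max (t * (s - L)); lra.
  have := hK t s t0; rewrite mul0r subr0; apply; by rewrite sL (le_trans x0).
have := cosine_type_series a0 kapE hF dec; apply: series_props_odd => [n z|n z].
  (* At even nodes sin (k (x - L)) = 0 and both terms of [T_sum] vanish. *)
  have e : n.*2%:R / kap * (x - L) = n%:R * pi.
    rewrite /kap -muln2 natrM; move: (x - L) xL0 (pi : R) pn => d d0 p pn.
    by field; rewrite ?pn ?d0.
  rewrite /cardinal_term /T_sum -rmorphM e csin_natpi; ring.
rewrite /T_term /cardinal_term /t_coef /sincpair.
have -> : kap%:C * z = 2 * z * (x - L)%:C / pi%:C.
  by rewrite /kap (natCE 2) rmorphM fmorphV rmorphM; ring.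
congr (_ * _); rewrite /half0 /= mul1r /T_sum.
have -> : (n.*2.+1)%:R / kap = (n.*2.+1)%:R * pi / (2 * (x - L)).
  move: (n.*2.+1)%:R => m; rewrite /kap; move: (x - L) xL0 (pi : R) pn => d d0 p pn.
  by field; rewrite ?pn ?d0.
set m := (n.*2.+1)%:R.
(* At odd nodes the sine is (-1)^n and its square is 1, which explains the sign and the -2 in
   [t_coef]. *)
have -> : csin ((m * pi / (2 * (x - L)))%:C * (x - L)%:C) = (- 1) ^+ n.
  rewrite -rmorphM -csin_oddpi; congr (csin _%:C).
  by rewrite -/m; move: (x - L) xL0 => d d0; field; rewrite ?d0.
have -> : ((- 1) ^+ n) ^+ 2 = 1 :> R[i] by rewrite -exprM muln2 -mul2n exprM sqrrN !expr1n.
have -> : 2 * (m * pi / (2 * (x - L)))%:C = (m * pi)%:C / (x - L)%:C.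
  rewrite (natCE 2) -fmorphV -!rmorphM; congr (_%:C).
  by move: (x - L) xL0 => d d0; field; rewrite ?d0.
ring.
Qed.

(** This is - z j_1(z) = cos z - sin z / z; at z = 0 both sides vanish, in agreement with the
    default value of [sph_j1]. *)
Lemma sph_j1_cshc l k : l != 0 :> R -> - (k * l%:C) * sph_j1 (k * l%:C) =
  ccos (k * l%:C) - cshc k l / l%:C.
Proof.
move=> l0; have lC : l%:C != 0 by rewrite -cabs_gt0 cabs_real normr_gt0.
rewrite /sph_j1 /cshc mulf_eq0 (negbTE lC) orbF; case: eqVneq => [->|k0].
  by rewrite mulr0 mul0r ccos0 mulfV // subrr.
by field; rewrite k0 lC.
Qed.

Lemma psi_sumE psi L x k : x < L -> psi_sum psi L x k =
  psi k x - ccos (k * (L - x)%:C) + cshc k (L - x) / (L - x)%:C.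
Proof.
move=> xL; rewrite /psi_sum -(opprB L x) rmorphN mulrN.
by rewrite sph_j1_cshc ?subr_eq0 ?gt_eqF //; ring.
Qed.

Lemma psi_series_props L q psi (H : R[i]) x : 0 < L -> cL2 0 L q ->
  (forall k, exists psi1, is_solution L q k (psi k) psi1 /\ psi k L = 1 /\ psi1 L = - H) ->
  0 <= x < L -> series_props (psi_term psi L x) (psi_sum psi L x).
Proof.
move=> L0 hq hpsi /andP[x0 xL]; have xL' : 0 <= x <= L by rewrite x0 ltW.
have [_ _ pM] := solution_family_type L0 hq hpsi.
have [K K0 hK] := solution_family_real_remainder L0 hq hpsi.
have l0 : 0 < L - x by rewrite subr_gt0.
have ln : L - x != 0 by rewrite gt_eqF.
have xL0 : x - L != 0 by rewrite subr_eq0 lt_eqF.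
have p0 := @pi_gt0 R; have pn : pi != 0 :> R by rewrite gt_eqF.
pose kap : R := (x - L) / pi.
have FE : psi_sum psi L x = fun k => psi k x - ccos (k * (L - x)%:C) + cshc k (L - x) / (L - x)%:C.
  by apply/funext => k; exact: psi_sumE.
have kapE : `|kap| = (L - x) / pi.
  by rewrite /kap normrM normfV (ger0_norm (ltW p0)) distrC gtr0_norm.
have li : cabs ((L - x)%:C^-1) = (L - x)^-1 by rewrite cabsV cabs_real gtr0_norm.
have hF r : 0 <= r -> exists2 M : R, 0 <= M & cosine_type r (L - x) M (psi_sum psi L x).
  (* M for psi, 1 for the cosine, and 2 for sin z / z, the mean of cos (k s) over 0 <= s <= L - x
     with the factor 2 of the complex integral. *)
  move=> r0; have [M M0 hM] := pM r r0; exists (M + 3); first by rewrite addr_ge0.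
  rewrite FE => n al rh B rhr bB.
  have -> : \sum_(i < n) al i * (psi (rh i) x - ccos (rh i * (L - x)%:C) +
      cshc (rh i) (L - x) / (L - x)%:C) =
    \sum_(i < n) al i * psi (rh i) x - \sum_(i < n) al i * ccos (rh i * (L - x)%:C) +
    (L - x)%:C^-1 * \sum_(i < n) al i * (cshc (rh i) (L - x) * ccos (rh i * (0 : R)%:C)).
    rewrite big_distrr /= -sumrB -big_split /=; apply: eq_bigr => i _.
    by rewrite mulr0 ccos0; ring.
  have -> : (M + 3) * B = M * B + B + 2 * B by ring.
  apply: le_trans (cabsD _ _) _; apply: lerD.
    apply: le_trans (cabsB _ _) _; apply: lerD; first exact: hM.
    by apply: bB; rewrite ltW // lexx.
  rewrite cabsM li.
  have h : L - x + `|0 : R| <= L - x by rewrite normr0 addr0.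
  have := cosine_bounded_mulshc (ltW l0) h bB.
  rewrite -[X in _ -> _ * _ <= X](_ : (L - x)^-1 * (2 * (L - x) * B) = _); last by field.
  by apply: ler_wpM2l; rewrite invr_ge0 ltW.
have dec t : t != 0 -> cabs (psi_sum psi L x t%:C) <= (K + (L - x)^-1) / `|t|.
  move=> t0; rewrite FE mulrDl; apply: le_trans (cabsD _ _) _; apply: lerD.
    by have := hK t x t0 xL'; rewrite mul1r.
  by rewrite cabsM li mulrC ler_wpM2l ?cabs_cshc_real // invr_ge0 ltW.
have -> : psi_term psi L x = cardinal_term kap
    (fun n => half0 n * psi_sum psi L x (n%:R / kap)%:C); last first.
  exact: (cosine_type_series l0 kapE hF dec).
apply/funext => n; apply/funext => z; rewrite /psi_term /cardinal_term /sincpair.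
have -> : kap%:C * z = z * (x - L)%:C / pi%:C.
  by rewrite /kap rmorphM fmorphV; ring.
congr (_ * _); rewrite /psi_coef /half0; case: eqVneq => [->|n0].
  (* At k = 0 the Bessel term vanishes, so the sample is psi(0, x) itself, halved by [half0]. *)
  by rewrite /psi_sum mul0r !mul0r subr0 mulrC.
rewrite mul1r FE.
have -> : n%:R / kap = n%:R * pi / (x - L).
  by rewrite /kap invfM invrK mulrCA mulrC mulrAC mulrC mulrA.
set k := n%:R * pi / (x - L).
have kn : k%:C != 0.
  rewrite -cabs_gt0 cabs_real normr_gt0 /k; apply: mulf_neq0; last by rewrite invr_eq0.
  by rewrite mulf_neq0 // pnatr_eq0.
have kL : k%:C * (L - x)%:C = - (n%:R * pi)%:C.
  rewrite -rmorphM -rmorphN; congr (_%:C).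
  by rewrite /k -(opprB x L) mulrN divfK.
rewrite kL ccosN ccos_natpi.
(* sin z / z vanishes at every node with n >= 1, so only the cosine value (-1)^n is subtracted
   there. *)
have -> : cshc k%:C (L - x) = 0.
  apply: (mulfI kn); rewrite cshcE kL csinN csin_natpi; ring.
by rewrite mul0r addr0.
Qed.

End Representation.

Unset Implicit Arguments.

Theorem mainTheorem5 (R : realType) (L : R) (q : R -> R[i]) (H : R[i])
    (T psi : R[i] -> R -> R[i]) (x : R) :
  0 < L ->
  cL2 0 L q ->
  (forall rho : R[i], exists T1 : R -> R[i],
      is_solution L q rho (T rho) T1 /\ T rho L = 0 /\ T1 L = 1) ->
  (forall rho : R[i], exists psi1 : R -> R[i],
      is_solution L q rho (psi rho) psi1 /\ psi rho L = 1 /\ psi1 L = - H) ->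
  0 <= x < L ->
  exists FT FP : R[i] -> R[i],
    series_props (T_term T L x) FT /\
    series_props (psi_term psi L x) FP /\
    (forall rho : R[i], rho != 0 -> csin (rho * (x - L)%:C) != 0 ->
       T rho x = csin (rho * (x - L)%:C) / rho
                 + FT rho / (2 * rho * csin (rho * (x - L)%:C))) /\
    (forall rho : R[i],
       psi rho x = rho * (x - L)%:C * sph_j1 (rho * (L - x)%:C) + FP rho).
Proof.
move=> L0 hq hT hpsi xL.
(* With these witnesses both identities are algebra; the analytic content is that the sampling
   series converge to them. *)
exists (T_sum T L x), (psi_sum psi L x); split; first exact: T_series_props hT xL.
split; first exact: psi_series_props hpsi xL.
split=> [rho rho0 s0|rho]; last by rewrite /psi_sum addrC subrK.
by rewrite /T_sum; move: (csin _) s0 => s s0; field; rewrite rho0 s0.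
Qed.
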